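(* Let $n\ge 1$ and let $\pi\in\mathfrak{S}_n$ be a permutation of $\{1,\dots,n\}$. Then $\pi$ is meandric if and only if for all $i,j\in\{1,\dots,n\}$ one has $$c_\pi(i,j)\equiv\begin{cases}1 \pmod 2, & \text{if } (i,j) \text{ is an inversion of } \pi,\\ 0 \pmod 2, & \text{if } (i,j) \text{ is not an inversion of } \pi.\end{cases}$$
   Context: Inversions: for $\pi\in\mathfrak{S}_n$ and $i,j\in\{1,\dots,n\}$, the pair $(i,j)$ is regarded as unordered and is an inversion of $\pi$ if $i\neq j$ and the smaller of $i,j$ has the larger image under $\pi$ (i.e. $i<j$ and $\pi(i)>\pi(j)$, or $j<i$ and $\pi(j)>\pi(i)$). In particular $(i,i)$ is never an inversion. For $i,j\in\{1,\dots,n\}$ (possibly equal), $c_\pi(i,j)$ is the number of $k\in\{1,\dots,n\}$ such that both $(i,k)$ and $(j,k)$ are inversions of $\pi$ (the number of common inversions of $i$ and $j$). Meanders: a meander of order $n$ is a triple $(\mathcal{D},\{m_0,m_1,p_0,p_1\},\{\mu,\ell\})$ where $\mathcal{D}$ is a 2-dimensional (closed) disk; $m_0,m_1,p_0,p_1$ are four distinct points of $\partial\mathcal{D}$ such that some connected component of $\partial\mathcal{D}\setminus\{m_0,p_0\}$ contains both $m_1$ and $p_1$; and $\mu,\ell:[0,1]\to\mathcal{D}$ are smooth proper embeddings with $\mu(0)=m_0$, $\mu(1)=m_1$, $\ell(0)=p_0$, $\ell(1)=p_1$, such that the curves $\mu$ and $\ell$ intersect transversely, in exactly $n$ points. Meandric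 permutations: label the $n$ intersection points of $\mu$ and $\ell$ by $1,\dots,n$ in the order they are met moving along $\ell$ from $p_0$ to $p_1$. The permutation of the meander is $\pi\in\mathfrak{S}_n$ where $\pi(k)$ is the label of the $k$-th intersection point met moving along $\mu$ from $m_0$ to $m_1$. A permutation is meandric if it is the permutation of some meander of order $n$. *)

(* Defs.v *)
From mathcomp Require Import all_boot all_order all_algebra perm.
From mathcomp Require Import boolp classical_sets functions cardinality.
From mathcomp Require Import set_interval reals topology normedtype derive.
Set Implicit Arguments.
Unset Strict Implicit.
Unset Printing Implicit Defensive.
Import Order.TTheory GRing.Theory Num.Theory.
Import numFieldNormedType.Exports.

Local Open Scope ring_scope.
Local Open Scope classical_set_scope.

(* Positions and values are numbered from 0, i.e. {1, ..., n} is 'I_n. *)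
Definition inversion (n : nat) (p : 'S_n) (i j : 'I_n) : bool :=
  ((i < j) && (p j < p i) || (j < i) && (p i < p j))%N.

Definition common_inversions (n : nat) (p : 'S_n) (i j : 'I_n) : nat :=
  #|[set k : 'I_n | inversion p i k && inversion p j k]%SET|.

Definition unit_segment (R : realType) : set R := `[0, 1].
Arguments unit_segment {R}.

Definition disk (R : realType) (c : R * R) (r : R) : set (R * R) :=
  [set x | (x.1 - c.1) ^+ 2 + (x.2 - c.2) ^+ 2 <= r ^+ 2].

Definition disk_boundary (R : realType) (c : R * R) (r : R) : set (R * R) :=
  [set x | (x.1 - c.1) ^+ 2 + (x.2 - c.2) ^+ 2 = r ^+ 2].

(* A parametrised curve [0, 1] -> R^2 is represented by a C^oo extension of it
   to the whole line: smoothness on the closed interval, endpoints included,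
   means that such an extension exists. All the other conditions only involve
   the parameters in [0, 1], where the velocity g^`() does not depend on the
   chosen extension. *)
Definition smooth (R : realType) (g : R -> R * R) : Prop :=
  forall (k : nat) (t : R), derivable (derive1n k g) t 1.

Definition immersion (R : realType) (g : R -> R * R) : Prop :=
  forall t : R, unit_segment t -> derive1 g t != 0.

Definition homeo_onto_image (R : realType) (g : R -> R * R) : Prop :=
  {within unit_segment, continuous g} /\
  exists h : R * R -> R,
    (forall t : R, unit_segment t -> h (g t) = t) /\
    {within g @` unit_segment, continuous h}.

Definition smooth_embedding (R : realType) (g : R -> R * R) : Prop :=
  [/\ smooth g, immersion g & homeo_onto_image g].

(* Properness of an arc in a manifold with boundary: the boundary of the
   manifold is met exactly at the endpoints of the arc. *)
Definition proper_in_disk (R : realType) (c : R * R) (r : R)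
    (g : R -> R * R) : Prop :=
  (forall t : R, unit_segment t -> disk c r (g t)) /\
  (forall t : R, unit_segment t ->
     (disk_boundary c r (g t) <-> t = 0 \/ t = 1)).

Definition transverse (R : realType) (g h : R -> R * R) : Prop :=
  forall s t : R, unit_segment s -> unit_segment t -> g s = h t ->
  forall v : R * R, exists a b : R, v = a *: derive1 g s + b *: derive1 h t.

Definition intersection (R : realType) (g h : R -> R * R) : set (R * R) :=
  (g @` unit_segment) `&` (h @` unit_segment).

Record meander (R : realType) (n : nat) := Meander {
  center : R * R;
  radius : R;
  m0 : R * R;
  m1 : R * R;
  p0 : R * R;
  p1 : R * R;
  mu : R -> R * R;
  ell : R -> R * R;
  radius_gt0 : 0 < radius;
  endpoints_uniq : uniq [:: m0; m1; p0; p1];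
  endpoints_boundary :
    [/\ disk_boundary center radius m0, disk_boundary center radius m1,
        disk_boundary center radius p0 & disk_boundary center radius p1];
  endpoints_component :
    exists2 x : R * R,
      (disk_boundary center radius `\` [set m0; p0]) x &
      connected_component (disk_boundary center radius `\` [set m0; p0]) x m1 /\
      connected_component (disk_boundary center radius `\` [set m0; p0]) x p1;
  mu_embedding : smooth_embedding mu;
  mu_proper : proper_in_disk center radius mu;
  mu_ends : mu 0 = m0 /\ mu 1 = m1;
  ell_embedding : smooth_embedding ell;
  ell_proper : proper_in_disk center radius ell;
  ell_ends : ell 0 = p0 /\ ell 1 = p1;
  mu_ell_transverse : transverse mu ell;
  mu_ell_card : (intersection mu ell #= `I_n)%card
}.

(* x 0, ..., x (n - 1) are the points of X in the order in which they are met
   when moving along g. *)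
Definition enumerates_along (R : realType) (n : nat) (g : R -> R * R)
    (X : set (R * R)) (x : 'I_n -> R * R) : Prop :=
  range x = X /\
  exists t : 'I_n -> R,
    [/\ forall i, unit_segment (t i),
        forall i j : 'I_n, (i < j)%N -> t i < t j
      & forall i, g (t i) = x i].

(* y i is the intersection point with label i (order along ell), x k is the
   k-th one met along mu; the label of x k is p k. *)
Definition is_meander_perm (R : realType) (n : nat) (M : meander R n)
    (p : 'S_n) : Prop :=
  exists x y : 'I_n -> R * R,
    [/\ enumerates_along (mu M) (intersection (mu M) (ell M)) x,
        enumerates_along (ell M) (intersection (mu M) (ell M)) y
      & forall k : 'I_n, x k = y (p k)].

Definition meandric (R : realType) (n : nat) (p : 'S_n) : Prop :=
  exists M : meander R n, is_meander_perm M p.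

(* Main.v *)
(* For the direct implication, consider F(s, t) = mu(s) - ell(t) on the unit
   square, whose zeros are the intersection points, and the symmetric secant maps
   (mu(s) - mu(s')) / (s - s') and (ell(t) - ell(t')) / (t - t'), which have no
   zero. Winding numbers modulo 2 are expressed by labels of the two sheets of the
   double cover of the punctured plane. Blowing up a transverse zero of F
   compares the labels of F around it with those of the secant maps; going around
   the rectangles bounded by the intersection parameters then evaluates, for two
   intersection points, the parity of the points separating them on both curves.
   The symmetry of the secant maps makes this parity the inversion indicator, and
   the convexity of the disk together with the position of the four endpoints
   fixes the boundary contributions.

   For the converse, put 0 and n + 1 at the two ends of the permutation. Second
   differences of the parity condition show that the chords joining consecutive
   values pi(k), pi(k + 1) do not cross when they lie on the same side, i.e. when
   their indices k have the same parity. Hence the curve that goes through the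
   points pi(k) of a diameter and alternates sides, climbing on each chord to a
   height equal to its length, is injective. It is made smooth by means of a step
   built from exp(-1/x). *)
Require Import Defs.
From mathcomp Require Import all_boot all_order all_algebra perm.
From mathcomp Require Import boolp classical_sets functions cardinality.
From mathcomp Require Import reals topology normedtype derive.
From mathcomp Require Import sequences realfun exp trigo.
From mathcomp Require Import ring lra zify.
Set Implicit Arguments.
Unset Strict Implicit.
Unset Printing Implicit Defensive.
Import Order.TTheory GRing.Theory Num.Theory.
Import numFieldNormedType.Exports.

Local Open Scope ring_scope.
Local Open Scope classical_set_scope.

(** The zeros of [F] are the very points to be counted, so no label of [F] exists on the whole
    square. The substitute is the [discrepancy] of a column: the label carried up that column from
    the lower edge, compared with a label prescribed on a horizontal line. It is constant between
    zeros, flips at each zero lying below the line, and changes by the sign of the crossing when the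
    line passes through the zero itself. Counting along the row of [j] up to [i], and along the row
    of [i] up to [j], leaves unknown labels that the symmetry of the secants removes. The case
    [i = j] needs the parities of [p i] and [i] to agree; this comes from computing each crossing
    sign twice, on the top edge and on the row of the zero, and it is where the position of the
    endpoints enters. In the converse, an arc moves horizontally only while its height exceeds its
    chord length, and never rises more than 1 above that length. A nested chord is shorter by at
    least 1, so the inner arc stays below the outer one. The sine changes sign at each integer, so
    that one formula gives both the alternation of sides and transversality. *)

(** * Connectedness arguments on intervals *)

Lemma connected_locally_constant (T : topologicalType) (A : set T)
    (f : T -> bool) :
  connected A -> (forall p, A p -> \forall q \near p, A q -> f q = f p) ->
  forall p q, A p -> A q -> f p = f q.
Proof.
move=> cA fA p q Ap Aq.
suff AE : A `&` [set r | f r = f p] = A by move: Aq; rewrite -AE => -[_ /= ->].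
apply: cA; first by exists p.
- exists (interior [set r | A r -> f r = f p]); first exact: open_interior.
  apply/seteqP; split => [r /= [Ar fr]|r /= [Ar]].
    split => //; rewrite /interior /=.
    by have := fA _ Ar; rewrite fr.
  by move=> /interior_subset /= /(_ Ar).
- exists (~` interior [set r | A r -> f r <> f p]).
    exact/open_closedC/open_interior.
  apply/seteqP; split => [r /= [Ar fr]|r /= [Ar] H].
    by split => // /interior_subset /= /(_ Ar).
  split => //; apply/eqP; apply: contra_notT H => /eqP fr.
  rewrite /interior /=; have := fA _ Ar.
  by apply: filterS => r' /= + Ar' => /(_ Ar') ->.
Qed.

(** Connectedness replaces a Lebesgue number: by restriction and concatenation, the truth value of
    [Q a x] is locally constant in [x], and it is true at [a]. *)
Lemma interval_induction (R : realType) (Q : R -> R -> Prop) (a b : R) :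
  a <= b ->
  (forall y z, a <= y <= z -> Q a z -> Q a y) ->
  (forall y z, a <= y <= z -> Q a y -> Q y z -> Q a z) ->
  (forall x, a <= x <= b -> exists2 e, 0 < e &
     forall y z, a <= y -> y <= z -> z <= b -> `|x - y| < e -> `|x - z| < e ->
     Q y z) ->
  Q a b.
Proof.
move=> ab Qsub Qcat Qloc.
have Aa : `[a, b]%classic a by rewrite /= in_itv /= lexx.
have Ab : `[a, b]%classic b by rewrite /= in_itv /= lexx andbT.
have Qaa : Q a a.
  have [|e e0 H] := Qloc a; first by rewrite lexx.
  by apply: H => //; rewrite subrr normr0.
suff : `[< Q a a >] = `[< Q a b >] by move/asboolP: (Qaa) => -> /esym/asboolP.
apply: (@connected_locally_constant _ `[a, b]%classic (fun x => `[< Q a x >])) => //.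
  exact: segment_connected.
move=> p /=; rewrite in_itv /= => /andP[ap pb].
have [|e e0 H] := Qloc p; first exact/andP.
near=> q => /=; rewrite in_itv /= => /andP[aq qb].
have pq : `|p - q| < e by near: q; apply: nbhsx_ballx.
have pp : `|p - p| < e by rewrite subrr normr0.
apply/asbool_equiv_eq.
have [lepq|/ltW leqp] := leP p q.
  split => Q1; first by apply: Qsub Q1; apply/andP.
  by apply: (Qcat p) => //; [apply/andP|apply: H].
split => Q1; first by apply: (Qcat q) => //; [apply/andP|apply: H].
by apply: Qsub Q1; apply/andP.
Unshelve. all: by end_near.
Qed.

(** * Parity of winding numbers *)

Section Lift.
Variable R : realType.
Implicit Types u v : R * R.

(** Half-open half-plane: it contains the positive half of the first axis and not the negative one,
    so that exactly one of [u] and [- u] is upper when [u] is nonzero. *)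
Definition upper u := (0 < u.2) || ((u.2 == 0) && (0 < u.1)).

(** Meant for nearby nonzero points: a change of half-plane then crosses one half of the first axis,
    and the sign of [u.1] tells which. *)
Definition crossing u v := (upper u (+) upper v) && (0 < u.1).

Lemma upperN u : u != 0 -> upper (- u) = ~~ upper u.
Proof.
case: u => x y; rewrite /upper /= oppr_eq0 !oppr_gt0 => u0.
case: (ltgtP y 0) => //= y0; case: (ltgtP x 0) => //= x0.
by move: u0; rewrite x0 y0 => /eqP.
Qed.

Lemma upperZ u (k : R) : 0 < k -> upper (k *: u) = upper u.
Proof.
by move=> k0; rewrite /upper /= /GRing.scale /= !pmulr_rgt0// mulf_eq0 (gt_eqF k0).
Qed.

Lemma near_coordinates u (e : R) : 0 < e ->
  \forall v \near u, `|u.1 - v.1| < e /\ `|u.2 - v.2| < e.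
Proof. by move=> e0; near=> v; near: v; exact: nbhsx_ballx. Unshelve. end_near. Qed.

Lemma upper_near u : u != 0 -> \forall v \near u,
  upper v = upper u \/ [/\ u.2 = 0, u.1 != 0 & (0 < v.1) = (0 < u.1)].
Proof.
move=> u0; have [u2|u2] := eqVneq u.2 0.
  have u1 : u.1 != 0.
    by apply: contra_neq u0 => u1; rewrite [u]surjective_pairing u1 u2.
  have e0 : 0 < `|u.1| by rewrite normr_gt0.
  apply: filterS (near_coordinates u e0) => v [+ _] => H; right; split=> //.
  by case: (ltrgt0P u.1) u1 H => [h|h|->]; rewrite ?eqxx// => _; rewrite ltr_norml;
    move=> /andP[h1 h2]; apply/idP/idP; lra.
have e0 : 0 < `|u.2| by rewrite normr_gt0.
apply: filterS (near_coordinates u e0) => v [_ +] => H; left.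
rewrite /upper.
by case: (ltrgt0P u.2) u2 H => [h|h|->]; rewrite ?eqxx// => _; rewrite ltr_norml;
    move=> /andP[h1 h2]; case: (ltrgt0P v.2) => //=; lra.
Qed.

(** Near a nonzero point the crossing indicator is a coboundary, which is what makes sheets exist
    locally. *)
Lemma crossing_local u : u != 0 -> exists2 B : set (R * R), nbhs u B &
  forall v w, B v -> B w ->
  crossing v w = (0 < u.1) && (upper v (+) upper w).
Proof.
move=> u0; have [u2|u2] := eqVneq u.2 0.
  have u1 : u.1 != 0.
    by apply: contra_neq u0 => u1; rewrite [u]surjective_pairing u1 u2.
  have e0 : 0 < `|u.1| by rewrite normr_gt0.
  eexists; first exact: (near_coordinates u e0).
  move=> v w /= [H _] _; rewrite andbC /crossing; congr (_ && _).
  by case: (ltrgt0P u.1) u1 H => [h|h|->]; rewrite ?eqxx// => _; rewrite ltr_norml;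
    move=> /andP[h1 h2]; apply/idP/idP; lra.
have e0 : 0 < `|u.2| by rewrite normr_gt0.
exists [set v | upper v = upper u] => [|v w /= vE wE]; last first.
  by rewrite /crossing vE wE addbb /= andbF.
have := upper_near u0; apply: filterS => v /= [//|[]].
by move/eqP: u2.
Qed.

Section Space.
Variable T : topologicalType.
Implicit Types (A B : set T) (f g : T -> R * R) (c d : T -> bool).

(* [c] selects a sheet of the connected double cover of the punctured plane:
   it changes exactly when [f] crosses the positive half of the first axis. *)
Definition sheet A f c := forall p, A p ->
  \forall q \near p, A q -> c q = c p (+) crossing (f p) (f q).

Lemma sheet_sub A B f c : B `<=` A -> sheet A f c -> sheet B f c.
Proof.
move=> BA fc p /BA Ap; have := fc _ Ap; apply: filterS => q + /BA.
exact.
Qed.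

Lemma sheet_eq A f g c d : (forall p, A p -> f p = g p) ->
  (forall p, A p -> c p = d p) -> sheet A f c -> sheet A g d.
Proof.
move=> fg cd fc p Ap; have := fc _ Ap; apply: filterS => q + Aq => /(_ Aq).
by rewrite -!fg// -!cd.
Qed.

Lemma sheet_addb A f c (b : bool) : sheet A f c -> sheet A f (fun p => b (+) c p).
Proof.
move=> fc p Ap; have := fc _ Ap; apply: filterS => q + Aq => /(_ Aq) ->.
by rewrite addbA.
Qed.

(** The sum of two sheets is locally constant, since both change by the same crossing term. *)
Lemma sheet_unique A f c d : connected A -> sheet A f c -> sheet A f d ->
  forall p q, A p -> A q -> c p (+) c q = d p (+) d q.
Proof.
move=> cA fc fd p q Ap Aq.
suff : c p (+) d p = c q (+) d q.
  by case: (c p); case: (c q); case: (d p); case: (d q).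
apply: (connected_locally_constant (f := fun p => c p (+) d p) cA) => //= r Ar.
apply: filterS2 (fc _ Ar) (fd _ Ar) => s /[swap] + + As => /(_ As) -> /(_ As) ->.
by case: (c r); case: (d r); case: crossing.
Qed.

Lemma sheet_local f p : {for p, continuous f} -> f p != 0 ->
  exists2 B, nbhs p B & exists c, forall A, A `<=` B -> sheet A f c.
Proof.
move=> cf fp0; have [B Bfp BE] := crossing_local fp0.
exists (f @^-1` B); first exact: cf.
exists (fun q => (0 < (f p).1) && upper (f q)) => A AB q Aq.
near=> r => Ar; rewrite BE; try exact: AB.
by case: (0 < _) => //=; rewrite addbA addbb.
Unshelve. all: by end_near.
Qed.

(** On the connected intersection the sheets differ by a constant, which is absorbed into the second
    one. Closedness lets a point outside one of the two sets ignore that set nearby. *)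
Lemma sheet_glue A B f c d : closed A -> closed B ->
  connected (A `&` B) -> sheet A f c -> sheet B f d ->
  exists e, sheet (A `|` B) f e.
Proof.
move=> clA clB cAB fc fd.
have [b bE] : exists b, forall p, A p -> B p -> c p = b (+) d p.
  have [[p [Ap Bp]]|AB0] := pselect (A `&` B !=set0).
    exists (c p (+) d p) => q Aq Bq.
    have cAB' := sheet_unique cAB (sheet_sub (@subIsetl _ _ _) fc)
      (sheet_sub (@subIsetr _ _ _) fd).
    have := cAB' p q (conj Ap Bp) (conj Aq Bq).
    by case: (c p); case: (c q); case: (d p); case: (d q).
  by exists true => p Ap Bp; case: AB0; exists p.
have {}fd := sheet_addb b fd.
pose e p := if `[< A p >] then c p else b (+) d p.
have eA p : A p -> e p = c p by move=> Ap; rewrite /e asboolT.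
have eB p : B p -> e p = b (+) d p.
  by move=> Bp; rewrite /e; case: asboolP => // Ap; rewrite bE.
have half (C : set T) h p : closed C -> (forall q, C q -> e q = h q) ->
    sheet C f h ->
    \forall q \near p, C p -> C q -> e q = e p (+) crossing (f p) (f q).
  move=> _ eC fh; have [Cp|nCp] := pselect (C p); last by near=> q.
  have := fh _ Cp; apply: filterS => q + _ Cq => /(_ Cq).
  by rewrite !eC.
have far (C : set T) p : closed C -> ~ C p -> \forall q \near p, ~ C q.
  by move=> /closed_openC oC nCp; exact: open_nbhs_nbhs.
have stay (C : set T) h p : closed C -> (forall q, C q -> e q = h q) ->
    sheet C f h -> A p \/ B p ->
    \forall q \near p, C q -> e q = e p (+) crossing (f p) (f q).
  move=> clC eC fh _; have [Cp|nCp] := pselect (C p).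
    by apply: filterS (half C h p clC eC fh) => q; exact.
  by apply: filterS (far C p clC nCp) => q /[swap] Cq /(_ Cq).
exists e => p ABp.
apply: filterS2 (stay _ _ p clA eA fc ABp) (stay _ _ p clB eB fd ABp).
by move=> q qA qB [/qA|/qB].
Unshelve. all: by end_near.
Qed.

(** Crossings of the positive and of the negative half-axis together make up all changes of
    [upper]. *)
Lemma sheet_opp A f c : (forall p, A p -> {for p, continuous f}) ->
  (forall p, A p -> f p != 0) -> sheet A f c ->
  sheet A (fun p => - f p) (fun p => c p (+) upper (f p)).
Proof.
move=> cf f0 fc p Ap.
have up : nbhs p (f @^-1` _) := cf _ Ap _ (upper_near (f0 _ Ap)).
apply: filterS2 (fc _ Ap) up => q + + Aq => /(_ Aq) -> qp.
rewrite /crossing !upperN ?f0//= oppr_gt0.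
case: qp => /= [->|[p2 p1 _]].
  by case: upper; case: (c p).
have -> : ((f p).1 < 0) = ~~ (0 < (f p).1).
  by rewrite -leNgt le_eqVlt (negPf p1).
by case: (upper (f p)); case: (upper (f q)); case: (c p); case: (0 < _).
Qed.

(** The half-plane of inner normal [n] contains the positive half-axis exactly when [0 < n.1]. In
    that case every change of [upper] is a crossing; otherwise there is none. *)
Lemma sheet_half_plane A f (n : R * R) :
  (forall p, A p -> {for p, continuous f}) ->
  (forall p, A p -> 0 < n.1 * (f p).1 + n.2 * (f p).2) ->
  sheet A f (fun p => (0 < n.1) && upper (f p)).
Proof.
move=> cf f0 p Ap.
have fp0 : f p != 0.
  by have := f0 _ Ap; apply: contraTneq => -> /=; rewrite !mulr0 addr0 ltxx.
have up : nbhs p (f @^-1` _) := cf _ Ap _ (upper_near fp0).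
apply: filterS up => q /= qp Aq.
rewrite /crossing; case: qp => [->|[p2 p1 _]].
  by rewrite addbb addbF.
have := f0 _ Ap; rewrite p2 mulr0 addr0 => n1.
have -> : (0 < n.1) = (0 < (f p).1).
  by apply/idP/idP => h; [rewrite -(pmulr_rgt0 _ h)|rewrite -(pmulr_lgt0 _ h)].
by case: (0 < _); case: (upper (f q)); case: (upper (f p)).
Qed.

Lemma sheet_scale A f c (k : T -> R) : (forall p, A p -> 0 < k p) ->
  sheet A f c -> sheet A (fun p => k p *: f p) c.
Proof.
move=> k0 fc p Ap; have := fc _ Ap; apply: filterS => q + Aq => /(_ Aq) ->.
by rewrite /crossing !upperZ ?k0//= /GRing.scale/= pmulr_rgt0 ?k0.
Qed.

End Space.

Lemma sheet_comp (S T : topologicalType) (A : set S) (B : set T) (f : T -> R * R)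
    (c : T -> bool) (h : S -> T) :
  (forall p, A p -> {for p, continuous h}) -> (forall p, A p -> B (h p)) ->
  sheet B f c -> sheet A (f \o h) (c \o h).
Proof.
move=> ch AB fc p Ap; have near_h : nbhs p (h @^-1` _) := ch _ Ap _ (fc _ (AB _ Ap)).
by apply: filterS near_h => q /= + /AB; exact.
Qed.

End Lift.

Lemma continuous_pair (S T U : topologicalType) (f : S -> T) (g : S -> U) x :
  {for x, continuous f} -> {for x, continuous g} ->
  {for x, continuous (fun y => (f y, g y))}.
Proof. move=> cf cg; exact: (@cvg_pair _ _ _ _ _ _ _ _ _ f g cf cg). Qed.

(** * Sheets over rectangles *)

Section Rectangle.
Variable R : realType.

Definition rectangle (a b c d : R) : set (R * R) := `[a, b] `*` `[c, d].

Lemma in_rectangle a b c d p :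
  rectangle a b c d p <-> a <= p.1 <= b /\ c <= p.2 <= d.
Proof. by rewrite /rectangle /= !in_itv. Qed.

Lemma closed_rectangle a b c d : closed (rectangle a b c d).
Proof.
rewrite (_ : rectangle a b c d = fst @^-1` `[a, b] `&` snd @^-1` `[c, d]) //.
apply: closedI; apply: preimage_closed; try exact: itv_closed.
  by move=> x _; exact: cvg_fst.
by move=> x _; exact: cvg_snd.
Qed.

Lemma continuous_pairl (x : R) : continuous (fun y : R => (x, y)).
Proof. by move=> y; apply: continuous_pair; [exact: cst_continuous|]. Qed.

Lemma continuous_pairr (y : R) : continuous (fun x : R => (x, y)).
Proof. by move=> x; apply: continuous_pair; [|exact: cst_continuous]. Qed.

Lemma connected_vertical x c d : connected (rectangle x x c d).
Proof.
have -> : rectangle x x c d = (fun y => (x, y)) @` `[c, d]%classic.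
  apply/seteqP; split=> [p /in_rectangle[p1 vcd]|p [y /= + <-]].
    exists p.2; last by rewrite (le_anti p1) -surjective_pairing.
    by rewrite /= in_itv.
  by rewrite in_itv /= => ycd; apply/in_rectangle; rewrite /= lexx.
apply: connected_continuous_connected; first exact: segment_connected.
by apply: continuous_subspaceT; exact: continuous_pairl.
Qed.

Lemma connected_horizontal a b y : connected (rectangle a b y y).
Proof.
have -> : rectangle a b y y = (fun x => (x, y)) @` `[a, b]%classic.
  apply/seteqP; split=> [p /in_rectangle[uab p2]|p [x /= + <-]].
    exists p.1; last by rewrite (le_anti p2) -surjective_pairing.
    by rewrite /= in_itv.
  by rewrite in_itv /= => xab; apply/in_rectangle; rewrite /= lexx.
apply: connected_continuous_connected; first exact: segment_connected.
by apply: continuous_subspaceT; exact: continuous_pairr.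
Qed.

Variable f : R * R -> R * R.
Hypothesis cf : continuous f.

Let has_sheet a b c d := exists e, sheet (rectangle a b c d) f e.

Lemma has_sheet_sub a b c d a' b' c' d' : a <= a' -> b' <= b -> c <= c' ->
  d' <= d -> has_sheet a b c d -> has_sheet a' b' c' d'.
Proof.
move=> aa' bb' cc' dd' [e fe]; exists e; apply: sheet_sub fe => p.
move=> /in_rectangle[/andP[? ?] /andP[? ?]]; apply/in_rectangle.
by split; apply/andP; split; lra.
Qed.

Lemma has_sheet_cath a b b' c d : a <= b <= b' ->
  has_sheet a b c d -> has_sheet b b' c d -> has_sheet a b' c d.
Proof.
move=> /andP[ab bb'] [e fe] [e' fe'].
have [|e'' fe''] := sheet_glue (@closed_rectangle _ _ _ _)
  (@closed_rectangle _ _ _ _) _ fe fe'.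
  rewrite (_ : _ `&` _ = rectangle b b c d); first exact: connected_vertical.
  apply/seteqP; split => p /=.
    move=> [/in_rectangle[/andP[? ?] ?] /in_rectangle[/andP[? ?] ?]].
    by apply/in_rectangle; split => //; apply/andP; split; lra.
  move=> /in_rectangle[/andP[? ?] ?].
  by split; apply/in_rectangle; split => //; apply/andP; split; lra.
exists e''; apply: sheet_sub fe'' => p /in_rectangle[/andP[? ?] ?].
have [pb|/ltW bp] := leP p.1 b; [left|right]; apply/in_rectangle;
  by split => //; apply/andP; split.
Qed.

Lemma has_sheet_catv a b c d d' : c <= d <= d' ->
  has_sheet a b c d -> has_sheet a b d d' -> has_sheet a b c d'.
Proof.
move=> /andP[cd dd'] [e fe] [e' fe'].
have [|e'' fe''] := sheet_glue (@closed_rectangle _ _ _ _)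
  (@closed_rectangle _ _ _ _) _ fe fe'.
  rewrite (_ : _ `&` _ = rectangle a b d d); first exact: connected_horizontal.
  apply/seteqP; split => p /=.
    move=> [/in_rectangle[? /andP[? ?]] /in_rectangle[? /andP[? ?]]].
    by apply/in_rectangle; split => //; apply/andP; split; lra.
  move=> /in_rectangle[? /andP[? ?]].
  by split; apply/in_rectangle; split => //; apply/andP; split; lra.
exists e''; apply: sheet_sub fe'' => p /in_rectangle[? /andP[? ?]].
have [pd|/ltW dp] := leP p.2 d; [left|right]; apply/in_rectangle;
  by split => //; apply/andP; split.
Qed.

(** Lifting over a simply connected domain by two nested uses of [interval_induction]: the inner
    one, in height, gives a sheet over a thin vertical strip of uniform width; the outer one joins
    the strips. *)
Lemma sheet_rectangle a b c d : a <= b -> c <= d ->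
  (forall x y, a <= x <= b -> c <= y <= d -> f (x, y) != 0) ->
  exists e, sheet (rectangle a b c d) f e.
Proof.
move=> ab cd f0.
apply: (@interval_induction _ (fun y z => has_sheet y z c d)) => //.
- by move=> y z /andP[ay yz]; exact: has_sheet_sub.
- by move=> y z; exact: has_sheet_cath.
move=> x xab.
pose Q t t' := exists2 e, 0 < e & forall y z, `|x - y| < e -> `|x - z| < e ->
  has_sheet y z t t'.
suff [e e0 He] : Q c d by exists e => // y z _ _ _; exact: He.
apply: interval_induction => //.
- move=> y z /andP[ay yz] [e e0 He]; exists e => // u v xu xv.
  by apply: (@has_sheet_sub u v c z) => //; exact: He.
- move=> y z cyz [e e0 He] [e' e'0 He']; exists (Num.min e e').
    by rewrite lt_min e0 e'0.
  move=> u v; rewrite !lt_min => /andP[? ?] /andP[? ?].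
  by apply: (has_sheet_catv cyz); [apply: He|apply: He'].
move=> t tcd.
have [B nB [g Bg]] := sheet_local (@cf (x, t)) (f0 _ _ xab tcd).
have [e /= e0 He] : exists2 e : R, 0 < e & ball (x, t) e `<=` B by exact/nbhs_ballP.
exists e => // y z _ _ _ ty tz; exists e => // u v xu xv.
exists g; apply: Bg => p /in_rectangle[/andP[? ?] /andP[? ?]].
apply: He; split; rewrite /ball /= ltr_norml;
  move: ty tz xu xv; rewrite !ltr_norml => /andP[? ?] /andP[? ?] /andP[? ?] /andP[? ?];
  by apply/andP; split; lra.
Qed.

End Rectangle.

(** * Winding parity along a segment *)

Section Winding.
Variable R : realType.
Implicit Types (f g : R -> R * R) (a b c x : R).

(** Unordered on purpose: a parity does not depend on the direction of travel. *)
Definition between a b : set R := `[Num.min a b, Num.max a b].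

Lemma betweenC a b : between a b = between b a.
Proof. by rewrite /between minC maxC. Qed.

Lemma in_between a b x :
  between a b x <-> (a <= x <= b) \/ (b <= x <= a).
Proof.
rewrite /between /= in_itv /=; case: (leP a b) => ab; split; first by left.
- by case=> // /andP[? ?]; apply/andP; split; lra.
- by right.
- by case=> // /andP[? ?]; apply/andP; split; lra.
Qed.

Lemma between_l a b : between a b a.
Proof. by apply/in_between; rewrite !lexx andbT; have [ab|/ltW ab] := leP a b; [left|right]. Qed.

Lemma between_r a b : between a b b.
Proof. by rewrite betweenC; exact: between_l. Qed.

Lemma connected_between a b : connected (between a b).
Proof. exact: segment_connected. Qed.

Lemma between_sub a b c d : between a b c -> between a b d -> between c d `<=` between a b.
Proof.
move=> /in_between H1 /in_between H2 x /in_between H3; apply/in_between.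
move: (ltP a b) => [ab|ba]; [left|right].
  by move: H1 H2 H3 => [] /andP[? ?] [] /andP[? ?] [] /andP[? ?]; apply/andP; split; lra.
by move: H1 H2 H3 => [] /andP[? ?] [] /andP[? ?] [] /andP[? ?]; apply/andP; split; lra.
Qed.

Lemma sheet_between f a b : continuous f -> (forall x, between a b x -> f x != 0) ->
  exists s, sheet (between a b) f s.
Proof.
move=> cf f0.
have cF : continuous (f \o fst : R * R -> R * R).
  by move=> p; apply: continuous_comp; [exact: cvg_fst|exact: cf].
(* The segment is treated as a rectangle of height zero. *)
have [|||s fs] := @sheet_rectangle R (f \o fst) cF (Num.min a b) (Num.max a b) 0 0.
- by case: (leP a b) => // /ltW.
- exact: lexx.
- by move=> x y xab _; apply: f0; rewrite /between /= in_itv.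
exists (fun x => s (x, 0)).
apply: (@sheet_comp _ _ _ _ _ _ _ (fun x => (x, 0)) _ _ fs) => p.
  by move=> _; exact: continuous_pairr.
by rewrite /between /= in_itv /= => H; apply/in_rectangle; rewrite /= lexx.
Qed.

(* Parity of the number of times [f] crosses the positive half of the first
   axis between [a] and [b]. *)
Definition winding f a b : bool :=
  let s := xget (fun=> false) [set s | sheet (between a b) f s] in s a (+) s b.

Lemma windingE f a b s : sheet (between a b) f s -> winding f a b = s a (+) s b.
Proof.
move=> fs; rewrite /winding; case: xgetP => [s' _ fs'|/(_ s)//].
exact: (sheet_unique (@connected_between a b) fs' fs (between_l _ _) (between_r _ _)).
Qed.

Lemma windingC f a b : winding f a b = winding f b a.
Proof. by rewrite /winding betweenC addbC. Qed.

Lemma winding_eq f g a b : (forall x, between a b x -> f x = g x) ->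
  winding f a b = winding g a b.
Proof.
move=> fg; rewrite /winding; congr (let s := xget _ _ in s a (+) s b).
apply/seteqP; split => s; apply: sheet_eq => // x /fg //.
Qed.

Lemma winding_cat f a b c : continuous f ->
  (forall x, between a b x -> f x != 0) -> between a b c ->
  winding f a b = winding f a c (+) winding f c b.
Proof.
move=> cf f0 abc; have [s fs] := sheet_between cf f0.
rewrite (windingE fs).
have sac := sheet_sub (between_sub (between_l _ _) abc) fs.
have scb := sheet_sub (between_sub abc (between_r _ _)) fs.
rewrite (windingE sac) (windingE scb).
by rewrite addbA -[s a (+) s c (+) s c]addbA addbb addbF.
Qed.

Lemma winding_opp f a b : continuous f -> (forall x, between a b x -> f x != 0) ->
  winding (fun x => - f x) a b = winding f a b (+) upper (f a) (+) upper (f b).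
Proof.
move=> cf f0; have [s fs] := sheet_between cf f0.
rewrite (windingE fs) (windingE (sheet_opp (fun x _ => cf x) f0 fs)).
by case: (s a); case: (s b); case: upper; case: upper.
Qed.

Lemma winding_scale f (k : R -> R) a b : continuous f ->
  (forall x, between a b x -> f x != 0) ->
  (forall x, between a b x -> 0 < k x) ->
  winding (fun x => k x *: f x) a b = winding f a b.
Proof.
move=> cf f0 k0; have [s fs] := sheet_between cf f0.
by rewrite (windingE fs) (windingE (sheet_scale k0 fs)).
Qed.

Lemma winding_half_plane f (n : R * R) a b : continuous f ->
  (forall x, between a b x -> 0 < n.1 * (f x).1 + n.2 * (f x).2) ->
  winding f a b = (0 < n.1) && (upper (f a) (+) upper (f b)).
Proof.
move=> cf f0; rewrite (windingE (sheet_half_plane (fun x _ => cf x) f0)).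
by case: (0 < _).
Qed.

(** Homotopy invariance modulo 2: with one sheet over the rectangle, each corner value occurs twice
    around the boundary. *)
Lemma winding_rectangle (F : R * R -> R * R) a b c d : continuous F ->
  (forall x y, between a b x -> between c d y -> F (x, y) != 0) ->
  winding (fun x => F (x, c)) a b (+) winding (fun x => F (x, d)) a b =
  winding (fun y => F (a, y)) c d (+) winding (fun y => F (b, y)) c d.
Proof.
move=> cF F0.
have [|||e Fe] := @sheet_rectangle R F cF (Num.min a b) (Num.max a b)
    (Num.min c d) (Num.max c d).
- by case: (leP a b) => // /ltW.
- by case: (leP c d) => // /ltW.
- by move=> x y xab ycd; apply: F0; rewrite /between /= in_itv.
have hor y : between c d y -> sheet (between a b) (fun x => F (x, y)) (fun x => e (x, y)).
  move=> cdy; apply: (@sheet_comp _ _ _ _ _ _ _ (fun x => (x, y)) _ _ Fe) => p.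
    by move=> _; exact: continuous_pairr.
  by move: cdy; rewrite /between /= !in_itv.
have ver x : between a b x -> sheet (between c d) (fun y => F (x, y)) (fun y => e (x, y)).
  move=> abx; apply: (@sheet_comp _ _ _ _ _ _ _ (fun y => (x, y)) _ _ Fe) => p.
    by move=> _; exact: continuous_pairl.
  by move: abx; rewrite /between /= !in_itv.
rewrite (windingE (hor c (between_l _ _))) (windingE (hor d (between_r _ _))).
rewrite (windingE (ver a (between_l _ _))) (windingE (ver b (between_r _ _))).
by case: (e _); case: (e _); case: (e _); case: (e _).
Qed.

End Winding.

(** * Secants and transverse zeros *)

Section Coordinates.
Variable R : realType.
Implicit Types (g : R -> R * R) (x y : R -> R).

Lemma is_derive_fst g (t : R) (d : R * R) : is_derive t 1 g d ->
  is_derive t 1 (fst \o g) d.1.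
Proof.
move=> [dg gE].
have H : (h^-1 *: ((fst \o g \o shift t) (h *: 1) - (fst \o g) t)) @[h --> 0^'] --> d.1.
  have dg' : (h^-1 *: ((g \o shift t) (h *: 1) - g t)) @[h --> 0^'] --> d.
    by rewrite -gE; exact: dg.
  by apply: (cvg_comp _ fst dg'); exact: cvg_fst.
by apply: DeriveDef; [apply/cvg_ex; exists d.1|exact: cvg_lim H].
Qed.

Lemma is_derive_snd g (t : R) (d : R * R) : is_derive t 1 g d ->
  is_derive t 1 (snd \o g) d.2.
Proof.
move=> [dg gE].
have H : (h^-1 *: ((snd \o g \o shift t) (h *: 1) - (snd \o g) t)) @[h --> 0^'] --> d.2.
  have dg' : (h^-1 *: ((g \o shift t) (h *: 1) - g t)) @[h --> 0^'] --> d.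
    by rewrite -gE; exact: dg.
  by apply: (cvg_comp _ snd dg'); exact: cvg_snd.
by apply: DeriveDef; [apply/cvg_ex; exists d.2|exact: cvg_lim H].
Qed.

Lemma is_derive_pair x y (t dx dy : R) : is_derive t 1 x dx -> is_derive t 1 y dy ->
  is_derive t 1 (fun s => (x s, y s)) (dx, dy).
Proof.
move=> [dgx xE] [dgy yE].
have H : (h^-1 *: (((fun s => (x s, y s)) \o shift t) (h *: 1) - (x t, y t)))
    @[h --> 0^'] --> (dx, dy).
  by rewrite -xE -yE; exact: (cvg_pair dgx dgy).
by apply: DeriveDef; [apply/cvg_ex; exists (dx, dy)|exact: cvg_lim H].
Qed.

Definition secant1 x (p : R * R) : R :=
  if p.1 == p.2 then x^`() p.1 else (p.1 - p.2)^-1 * (x p.1 - x p.2).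

Lemma secant1_mvt x (a b : R) : (forall t, derivable x t 1) ->
  exists2 c, between a b c & secant1 x (a, b) = x^`() c.
Proof.
move=> dx; wlog ab : a b / a <= b => [H|].
  have [/H //|/ltW /H [c bac E]] := leP a b.
  exists c; first by rewrite betweenC.
  rewrite -E /secant1 /= eq_sym; case: eqVneq => [->//|ba].
  by rewrite -(opprB b a) -(opprB (x b)) invrN mulrNN.
have [<-|neqab] := eqVneq a b.
  by exists a; [exact: between_l|rewrite /secant1 eqxx].
have ltab : a < b by rewrite lt_neqAle neqab.
have dx' (t : R) : is_derive t 1 x (x^`() t) by rewrite derive1E; exact/derivableP.
have cx : {within `[a, b], continuous x}.
  apply: continuous_subspaceT => t.
  exact/differentiable_continuous/derivable1_diffP.
have [c cab E] := MVT ltab (fun t _ => dx' t) cx.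
exists c; first by apply/in_between; left; rewrite !(itvP cab).
rewrite /secant1 /= (negPf neqab) -(opprB b) -(opprB (x b)) E invrN mulrNN.
by rewrite mulrC mulfK// subr_eq0 eq_sym.
Qed.

(** At the diagonal the mean value lemma reduces the claim to continuity of the derivative. Plane
    curves are handled one coordinate at a time, so it does not matter that the mean points
    differ. *)
Lemma continuous_secant1 x : (forall t, derivable x t 1) ->
  continuous (x^`()) -> continuous (secant1 x).
Proof.
move=> dx cx [a b].
have cx0 : continuous x.
  by move=> t; exact/differentiable_continuous/derivable1_diffP.
have [<-|neqab] := eqVneq a b.
  rewrite /continuous_at {2}/secant1 /= eqxx.
  apply/cvgrPdist_lt => e e0.
  have /cvgrPdist_lt /(_ e e0) /nbhs_ballP[d /= d0 H] := cx a.
  apply: filterS (near_coordinates (a, a) d0) => -[u v] /= [p1 p2].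
  have [c /in_between cp ->] := secant1_mvt u v dx.
  apply: H; rewrite /ball /=; move: p1 p2; rewrite !ltr_norml.
  by move: cp => [] /andP[? ?] /andP[? ?] /andP[? ?]; apply/andP; split; lra.
have near_neq : \forall p \near (a, b), (p.1 - p.2)^-1 * (x p.1 - x p.2) = secant1 x p.
  have e0 : 0 < `|a - b| / 2 by rewrite divr_gt0// normr_gt0 subr_eq0.
  apply: filterS (near_coordinates (a, b) e0) => p /= [p1 p2].
  rewrite /secant1; case: eqVneq => [E|_ //]; exfalso.
  have := ler_normB (a - p.1) (b - p.2).
  by rewrite (_ : _ - (b - p.2) = a - b); [lra|rewrite E; ring].
apply: cvg_trans (near_eq_cvg near_neq) _.
rewrite /secant1 /= (negPf neqab).
apply: cvgM.
  apply: cvgV; first by rewrite subr_eq0.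
  by apply: cvgB; [exact: cvg_fst|exact: cvg_snd].
apply: cvgB.
  by apply: continuous_comp; [exact: cvg_fst|exact: cx0].
by apply: continuous_comp; [exact: cvg_snd|exact: cx0].
Qed.

Definition secant g (p : R * R) : R * R := (secant1 (fst \o g) p, secant1 (snd \o g) p).

Lemma smooth_is_derive g (t : R) : smooth g -> is_derive t 1 g (g^`() t).
Proof. by move=> /(_ 0%N t) dg; rewrite derive1E; exact/derivableP. Qed.

Lemma smooth_fst g (t : R) : smooth g -> is_derive t 1 (fst \o g) (g^`() t).1.
Proof. by move=> sg; exact: is_derive_fst (smooth_is_derive t sg). Qed.

Lemma smooth_snd g (t : R) : smooth g -> is_derive t 1 (snd \o g) (g^`() t).2.
Proof. by move=> sg; exact: is_derive_snd (smooth_is_derive t sg). Qed.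

Lemma smooth_continuous g : smooth g -> continuous g.
Proof.
move=> sg t; apply: differentiable_continuous; apply/derivable1_diffP.
exact: (sg 0%N t).
Qed.

Lemma smooth_derive1_fst g : smooth g -> (fst \o g)^`() = fst \o g^`().
Proof.
by move=> sg; apply/funext => t; rewrite derive1E; have [_ ->] := smooth_fst t sg.
Qed.

Lemma smooth_derive1_snd g : smooth g -> (snd \o g)^`() = snd \o g^`().
Proof.
by move=> sg; apply/funext => t; rewrite derive1E; have [_ ->] := smooth_snd t sg.
Qed.

Lemma continuous_secant g : smooth g -> continuous (secant g).
Proof.
move=> sg.
have cg' : continuous g^`().
  move=> t; apply: differentiable_continuous; apply/derivable1_diffP.
  exact: (sg 1%N t).
move=> p; apply: continuous_pair; apply: continuous_secant1.
- by move=> t; have [] := smooth_fst t sg.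
- rewrite smooth_derive1_fst // => t.
  by apply: continuous_comp; [exact: cg'|exact: cvg_fst].
- by move=> t; have [] := smooth_snd t sg.
- rewrite smooth_derive1_snd // => t.
  by apply: continuous_comp; [exact: cg'|exact: cvg_snd].
Qed.

Lemma secant_diag g t : smooth g -> secant g (t, t) = g^`() t.
Proof.
move=> sg; rewrite /secant /secant1 /= eqxx smooth_derive1_fst// smooth_derive1_snd//=.
by rewrite -surjective_pairing.
Qed.

Lemma secantC g s t : secant g (s, t) = secant g (t, s).
Proof.
rewrite /secant /secant1 /= [t == s]eq_sym; case: eqVneq => [->//|_].
by rewrite -(opprB t s) invrN !mulNr -!mulrN !opprB.
Qed.

Lemma secantE g s t : g s - g t = (s - t) *: secant g (s, t).
Proof.
rewrite /secant /secant1 /=; case: eqVneq => [->|st].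
  by rewrite !subrr scale0r.
by apply: injective_projections => /=; rewrite /GRing.scale/= mulrA mulfV ?subr_eq0// mul1r.
Qed.

(** Immersion on the diagonal and injectivity off it merge into the absence of zeros of a single
    continuous map. *)
Lemma secant_neq0 g s t : smooth_embedding g -> unit_segment s -> unit_segment t ->
  secant g (s, t) != 0.
Proof.
move=> [sg ig [_ [h [hg _]]]] s01 t01; have [<-|st] := eqVneq s t.
  by rewrite secant_diag//; exact: ig.
apply: contra_neq st => st0; have : g s = g t.
  by apply/eqP; rewrite -subr_eq0 secantE st0 scaler0.
by move=> gst; rewrite -(hg s)// gst hg.
Qed.

End Coordinates.

(** * Blow-up of a transverse zero *)

Section Quadrant.
Variable R : realType.
Implicit Types (f g mu ell : R -> R * R) (U V X Y : R * R).

Lemma winding_comp f (h : R -> R) (a b : R) : continuous f ->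
  continuous h -> (forall x, between (h a) (h b) x -> f x != 0) ->
  (forall x, between a b x -> between (h a) (h b) (h x)) ->
  winding (f \o h) a b = winding f (h a) (h b).
Proof.
move=> cf ch f0 hb; have [s fs] := sheet_between cf f0.
rewrite (windingE fs).
by rewrite (windingE (@sheet_comp _ _ _ _ _ _ _ h (fun x _ => ch x) hb fs)).
Qed.

Lemma winding_affine f (a b : R) : continuous f ->
  (forall x, between a b x -> f x != 0) ->
  winding (fun r => f (a + r * (b - a))) 0 1 = winding f a b.
Proof.
move=> cf f0; have E : a + 0 * (b - a) = a /\ a + 1 * (b - a) = b by split; ring.
have ch : continuous (fun r : R => a + r * (b - a)).
  move=> r; apply: cvgD; first exact: cvg_cst.
  by apply: cvgM; [exact: cvg_id|exact: cvg_cst].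
rewrite (@winding_comp f (fun r => a + r * (b - a)) 0 1) ?E.1 ?E.2//.
move=> r /in_between H; apply/in_between.
have {H} /andP[r0 r1] : 0 <= r <= 1.
  by case: H => // /andP[? ?]; apply/andP; split; lra.
by have [ab|/ltW ab] := leP a b; [left|right]; apply/andP; split; nra.
Qed.

Lemma winding_scaler f (k a b : R) : k != 0 -> continuous f ->
  (forall x, between a b x -> f x != 0) ->
  winding (fun x => k *: f x) a b =
  winding f a b (+) ((k < 0) && (upper (f a) (+) upper (f b))).
Proof.
move=> k0 cf f0; case: (ltgtP k 0) k0 => // [kn|kp] _; last first.
  by rewrite winding_scale// addbF.
rewrite andTb addbA -winding_opp// -(@winding_scale _ (fun x => - f x) (fun=> - k))//=.
- by apply: winding_eq => x _; rewrite scalerN scaleNr opprK.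
- by move=> x; apply: cvgN; exact: cf.
- by move=> x /f0; rewrite oppr_eq0.
- by rewrite oppr_gt0.
Qed.

Definition cross X Y : R := X.1 * Y.2 - X.2 * Y.1.

Lemma crossZ (k l : R) X Y : cross (k *: X) (l *: Y) = k * (l * cross X Y).
Proof. by case: X Y => [? ?] [? ?]; rewrite /cross /= /GRing.scale /=; ring. Qed.

(** Winding parity of a path from [X] to [Y] inside the cone that they span: the positive half-axis
    is crossed when the path passes from lower to upper counterclockwise, or from upper to lower
    clockwise. *)
Definition turn X Y := (upper X (+) upper Y) && (upper Y == (0 < cross X Y)).

Lemma upper_cross X Y : upper X -> ~~ upper Y -> cross X Y != 0 -> Y.2 < X.2.
Proof.
rewrite /upper /cross negb_or -leNgt => uX /andP[Y2 _] XY0.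
rewrite lt_neqAle (le_trans Y2) ?andbT; last first.
  by case/orP: uX => [/ltW//|/andP[/eqP ->]].
apply: contra_neq XY0 => YX; have X2 : X.2 = 0.
  by apply/le_anti; rewrite -{1}YX Y2 /=; case/orP: uX => [/ltW|/andP[/eqP ->]].
by rewrite YX X2 mulr0 mul0r subrr.
Qed.

Lemma winding_turn f X Y (a b : R) : continuous f -> cross X Y != 0 ->
  f a = X -> f b = Y -> (forall x, between a b x ->
    exists k l, [/\ 0 <= k, 0 <= l, 0 < k + l & f x = k *: X + l *: Y]) ->
  winding f a b = turn X Y.
Proof.
move=> cf XY0 fa fb fXY.
(* Chosen so that its scalar products with [X] and [Y] are both 1; the product with
   [k *: X + l *: Y] is then [k + l]. *)
pose n : R * R := ((Y.2 - X.2) / cross X Y, (X.1 - Y.1) / cross X Y).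
rewrite (@winding_half_plane _ f n) // => [|x /fXY[k [l [_ _ kl0 ->]]]]; last first.
  rewrite (_ : _ + _ = k + l)//= /GRing.scale/=.
  by rewrite /cross in XY0 *; field.
rewrite fa fb /turn /n /=.
have [uX|nuX] := boolP (upper X); have [uY|nuY] := boolP (upper Y);
  rewrite ?andbF//= andbT.
- have YX := upper_cross uX nuY XY0.
  by case: (ltgtP (cross X Y) 0) XY0 => // D0 _;
    [rewrite nmulr_lgt0 ?invr_lt0|rewrite pmulr_lgt0 ?invr_gt0] => //;
    rewrite ?subr_gt0 ?subr_lt0; case: ltgtP YX.
- have XY : X.2 < Y.2.
    apply: upper_cross uY nuX _; apply: contra_neq XY0 => YX0.
    by rewrite /cross mulrC [X.2 * _]mulrC -opprB; apply/eqP; rewrite oppr_eq0 -YX0 /cross.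
  by case: (ltgtP (cross X Y) 0) XY0 => // D0 _;
    [rewrite nmulr_lgt0 ?invr_lt0|rewrite pmulr_lgt0 ?invr_gt0] => //;
    rewrite ?subr_gt0 ?subr_lt0; case: ltgtP XY.
Qed.

End Quadrant.

Section Corner.
Variable R : realType.
Implicit Types (f g mu ell : R -> R * R) (U V X Y : R * R).

Lemma continuous_secantZ g (k c : R) : smooth g ->
  continuous (fun x => k *: secant g (x, c)).
Proof.
move=> sg x; apply: cvgZ; first exact: cvg_cst.
by apply: continuous_comp; [exact: continuous_pairr|exact: continuous_secant].
Qed.

(** The blow-up [K] is the difference of the curves along rays from [(s0, t0)], divided by the ray
    parameter [r]. Having no zero on its rectangle, it relates the four sides: the outer edges at
    [r = 1], the tangent directions at [r = 0], and the two secants at [tau = 0] and [tau = 2]. *)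
Lemma quadrant_winding mu ell (s0 t0 s t : R) :
  smooth mu -> smooth ell -> mu s0 = ell t0 ->
  cross (derive1 mu s0) (derive1 ell t0) != 0 -> s != s0 -> t != t0 ->
  (forall x y, between s0 s x -> between t0 t y -> mu x = ell y ->
    x = s0 /\ y = t0) ->
  (forall x, between s0 s x -> secant mu (x, s0) != 0) ->
  (forall y, between t0 t y -> secant ell (y, t0) != 0) ->
  winding (fun y => mu s - ell y) t0 t (+) winding (fun x => mu x - ell t) s0 s =
  winding (fun x => (s - s0) *: secant mu (x, s0)) s0 s (+)
  winding (fun y => (t0 - t) *: secant ell (y, t0)) t0 t (+)
  turn ((s - s0) *: derive1 mu s0) ((t0 - t) *: derive1 ell t0).
Proof.
move=> smu sell mul0 UV0 ss0 tt0 F0 mu0 ell0.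
(* As [tau] goes from 0 to 2, the point [(s0 + a tau, t0 + b tau)] runs from [(s, t0)] through the
   corner [(s, t)] to [(s0, t)]. *)
pose a (tau : R) : R := (s - s0) * Num.min 1 (2 - tau).
pose b (tau : R) : R := (t - t0) * Num.min 1 tau.
pose K (p : R * R) : R * R := a p.2 *: secant mu (s0 + p.1 * a p.2, s0) -
            b p.2 *: secant ell (t0 + p.1 * b p.2, t0).
have ca : continuous a.
  have cm : continuous (fun y : R => Num.min (1 : R^o) (2 - y)).
    move=> x; apply: (@continuous_min R R (fun=> 1) (fun y => 2 - y) x).
      exact: cst_continuous.
    by apply: cvgB; [exact: cvg_cst|exact: cvg_id].
  by move=> x; apply: cvgM; [exact: cvg_cst|exact: cm].
have cb : continuous b.
  have cm : continuous (fun y : R => Num.min (1 : R^o) y).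
    move=> x; apply: (@continuous_min R R (fun=> 1) id x); last exact: cvg_id.
    exact: cst_continuous.
  by move=> x; apply: cvgM; [exact: cvg_cst|exact: cm].
have cK : continuous K.
  have aux g (c0 : R) (h : R -> R) : smooth g -> continuous h ->
      continuous (fun p : R * R => h p.2 *: secant g (c0 + p.1 * h p.2, c0)).
    move=> sg ch p; have ch2 : {for p, continuous (fun p : R * R => h p.2)}.
      by apply: continuous_comp; [exact: cvg_snd|exact: ch].
    apply: cvgZ; first exact: ch2.
    apply: (@continuous_comp _ _ _ (fun p : R * R => (c0 + p.1 * h p.2, c0))).
      apply: continuous_pair; last exact: cvg_cst.
      by apply: cvgD; [exact: cvg_cst|apply: cvgM; [exact: cvg_fst|exact: ch2]].
    exact: continuous_secant.
  by move=> p; apply: cvgB; apply: aux.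
have KE p : p.1 *: K p = mu (s0 + p.1 * a p.2) - ell (t0 + p.1 * b p.2).
  rewrite scalerBr !scalerA.
  have := secantE mu (s0 + p.1 * a p.2) s0; rewrite [_ + _ - s0]addrC addKr => <-.
  have := secantE ell (t0 + p.1 * b p.2) t0; rewrite [_ + _ - t0]addrC addKr => <-.
  by rewrite mul0 opprB addrA subrK.
have lb x : between (0 : R) 1 x -> 0 <= x <= 1.
  by move=> /in_between[//|/andP[? ?]]; apply/andP; split; lra.
have lb2 x : between (0 : R) 2 x -> 0 <= x <= 2.
  by move=> /in_between[//|/andP[? ?]]; apply/andP; split; lra.
have conv (u v r : R) : 0 <= r <= 1 -> between u v (u + (v - u) * r).
  move=> /andP[r0 r1]; apply/in_between.
  by have [uv|/ltW uv] := leP u v; [left|right]; apply/andP; split; nra.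
have kl (tau : R) : 0 <= tau <= 2 -> [/\ 0 <= Num.min 1 (2 - tau) <= 1,
    0 <= Num.min 1 tau <= 1 & 0 < Num.min 1 (2 - tau) + Num.min 1 tau].
  move=> /andP[? ?].
  by case: (leP 1 (2 - tau)) => ?; case: (leP 1 tau) => ?; split;
    rewrite ?ler01 ?lexx //; try (apply/andP; split); lra.
set X := (s - s0) *: derive1 mu s0; set Y := (t0 - t) *: derive1 ell t0.
have XY0 : cross X Y != 0.
  rewrite crossZ; apply: mulf_neq0; first by rewrite subr_eq0.
  by apply: mulf_neq0 UV0; rewrite subr_eq0 eq_sym.
have K0E (tau : R) : K (0, tau) = Num.min 1 (2 - tau) *: X + Num.min 1 tau *: Y.
  rewrite /K /= !mul0r !addr0 !secant_diag// /a /b /X /Y !scalerA.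
  by rewrite -(opprB t) mulrN scaleNr ![_ * (_ - _)]mulrC.
have K0 r tau : between 0 1 r -> between 0 2 tau -> K (r, tau) != 0.
  move=> /lb /andP[r0 r1] /lb2 /kl[/andP[k0 k1] /andP[l0 l1] kl0].
  (* At [r = 0] the independence of [X] and [Y] excludes a zero. For other [r] a zero of [K] is an
     intersection in the quadrant, hence the base point, which forces both minima to vanish. *)
  have [->|rn0] := eqVneq r 0.
    apply: contraTneq kl0; rewrite K0E; set k := Num.min 1 _; set l := Num.min _ _.
    case: (X) (Y) XY0 => [X1 X2] [Y1 Y2]; rewrite /cross /= /GRing.scale /= => D0 [E1 E2].
    rewrite -leNgt le_eqVlt; apply/orP; left; apply/eqP.
    have k0' : k = 0.
      apply: (mulIf D0); rewrite mul0r; transitivity (Y2 * (k * X1 + l * Y1) - Y1 * (k * X2 + l * Y2)).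
        by ring.
      by rewrite E1 E2 !mulr0 subrr.
    have l0' : l = 0.
      apply: (mulIf D0); rewrite mul0r; transitivity (X1 * (k * X2 + l * Y2) - X2 * (k * X1 + l * Y1)).
        by ring.
      by rewrite E1 E2 !mulr0 subrr.
    by rewrite k0' l0' addr0.
  apply: contraTneq kl0 => KE0; have := KE (r, tau); rewrite KE0 scaler0 /= => /esym/eqP.
  rewrite subr_eq0 => /eqP /F0[].
  - by rewrite /a mulrCA; apply: conv; apply/andP; split; nra.
  - by rewrite /b mulrCA; apply: conv; apply/andP; split; nra.
  have add0 (x y : R) : x + y = x -> y = 0 by lra.
  move=> /add0/eqP + /add0/eqP; rewrite /a /b !mulf_eq0 (negPf rn0) !subr_eq0.
  rewrite (negPf ss0) (negPf tt0) /= => /eqP -> /eqP ->.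
  by rewrite addr0 ltxx.
have := winding_rectangle cK K0.
have m10 : Num.min (1 : R) 0 = 0 by rewrite min_r ?ler01.
have two : Num.min (1 : R) 2 = 1.
  by case: leP => //; lra.
have -> : winding (fun x => K (x, 0)) 0 1 =
    winding (fun x => (s - s0) *: secant mu (x, s0)) s0 s.
  rewrite -[RHS]winding_affine.
  - apply: winding_eq => r _; rewrite /K /= /a /b subr0 two.
    by rewrite m10 mulr0 scale0r subr0 mulr1.
  - exact: continuous_secantZ.
  - by move=> x /mu0 H; rewrite scaler_eq0 negb_or subr_eq0 ss0.
have -> : winding (fun x => K (x, 2)) 0 1 =
    winding (fun y => (t0 - t) *: secant ell (y, t0)) t0 t.
  rewrite -[RHS]winding_affine.
  - apply: winding_eq => r _; rewrite /K /= /a /b subrr two.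
    by rewrite m10 mulr0 scale0r sub0r mulr1 -scaleNr opprB.
  - exact: continuous_secantZ.
  - by move=> x /ell0 H; rewrite scaler_eq0 negb_or subr_eq0 eq_sym tt0.
have -> : winding (fun y => K (0, y)) 0 2 = turn X Y.
  apply: winding_turn => //.
  - by move=> x; apply: continuous_comp; [exact: continuous_pairl|exact: cK].
  - by rewrite K0E subr0 two m10 scale0r scale1r addr0.
  - by rewrite K0E subrr two m10 scale0r scale1r add0r.
  - move=> tau /lb2 /kl[/andP[? ?] /andP[? ?] ?].
    by exists (Num.min 1 (2 - tau)), (Num.min 1 tau).
have -> : winding (fun y => K (1, y)) 0 2 =
    winding (fun y => mu s - ell y) t0 t (+) winding (fun x => mu x - ell t) s0 s.
  have m1 (tau : R) : tau <= 1 -> Num.min 1 (2 - tau) = 1.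
    by move=> ?; rewrite min_l//; lra.
  have cF1 : continuous (fun y => mu s - ell y).
    move=> y; apply: cvgB; first exact: cvg_cst.
    exact: smooth_continuous.
  have cF2 : continuous (fun x => mu x - ell t).
    move=> y; apply: cvgB; last exact: cvg_cst.
    exact: smooth_continuous.
  rewrite (@winding_cat _ _ 0 2 1); first last.
  - by apply/in_between; left; apply/andP; split; lra.
  - by move=> x; apply: K0; exact: between_r.
  - by move=> x; apply: continuous_comp; [exact: continuous_pairl|exact: cK].
  congr (_ (+) _).
    rewrite -[RHS]winding_affine//.
      apply: winding_eq => r /lb /andP[? ?]; rewrite -[LHS]scale1r (KE (1, r)) /=.
      by rewrite !mul1r /a /b m1// min_r//; congr (mu _ - ell _); ring.
    move=> y yt; rewrite subr_eq0; apply: contra_neq ss0 => /F0[]// ; exact: between_r.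
  have h1 : s = s0 + (2 - 1) * (s - s0) by ring.
  have h2 : s0 = s0 + (2 - 2) * (s - s0) by ring.
  transitivity (winding (fun x => mu x - ell t) (s0 + (2 - 1) * (s - s0))
      (s0 + (2 - 2) * (s - s0))); last by rewrite -h1 -h2 windingC.
  rewrite -[RHS](@winding_comp _ (fun x => mu x - ell t) (fun r => s0 + (2 - r) * (s - s0))).
  - apply: winding_eq => r /in_between H.
    have {H} /andP[? ?] : 1 <= r <= 2.
      by case: H => // /andP[? ?]; apply/andP; split; lra.
    rewrite -[LHS]scale1r (KE (1, r)) /=.
    have m2 : Num.min 1 (2 - r) = 2 - r by rewrite min_r//; lra.
    have m3 : Num.min 1 r = 1 by rewrite min_l.
    rewrite !mul1r /a /b m2 m3.
    by congr (mu _ - ell _); ring.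
  - exact: cF2.
  - move=> r; apply: cvgD; first exact: cvg_cst.
    apply: cvgM; last exact: cvg_cst.
    by apply: cvgB; [exact: cvg_cst|exact: cvg_id].
  - rewrite -h1 -h2 => x xs; rewrite subr_eq0; apply: contra_neq tt0.
    by rewrite betweenC in xs => /F0[]//; exact: between_r.
  - move=> r /in_between H; rewrite -h1 -h2 betweenC mulrC; apply: conv.
    by case: H => /andP[? ?]; apply/andP; split; lra.
by case: (winding _ _ _); case: (winding _ _ _); case: (winding _ _ _);
  case: (winding _ _ _); case: turn.
Qed.

End Corner.

(** * Labels along a pair of curves *)

Section Labels.
Variable R : realType.
Implicit Types (f g : R -> R * R) (U V X Y : R * R).

Lemma unit_between (a b x : R) : unit_segment a -> unit_segment b ->
  between a b x -> unit_segment x.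
Proof.
rewrite /unit_segment /= !in_itv /= => /andP[? ?] /andP[? ?] /in_between H.
by case: H => /andP[? ?]; apply/andP; split; lra.
Qed.

(** [phi] is a sheet over the unit square. Its symmetry comes from comparing a horizontal and a
    vertical path that end at the same diagonal point [(b, b)], along which the symmetric secant
    takes the same values. *)
Lemma secant_label g : smooth_embedding g -> exists phi : R -> R -> bool,
  (forall s a b, unit_segment s -> unit_segment a -> unit_segment b ->
     winding (fun x => secant g (x, s)) a b = phi a s (+) phi b s) /\
  (forall a b, unit_segment a -> unit_segment b -> phi a b = phi b a).
Proof.
move=> eg; have [sg _ _] := eg.
have [|||e Fe] := @sheet_rectangle R _ (continuous_secant sg) 0 1 0 1.
- exact: ler01.
- exact: ler01.
- by move=> x y x01 y01; apply: secant_neq0 => //; rewrite /unit_segment /= in_itv.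
have hor s a b : unit_segment s -> unit_segment a -> unit_segment b ->
    winding (fun x => secant g (x, s)) a b = e (a, s) (+) e (b, s).
  move=> us ua ub.
  apply: (@windingE _ (fun x => secant g (x, s)) a b (fun x => e (x, s))).
  apply: (@sheet_comp _ _ _ _ _ _ _ (fun x => (x, s)) _ _ Fe) => x.
    by move=> _; exact: continuous_pairr.
  by move=> /(unit_between ua ub).
have ver s a b : unit_segment s -> unit_segment a -> unit_segment b ->
    winding (fun x => secant g (x, s)) a b = e (s, a) (+) e (s, b).
  move=> us ua ub; rewrite (winding_eq (fun x _ => secantC g x s)).
  apply: (@windingE _ (fun x => secant g (s, x)) a b (fun x => e (s, x))).
  apply: (@sheet_comp _ _ _ _ _ _ _ (fun x => (s, x)) _ _ Fe) => x.
    by move=> _; exact: continuous_pairl.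
  by move=> /(unit_between ua ub).
exists (fun a b => e (a, b)); split => // a b ua ub.
have := hor b a b ub ua ub; rewrite (ver b a b ub ua ub).
by case: (e (a, b)); case: (e (b, a)); case: (e (b, b)).
Qed.

Lemma upper_scale (k : R) U : k != 0 -> U != 0 -> upper (k *: U) = (k < 0) (+) upper U.
Proof.
move=> + U0; case: (ltgtP k 0) => // k0 _; last by rewrite upperZ.
by rewrite -[k]opprK scaleNr upperN ?upperZ ?oppr_gt0// scaler_eq0 negb_or U0 oppr_eq0 lt_eqF.
Qed.

Lemma mulr_gt0_addb (k x : R) : k != 0 -> x != 0 -> (0 < k * x) = (k < 0) (+) (0 < x).
Proof.
case: (ltgtP k 0) => // k0 _; last by rewrite pmulr_rgt0.
by rewrite nmulr_rgt0//; case: ltgtP.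
Qed.

Variables mu ell : R -> R * R.
Hypothesis emu : smooth_embedding mu.
Hypothesis eell : smooth_embedding ell.
Variables phimu phiell : R -> R -> bool.
Hypothesis phimuP : forall s a b,
  unit_segment s -> unit_segment a -> unit_segment b ->
  winding (fun x => secant mu (x, s)) a b = phimu a s (+) phimu b s.
Hypothesis phiellP : forall s a b,
  unit_segment s -> unit_segment a -> unit_segment b ->
  winding (fun x => secant ell (x, s)) a b = phiell a s (+) phiell b s.

Let smu : smooth mu. Proof. by case: emu. Qed.
Let sell : smooth ell. Proof. by case: eell. Qed.

(** A label of [mu x - mu s0] on each side of [s0]: this difference is [x - s0] times the secant,
    and a negative factor brings in the [upper] term of [sheet_opp]. *)
Definition row_label (s0 s : R) :=
  phimu s s0 (+) ((s < s0) && upper (secant mu (s, s0))).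

(** The difference labelled here is [ell t0 - ell y], so the factor is negative above [t0]
    instead. *)
Definition column_label (t0 t : R) :=
  phiell t t0 (+) ((t0 < t) && upper (secant ell (t, t0))).

Lemma continuous_secantl g (c : R) : smooth g -> continuous (fun x => secant g (x, c)).
Proof.
move=> sg x.
by apply: continuous_comp; [exact: continuous_pairr|exact: continuous_secant].
Qed.

Lemma row_winding (s0 s s' : R) :
  unit_segment s0 -> unit_segment s -> unit_segment s' ->
  (s < s0) && (s' < s0) || (s0 < s) && (s0 < s') ->
  winding (fun x => mu x - mu s0) s s' = row_label s0 s (+) row_label s0 s'.
Proof.
move=> us0 us us'; rewrite /row_label.
have n0 x : between s s' x -> secant mu (x, s0) != 0.
  by move=> xs; apply: secant_neq0 => //; exact: unit_between xs.
case/orP => /andP[h h'].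
  rewrite h h' /=.
  rewrite -(@winding_eq _ (fun x => (s0 - x) *: - secant mu (x, s0))).
    rewrite (@winding_scale _ (fun x => - secant mu (x, s0))) //.
    - rewrite winding_opp// ?phimuP//; last exact: continuous_secantl.
      by case: (phimu _ _); case: (phimu _ _); case: upper; case: upper.
    - by move=> x; apply: cvgN; exact: continuous_secantl.
    - by move=> x /n0; rewrite oppr_eq0.
    - by move=> x /in_between H; case: H => /andP[? ?]; lra.
  by move=> x _; rewrite secantE scalerN -scaleNr opprB.
have hN : (s < s0) = false by rewrite ltNge ltW.
have hN' : (s' < s0) = false by rewrite ltNge ltW.
rewrite hN hN' /= !addbF -phimuP//.
rewrite -[RHS](@winding_scale _ _ (fun x => x - s0)) //.
- by apply: winding_eq => x _; rewrite secantE.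
- exact: continuous_secantl.
- by move=> x /in_between H; case: H => /andP[? ?]; lra.
Qed.

Lemma column_winding (t0 t t' : R) :
  unit_segment t0 -> unit_segment t -> unit_segment t' ->
  (t < t0) && (t' < t0) || (t0 < t) && (t0 < t') ->
  winding (fun y => ell t0 - ell y) t t' = column_label t0 t (+) column_label t0 t'.
Proof.
move=> us0 us us'; rewrite /column_label.
have n0 x : between t t' x -> secant ell (x, t0) != 0.
  by move=> xs; apply: secant_neq0 => //; exact: unit_between xs.
case/orP => /andP[h h']; last first.
  rewrite h h' /=.
  rewrite -(@winding_eq _ (fun x => (x - t0) *: - secant ell (x, t0))).
    rewrite (@winding_scale _ (fun x => - secant ell (x, t0))) //.
    - rewrite winding_opp// ?phiellP//; last exact: continuous_secantl.
      by case: (phiell _ _); case: (phiell _ _); case: upper; case: upper.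
    - by move=> x; apply: cvgN; exact: continuous_secantl.
    - by move=> x /n0; rewrite oppr_eq0.
    - by move=> x /in_between H; case: H => /andP[? ?]; lra.
  by move=> x _; rewrite secantE scalerN -scaleNr opprB secantC.
have hN : (t0 < t) = false by rewrite ltNge ltW.
have hN' : (t0 < t') = false by rewrite ltNge ltW.
rewrite hN hN' /= !addbF -phiellP//.
rewrite -[RHS](@winding_scale _ _ (fun x => t0 - x)) //.
- by apply: winding_eq => x _; rewrite secantE secantC.
- exact: continuous_secantl.
- by move=> x /in_between H; case: H => /andP[? ?]; lra.
Qed.

(** Local contribution of one of the four quadrants at a zero with tangents [U] and [V]. The last
    conjunction is [turn] applied to the tangents with the signs of the quadrant; the first two
    terms are the sign corrections at the zero itself. *)
Definition corner_jump U V (left above : bool) :=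
  (left && upper U) (+) (above && upper V) (+)
  ((upper U (+) left (+) (upper V (+) above)) &&
   (upper V (+) above == (0 < cross U V) (+) left (+) above)).

(** The half-planes of [U] and [V] cancel over two adjacent quadrants, and only the orientation of
    the crossing survives. *)
Lemma corner_jump_vertical U V left :
  corner_jump U V left false (+) corner_jump U V left true =
  (0 < cross U V) (+) ~~ left.
Proof.
rewrite /corner_jump; move: (upper U) (upper V) (0 < _) => u v pos.
by case: u; case: v; case: pos; case: left.
Qed.

Lemma corner_jump_horizontal U V :
  corner_jump U V true false (+) corner_jump U V false false = (0 < cross U V).
Proof.
rewrite /corner_jump; move: (upper U) (upper V) (0 < _) => u v pos.
by case: u; case: v; case: pos.
Qed.

Section Zero.
Variables (s0 t0 : R).
Hypothesis us0 : unit_segment s0.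
Hypothesis ut0 : unit_segment t0.
Hypothesis mell : mu s0 = ell t0.
Let U := derive1 mu s0.
Let V := derive1 ell t0.
Hypothesis UV0 : cross U V != 0.

Let base := phimu s0 s0 (+) phiell t0 t0.

Lemma corner_winding (s t : R) : unit_segment s -> unit_segment t ->
  s != s0 -> t != t0 ->
  (forall x y, between s0 s x -> between t0 t y -> mu x = ell y ->
    x = s0 /\ y = t0) ->
  winding (fun y => mu s - ell y) t0 t (+) winding (fun x => mu x - ell t) s0 s =
  row_label s0 s (+) column_label t0 t (+) base (+) corner_jump U V (s < s0) (t0 < t).
Proof.
move=> us ut ss0 tt0 F0.
have U0 : U != 0.
  by apply: contra_neq UV0 => ->; rewrite /cross /= !mul0r subrr.
have V0 : V != 0.
  by apply: contra_neq UV0 => ->; rewrite /cross /= !mulr0 subrr.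
have mu0 x : between s0 s x -> secant mu (x, s0) != 0.
  by move=> /(unit_between us0 us) ?; exact: secant_neq0.
have ell0 x : between t0 t x -> secant ell (x, t0) != 0.
  by move=> /(unit_between ut0 ut) ?; exact: secant_neq0.
have cl0 : (s - s0 < 0) = (s < s0) by rewrite subr_lt0.
have ct0 : (t0 - t < 0) = (t0 < t) by rewrite subr_lt0.
have cs0 : s - s0 != 0 by rewrite subr_eq0.
have cst0 : t0 - t != 0 by rewrite subr_eq0 eq_sym.
rewrite quadrant_winding// !winding_scaler//; try exact: continuous_secantl.
rewrite phimuP; [|assumption..].
rewrite phiellP; [|assumption..].
rewrite secant_diag// secant_diag// /row_label /column_label /corner_jump /base -/U -/V.
move: (upper (secant mu (s, s0))) (upper (secant ell (t, t0))) => um ul.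
rewrite /turn; clearbody U V.
rewrite (upper_scale cs0 U0) (upper_scale cst0 V0) cl0 ct0.
have -> : (0 < cross ((s - s0) *: U) ((t0 - t) *: V)) =
    (0 < cross U V) (+) (s < s0) (+) (t0 < t).
  rewrite crossZ.
  rewrite (mulr_gt0_addb cs0) ?mulf_neq0// (mulr_gt0_addb cst0)// cl0 ct0.
  by case: (s < s0); case: (t0 < t); case: (0 < _).
move: (s < s0) (t0 < t) (upper U) (upper V) (0 < cross U V) => l h u v pos.
rewrite [v (+) h]addbC [u (+) l]addbC; move: (_ && (_ == _)) => j.
move: (phimu s s0) (phimu s0 s0) (phiell t t0) (phiell t0 t0) => p1 p2 p3 p4.
by case: p1; case: p2; case: p3; case: p4; case: j; case: l; case: h; case: u;
  case: v; case: um; case: ul.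
Qed.

(** Sum of [corner_winding] over the lower and upper quadrants on the side of [s]; the row labels
    and [base] occur twice and cancel. *)
Lemma edge_winding (s t t' : R) : unit_segment s -> unit_segment t ->
  unit_segment t' -> s != s0 -> t < t0 -> t0 < t' ->
  (forall x y, between s0 s x -> between t t' y -> mu x = ell y ->
    x = s0 /\ y = t0) ->
  winding (fun y => mu s - ell y) t t' (+)
  (winding (fun x => mu x - ell t) s0 s (+) winding (fun x => mu x - ell t') s0 s) =
  column_label t0 t (+) column_label t0 t' (+) (0 < cross U V) (+) (s0 < s).
Proof.
move=> us ut ut' ss0 tt0 tt0' F0.
have tt't0 : between t t' t0 by apply/in_between; left; rewrite !ltW.
have F1 : forall x y, between s0 s x -> between t0 t y -> mu x = ell y ->
    x = s0 /\ y = t0.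
  move=> x y sx ty; apply: F0 => //; apply: between_sub ty => //; exact: between_l.
have F2 : forall x y, between s0 s x -> between t0 t' y -> mu x = ell y ->
    x = s0 /\ y = t0.
  move=> x y sx ty; apply: F0 => //; apply: between_sub ty => //; exact: between_r.
have E1 := corner_winding us ut ss0 (negbT (lt_eqF tt0)) F1.
have E2 := corner_winding us ut' ss0 (negbT (gt_eqF tt0')) F2.
rewrite (@winding_cat _ _ t t' t0)//; first last.
- move=> y ty; rewrite subr_eq0; apply: contra_neq ss0 => /F0[]//; exact: between_r.
- move=> y; apply: cvgB; first exact: cvg_cst.
  exact: smooth_continuous.
rewrite [winding _ t t0]windingC addbACA E1 E2.
have -> : (t0 < t) = false by apply/negbTE; rewrite -leNgt ltW.
have -> : (s0 < s) = ~~ (s < s0) by rewrite -leNgt lt_neqAle eq_sym ss0.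
rewrite tt0' -[RHS]addbA -corner_jump_vertical.
move: (corner_jump _ _ _ _) (corner_jump _ _ _ _) base => j j' k.
move: (row_label _ _) (column_label _ _) (column_label _ _) => r c c'.
by case: j; case: j'; case: k; case: r; case: c; case: c'.
Qed.

(** The same with the two quadrants below the zero: the row labels of both sides remain, while the
    column label at [t] cancels. *)
Lemma top_winding (s s' t : R) : unit_segment s -> unit_segment s' ->
  unit_segment t -> s < s0 -> s0 < s' -> t < t0 ->
  (forall x y, between s s' x -> between t0 t y -> mu x = ell y ->
    x = s0 /\ y = t0) ->
  winding (fun x => mu x - ell t) s s' (+)
  (winding (fun y => mu s - ell y) t t0 (+) winding (fun y => mu s' - ell y) t t0) =
  row_label s0 s (+) row_label s0 s' (+) (0 < cross U V).
Proof.
move=> us us' ut ss0 ss0' tt0 F0.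
have ss's0 : between s s' s0 by apply/in_between; left; rewrite !ltW.
have F1 : forall x y, between s0 s x -> between t0 t y -> mu x = ell y ->
    x = s0 /\ y = t0.
  move=> x y sx ty; apply: F0 => //; apply: between_sub sx => //; exact: between_l.
have F2 : forall x y, between s0 s' x -> between t0 t y -> mu x = ell y ->
    x = s0 /\ y = t0.
  move=> x y sx ty; apply: F0 => //; apply: between_sub sx => //; exact: between_r.
have E1 := corner_winding us ut (negbT (lt_eqF ss0)) (negbT (lt_eqF tt0)) F1.
have E2 := corner_winding us' ut (negbT (gt_eqF ss0')) (negbT (lt_eqF tt0)) F2.
rewrite (@winding_cat _ _ s s' s0)//; first last.
- move=> x sx; rewrite subr_eq0; apply: contraTneq tt0 => /F0[]//.
    exact: between_r.
  by move=> _ ->; rewrite ltxx.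
- move=> y; apply: cvgB; last exact: cvg_cst.
  exact: smooth_continuous.
rewrite [winding _ s s0]windingC ![winding _ t t0]windingC addbC addbACA E1 E2.
have -> : (t0 < t) = false by apply/negbTE; rewrite -leNgt ltW.
have -> : (s' < s0) = false by apply/negbTE; rewrite -leNgt ltW.
rewrite ss0 -(corner_jump_horizontal U V).
move: (corner_jump _ _ _ _) (corner_jump _ _ _ _) base => j j' k.
move: (row_label _ _) (row_label _ _) (column_label _ _) => r r' c.
by case: j; case: j'; case: k; case: r; case: r'; case: c.
Qed.

End Zero.

End Labels.

(** * Endpoints on the circle *)

Section Circle.
Variable R : realType.
Variables (c : R * R) (r : R).
Implicit Types (z a b u v : R * R).

(** Strict convexity of the disk: it lies, apart from [z], strictly on the inner side of its tangent
    at [z]. *)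
Lemma inward z a : disk_boundary c r z -> disk c r a -> a != z ->
  0 < (c - z).1 * (a - z).1 + (c - z).2 * (a - z).2.
Proof.
rewrite /disk_boundary /disk /= => zr ar az.
have : 0 < (a.1 - z.1) ^+ 2 + (a.2 - z.2) ^+ 2.
  rewrite lt_neqAle addr_ge0 ?sqr_ge0// andbT eq_sym paddr_eq0 ?sqr_ge0//.
  rewrite !sqrf_eq0 !subr_eq0; apply: contra az => /andP[/eqP e1 /eqP e2].
  by rewrite [a]surjective_pairing [z]surjective_pairing e1 e2.
by move: zr ar; case: z {az} => z1 z2; case: a => a1 a2; case: c => c1 c2 /=; nra.
Qed.

Lemma outward z a : disk_boundary c r z -> disk c r a -> a != z ->
  0 < (z - c).1 * (z - a).1 + (z - c).2 * (z - a).2.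
Proof.
move=> zr ar az; have := inward zr ar az.
by rewrite -[c - z]opprB -[a - z]opprB /= !mulrNN.
Qed.

(** Signs of the first coordinates of the inward and outward normals at [z], as they enter
    [winding_half_plane]. *)
Definition on_left z := 0 < (c - z).1.
Definition on_right z := 0 < (z - c).1.

(** A boundary point that is neither left nor right is the highest or the lowest point of the disk,
    so its differences with the other points have second coordinates of one strict sign. *)
Lemma side_upper z a b : disk_boundary c r z -> disk c r a -> disk c r b ->
  a != z -> b != z ->
  (~~ (on_left z (+) on_right z)) && (upper (z - a) (+) upper (z - b)) = false.
Proof.
move=> zr ar br az bz; have := outward zr ar az; have := outward zr br bz.
rewrite /on_left /on_right /= !subr_gt0 /upper.
case: (ltgtP z.1 c.1) => //= zc; rewrite zc subrr !mul0r !add0r.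
case: (ltgtP (z.2 - c.2) 0) => h.
- rewrite !nmulr_rgt0// => h1 h2; rewrite !(lt_gtF h1) !(lt_gtF h2) (lt_eqF h1) (lt_eqF h2).
  by [].
- by rewrite !pmulr_rgt0// => -> ->.
- by rewrite h mul0r ltxx.
Qed.

Lemma disk_boundary_sub z : disk_boundary c r z -> disk c r z.
Proof. by rewrite /disk_boundary /disk /= => ->. Qed.

Lemma reflected z a : disk_boundary c r z -> disk_boundary c r a -> z.2 = a.2 ->
  z.1 != a.1 -> z.1 - c.1 = c.1 - a.1.
Proof.
rewrite /disk_boundary /= => zr ar za2 za1.
have /eqP : (z.1 - a.1) * (z.1 - c.1 - (c.1 - a.1)) = 0.
  by rewrite za2 in zr; lra.
by rewrite mulf_eq0 subr_eq0 (negPf za1) subr_eq0 => /eqP.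
Qed.

Lemma mirror z a : disk_boundary c r z -> disk_boundary c r a -> z.2 = a.2 ->
  z.1 != a.1 -> on_right z = on_left a /\ on_right z != on_right a.
Proof.
move=> zr ar za2 za1; have za := reflected zr ar za2 za1.
rewrite /on_left /on_right /=.
rewrite za; split => //; rewrite -[a.1 - _]opprB oppr_gt0 -za.
by case: (ltgtP (z.1 - c.1) 0) => // h; move: za1; apply: contra_neqT => _; lra.
Qed.

Variables (m0 m1 p0 p1 : R * R).
Hypothesis m0r : disk_boundary c r m0.
Hypothesis p0r : disk_boundary c r p0.

(** The part of [circle_parity] that varies with [z]: [z = m1] gives its left side, and [z = p1] its
    right side up to an application of [side_upper] at [p1]. *)
Definition circle_label z :=
  on_right m0 && upper (m0 - z) (+) upper (z - m0) (+)
  on_right z && (upper (z - p0) (+) upper (z - m0)) (+)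
  on_left p0 && upper (z - p0).

Lemma upper_sub_near z a : z != a -> \forall y \near z,
  upper (y - a) = upper (z - a) \/ (z.2 = a.2 /\ z.1 != a.1).
Proof.
move=> za; have sub_c : continuous (fun y : R * R => y - a).
  by move=> y; apply: cvgB; [exact: cvg_id|exact: cvg_cst].
have za0 : z - a != 0 by rewrite subr_eq0.
have up : nbhs z ((fun y : R * R => y - a) @^-1` _) := sub_c z _ (upper_near za0).
apply: filterS up => y /= [->|[/eqP + + _]]; first by left.
by rewrite /= !subr_eq0 => /eqP ? ?; right.
Qed.

(** A summand can jump only on the vertical axis or at the height of [m0] or [p0]. On the axis
    [side_upper] kills the factor of [on_right z]. At equal heights [z] is the mirror image of the
    endpoint, and an even number of summands jump. *)
Lemma circle_label_near z : (disk_boundary c r `\` [set m0; p0]) z ->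
  \forall y \near z, (disk_boundary c r `\` [set m0; p0]) y ->
  circle_label y = circle_label z.
Proof.
move=> [zr /not_orP[/= /eqP zm0 /eqP zp0]].
have near_side : \forall y \near z, z.1 != c.1 -> on_right y = on_right z.
  have [zc|zc] := eqVneq z.1 c.1.
    by apply: filterS (near_coordinates z ltr01) => y _ /eqP.
  have e0 : 0 < `|z.1 - c.1| by rewrite normr_gt0 subr_eq0.
  apply: filterS (near_coordinates z e0) => y [+ _] _.
  rewrite /on_right /=; move: (zc); rewrite -subr_eq0.
  by case: (ltrgt0P (z.1 - c.1)) => // h _; rewrite ltr_norml => /andP[h1 h2];
    apply/idP/idP; lra.
apply: filterS3 near_side (upper_sub_near zm0) (upper_sub_near zp0).
move=> y Ry Am Ap [yr /not_orP[/= /eqP ym0 /eqP yp0]].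
have upN a b : a != b -> upper (b - a) = ~~ upper (a - b).
  by move=> ab; rewrite -opprB upperN// subr_eq0.
rewrite /circle_label (upN _ _ ym0) (upN _ _ zm0).
have [zc|zc] := eqVneq z.1 c.1.
  have off a : disk_boundary c r a -> z.2 = a.2 -> z.1 != a.1 -> False.
    move=> ar za2 za1; have := reflected zr ar za2 za1; move: za1.
    by rewrite zc subrr => /eqP; lra.
  case: Am => [->|[? ?]]; last by case: (off _ m0r).
  case: Ap => [->|[? ?]]; last by case: (off _ p0r).
  have := side_upper zr (disk_boundary_sub m0r) (disk_boundary_sub p0r).
  rewrite ![_ == z]eq_sym zm0 zp0 => /(_ erefl erefl).
  rewrite {1}/on_left {1}/on_right /= zc subrr ltxx /=.
  by case: (upper (z - m0)); case: (upper (z - p0)) => //= _; rewrite !andbF.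
rewrite (Ry zc).
case: Am => [->|[e2 e1]]; case: Ap => [->|[e2' e1']] //.
- have [-> _] := mirror zr p0r e2' e1'; case: on_left => //=.
  by case: (upper (y - p0)); case: (upper (z - p0)); case: upper; case: on_right.
- have [_] := mirror zr m0r e2 e1; case: (on_right z); case: (on_right m0) => // _.
    by case: upper; case: upper; case: upper; case: on_left.
  by case: upper; case: upper; case: upper; case: on_left.
- have [_] := mirror zr m0r e2 e1; have [-> _] := mirror zr p0r e2' e1'.
  by case: (on_left p0); case: (on_right m0) => // _;
    case: upper; case: upper; case: upper; case: upper.
Qed.

Hypothesis m1r : disk_boundary c r m1.
Hypothesis p1r : disk_boundary c r p1.
Hypothesis ends : uniq [:: m0; m1; p0; p1].
Hypothesis component : exists2 x : R * R,
  (disk_boundary c r `\` [set m0; p0]) x &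
  connected_component (disk_boundary c r `\` [set m0; p0]) x m1 /\
  connected_component (disk_boundary c r `\` [set m0; p0]) x p1.

(** The hypothesis on components is used through the constancy of [circle_label] on the component of
    [m1] and [p1]. The two sides are the endpoint terms of the two computations of a crossing
    sign. *)
Lemma circle_parity :
  on_right m0 && (upper (m0 - p0) (+) upper (m0 - m1)) (+)
  on_left p0 && upper (m0 - p0) (+) upper (m1 - m0) (+)
  (on_right m1 && (upper (m1 - p0) (+) upper (m1 - m0)) (+)
   on_left p0 && upper (m1 - p0)) =
  on_right m0 && (upper (m0 - p0) (+) upper (m0 - p1)) (+)
  on_left p0 && upper (m0 - p0) (+) on_left p1 && upper (m0 - p1) (+)
  (on_left p0 && upper (p1 - p0)) (+)
  (on_left p1 && upper (p0 - p1) (+) upper (p1 - p0)).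
Proof.
have [x Dx [xm1 xp1]] := component.
have : circle_label m1 = circle_label p1.
  set D := _ `\` _ in xm1 xp1.
  apply: (connected_locally_constant (A := connected_component D x)) => //.
    exact: component_connected.
  move=> z /connected_component_sub /circle_label_near.
  by apply: filterS => y + /connected_component_sub; exact.
have [m0p1 p0p1] : m0 != p1 /\ p0 != p1.
  by move: ends; rewrite /= !inE !negb_or => /and4P[/and3P[_ _ ->] _ ->].
have := side_upper p1r (disk_boundary_sub p0r) (disk_boundary_sub m0r) p0p1 m0p1.
rewrite /circle_label.
have upN a b : a != b -> upper (a - b) = ~~ upper (b - a).
  by move=> ab; rewrite -opprB upperN// subr_eq0 eq_sym.
rewrite (upN _ _ m0p1) (upN _ _ p0p1).
case: (upper (m0 - p0)); case: (upper (m0 - m1)); case: (upper (m1 - m0));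
 case: (upper (m1 - p0)); case: (upper (p1 - m0)); case: (upper (p1 - p0));
 case: (on_right m0); case: (on_right m1); case: (on_right p1);
 by case: (on_left p0); case: (on_left p1).
Qed.

End Circle.

(** * Parities of a meander *)

Section Necessity.
Variables (R : realType) (n : nat).
Variables (c : R * R) (r : R) (mu ell : R -> R * R).
Hypothesis emu : smooth_embedding mu.
Hypothesis eell : smooth_embedding ell.
Hypothesis pmu : proper_in_disk c r mu.
Hypothesis pell : proper_in_disk c r ell.
Local Notation m0 := (mu 0).
Local Notation m1 := (mu 1).
Local Notation p0 := (ell 0).
Local Notation p1 := (ell 1).
Hypothesis ends : uniq [:: m0; m1; p0; p1].
Hypothesis component : exists2 x : R * R,
  (disk_boundary c r `\` [set m0; p0]) x &
  connected_component (disk_boundary c r `\` [set m0; p0]) x m1 /\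
  connected_component (disk_boundary c r `\` [set m0; p0]) x p1.
Hypothesis trans : transverse mu ell.
Variables (S T : nat -> R) (q : nat -> nat).
Hypothesis S0 : S 0%N = 0.
Hypothesis S1 : S n.+1 = 1.
Hypothesis ltS : forall i j, (i < j <= n.+1)%N -> S i < S j.
Variable mid : nat -> R.
Hypothesis mid_between : forall k, (k <= n)%N -> S k < mid k < S k.+1.
Hypothesis T0 : T 0%N = 0.
Hypothesis T1 : T n.+1 = 1.
Hypothesis ltT : forall i j, (i < j <= n.+1)%N -> T i < T j.
Hypothesis q_bound : forall k, (1 <= k <= n)%N -> (1 <= q k <= n)%N.
Hypothesis q_inj : forall i j, (1 <= i <= n)%N -> (1 <= j <= n)%N ->
  q i = q j -> i = j.
Hypothesis meet : forall k, (1 <= k <= n)%N -> mu (S k) = ell (T (q k)).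
Hypothesis meet_only : forall x y, unit_segment x -> unit_segment y ->
  mu x = ell y -> exists2 k, (1 <= k <= n)%N & x = S k /\ y = T (q k).

Let smu : smooth mu. Proof. by case: emu. Qed.
Let sell : smooth ell. Proof. by case: eell. Qed.
Let cmu : continuous mu. Proof. exact: smooth_continuous. Qed.
Let cell : continuous ell. Proof. exact: smooth_continuous. Qed.

Lemma unit0 : unit_segment (0 : R).
Proof. by rewrite /unit_segment /= in_itv /= lexx ler01. Qed.
Lemma unit1 : unit_segment (1 : R).
Proof. by rewrite /unit_segment /= in_itv /= lexx ler01. Qed.
Hint Resolve unit0 unit1 : core.

Lemma ltS_iff i j : (i <= n.+1)%N -> (j <= n.+1)%N -> (S i < S j) = (i < j)%N.
Proof.
move=> i1 j1; case: (ltngtP i j) => h.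
- by rewrite ltS// h.
- by apply/negbTE; rewrite -leNgt ltW// ltS// h.
- by rewrite h ltxx.
Qed.

Lemma ltT_iff i j : (i <= n.+1)%N -> (j <= n.+1)%N -> (T i < T j) = (i < j)%N.
Proof.
move=> i1 j1; case: (ltngtP i j) => h.
- by rewrite ltT// h.
- by apply/negbTE; rewrite -leNgt ltW// ltT// h.
- by rewrite h ltxx.
Qed.

Lemma unitS k : (k <= n.+1)%N -> unit_segment (S k).
Proof.
move=> kn; rewrite /unit_segment /= in_itv /= -{1}S0 -{1}S1.
by rewrite !leNgt !ltS_iff//; lia.
Qed.

Lemma unitT k : (k <= n.+1)%N -> unit_segment (T k).
Proof.
move=> kn; rewrite /unit_segment /= in_itv /= -{1}T0 -{1}T1.
by rewrite !leNgt !ltT_iff//; lia.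
Qed.

Lemma mu_disk x : unit_segment x -> disk c r (mu x).
Proof. by case: pmu => + _; exact. Qed.
Lemma ell_disk x : unit_segment x -> disk c r (ell x).
Proof. by case: pell => + _; exact. Qed.
Lemma mu_boundary x : x = 0 \/ x = 1 -> disk_boundary c r (mu x).
Proof. by case: pmu => _ H [->|->]; apply/H; auto. Qed.
Lemma ell_boundary x : x = 0 \/ x = 1 -> disk_boundary c r (ell x).
Proof. by case: pell => _ H [->|->]; apply/H; auto. Qed.

Lemma mu_inj x y : unit_segment x -> unit_segment y -> mu x = mu y -> x = y.
Proof.
by case: emu => _ _ [_ [h [hmu _]]] ux uy E; rewrite -(hmu x)// E hmu.
Qed.

Lemma mu_ell0 x y : unit_segment x -> unit_segment y -> y = 0 \/ y = 1 -> mu x != ell y.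
Proof.
move=> ux uy y01; apply/eqP => /meet_only[]// k /q_bound kn [_ yE].
have : T 0 < T (q k) < T n.+1 by rewrite !ltT_iff//; lia.
by rewrite -yE T0 T1; case: y01 => ->; rewrite ltxx ?andbF.
Qed.

Lemma mu0_ell x y : unit_segment x -> unit_segment y -> x = 0 \/ x = 1 -> mu x != ell y.
Proof.
move=> ux uy x01; apply/eqP => /meet_only[]// k kn [xE _].
have : S 0 < S k < S n.+1 by rewrite !ltS_iff//; lia.
by rewrite -xE S0 S1; case: x01 => ->; rewrite ltxx ?andbF.
Qed.

Variables phimu phiell : R -> R -> bool.
Hypothesis phimuP : forall s a b,
  unit_segment s -> unit_segment a -> unit_segment b ->
  winding (fun x => secant mu (x, s)) a b = phimu a s (+) phimu b s.
Hypothesis phiellP : forall s a b,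
  unit_segment s -> unit_segment a -> unit_segment b ->
  winding (fun x => secant ell (x, s)) a b = phiell a s (+) phiell b s.
Hypothesis phimuC : forall a b, unit_segment a -> unit_segment b ->
  phimu a b = phimu b a.
Hypothesis phiellC : forall a b, unit_segment a -> unit_segment b ->
  phiell a b = phiell b a.

Local Notation row := (row_label mu phimu).
Local Notation column := (column_label ell phiell).

Definition sense k : bool := 0 < cross (derive1 mu (S k)) (derive1 ell (T (q k))).

Lemma cross_neq0 k : (1 <= k <= n)%N ->
  cross (derive1 mu (S k)) (derive1 ell (T (q k))) != 0.
Proof.
move=> kn; have qn := q_bound kn.
have us : unit_segment (S k) by apply: unitS; lia.
have ut : unit_segment (T (q k)) by apply: unitT; lia.
have tr := trans us ut (meet kn).
move: (derive1 mu _) (derive1 ell _) tr => [u1 u2] [v1 v2] tr.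
have [a [b [e1 e2]]] := tr (1, 0); have [a' [b' [e1' e2']]] := tr (0, 1).
rewrite /cross /=; apply/eqP => uv0.
have : (a * b' - a' * b) * (u1 * v2 - u2 * v1) = 1.
  transitivity ((a * u1 + b * v1) * (a' * u2 + b' * v2) -
                (a * u2 + b * v2) * (a' * u1 + b' * v1)); first by ring.
  move: e1 e2 e1' e2'; rewrite /= /GRing.scale /= => <- <- <- <-.
  by rewrite mul1r mul0r subr0.
by rewrite uv0 mulr0 => /eqP; rewrite eq_sym oner_eq0.
Qed.

(** Label on the lower edge of the square, where [F] is [mu x - p0] and stays on one side of the
    tangent at [p0]. *)
Definition bottom s := on_left c p0 && upper (mu s - p0).

(** Compares the label [h] on the line at height [t] with the label carried from the lower edge up
    the column at [s]. Moving [s] across a rectangle without zeros leaves it unchanged. *)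
Definition discrepancy (t : R) (h : R -> bool) s :=
  winding (fun y => mu s - ell y) 0 t (+) bottom s (+) h s.

Lemma winding_inward g z s s' : smooth g ->
  (forall x, unit_segment x -> disk c r (g x)) -> disk_boundary c r z ->
  unit_segment s -> unit_segment s' -> (forall x, between s s' x -> g x != z) ->
  winding (fun x => g x - z) s s' =
  on_left c z && (upper (g s - z) (+) upper (g s' - z)).
Proof.
move=> sg gd zr us us' gz.
rewrite (@winding_half_plane _ _ (c - z))//.
- by move=> x; apply: cvgB; [exact: smooth_continuous|exact: cvg_cst].
- move=> x sx; apply: (inward zr); last exact: gz.
  exact/gd/(unit_between us us').
Qed.

Lemma winding_outward g z s s' : smooth g ->
  (forall x, unit_segment x -> disk c r (g x)) -> disk_boundary c r z ->
  unit_segment s -> unit_segment s' -> (forall x, between s s' x -> g x != z) ->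
  winding (fun x => z - g x) s s' =
  on_right c z && (upper (z - g s) (+) upper (z - g s')).
Proof.
move=> sg gd zr us us' gz.
rewrite (@winding_half_plane _ _ (z - c))//.
- by move=> x; apply: cvgB; [exact: cvg_cst|exact: smooth_continuous].
- move=> x sx; apply: (outward zr); last exact: gz.
  exact/gd/(unit_between us us').
Qed.

Lemma winding_bottom s s' : unit_segment s -> unit_segment s' ->
  winding (fun x => mu x - p0) s s' = bottom s (+) bottom s'.
Proof.
move=> us us'; rewrite winding_inward//.
- by rewrite /bottom; case: (on_left c p0).
- exact: mu_disk.
- by apply: ell_boundary; left.
by move=> x /(unit_between us us') ux; apply: mu_ell0; auto.
Qed.

Let F (p : R * R) := mu p.1 - ell p.2.

Lemma continuousF : continuous F.
Proof.
move=> p; apply: cvgB; apply: continuous_comp.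
- exact: cvg_fst. - exact: cmu. - exact: cvg_snd. - exact: cell.
Qed.

Lemma rectangle_winding s s' t : unit_segment s -> unit_segment s' -> unit_segment t ->
  (forall x y, between s s' x -> between 0 t y -> mu x != ell y) ->
  winding (fun x => mu x - ell t) s s' =
  winding (fun y => mu s - ell y) 0 t (+) winding (fun y => mu s' - ell y) 0 t (+)
  bottom s (+) bottom s'.
Proof.
move=> us us' ut F0.
have := @winding_rectangle R F s s' 0 t continuousF.
rewrite /F /= winding_bottom// => <-; last first.
  by move=> x y sx ty; rewrite subr_eq0 F0.
by case: (bottom s); case: (bottom s'); case: winding.
Qed.

Lemma discrepancy_eq t h s s' : unit_segment s -> unit_segment s' -> unit_segment t ->
  (forall x y, between s s' x -> between 0 t y -> mu x != ell y) ->
  winding (fun x => mu x - ell t) s s' = h s (+) h s' ->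
  discrepancy t h s = discrepancy t h s'.
Proof.
move=> us us' ut F0; rewrite rectangle_winding// /discrepancy.
case: (winding _ _ _); case: (winding _ _ _); case: (bottom s); case: (bottom s');
by case: (h s); case: (h s').
Qed.

Definition column_base k := bottom (S k) (+) column (T (q k)) 0.

(** If the zero is above [t], the column can be moved to [S k] itself, where [F] equals
    [ell (T (q k)) - ell y] and is labelled by [column]. If it is below, [edge_winding] adds the
    orientation and the side. *)
Lemma strip k s t h : (1 <= k <= n)%N -> unit_segment s -> unit_segment t ->
  s != S k -> t != T (q k) -> 0 < t ->
  (forall i, (1 <= i <= n)%N -> between (S k) s (S i) -> i = k) ->
  winding (fun x => mu x - ell t) (S k) s = h (S k) (+) h s ->
  discrepancy t h s = column_base k (+) (h (S k) (+) column (T (q k)) t) (+)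
    ((T (q k) < t) && (sense k (+) (S k < s))).
Proof.
move=> kn us ut sk tk t0 only hrow.
have qn := q_bound kn.
have usk : unit_segment (S k) by apply: unitS; lia.
have utk : unit_segment (T (q k)) by apply: unitT; lia.
have Tk0 : 0 < T (q k) by rewrite -T0 ltT_iff//; lia.
have only2 x y : between (S k) s x -> between 0 t y -> mu x = ell y ->
    x = S k /\ y = T (q k).
  move=> sx ty /meet_only[||i i1 [xE yE]].
  - exact: unit_between sx.
  - exact: unit_between ty.
  by rewrite -(only i i1) -?xE.
case: (ltgtP (T (q k)) t) tk => // lt _ /=.
  have := edge_winding emu eell phimuP phiellP usk utk (meet kn) (cross_neq0 kn) us
    unit0 ut sk Tk0 lt only2.
  rewrite winding_bottom// hrow /discrepancy /column_base -/(sense k).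
  move: (winding _ _ _) (bottom _) (bottom _) (h _) (h _) (column _ _) (column _ _) (sense k) (S k < s).
  by move=> a1 a2 a3 a4 a5 a6 a7 a8 a9; case: a1; case: a2; case: a3; case: a4; case: a5;
    case: a6; case: a7; case: a8; case: a9.
have E : discrepancy t h (S k) = discrepancy t h s.
  apply: discrepancy_eq => // x y sx ty; apply/eqP => /only2[]// _ yE.
  by move: ty => /in_between; rewrite yE; case=> /andP[? ?]; lra.
rewrite -E addbF /discrepancy /column_base meet// (column_winding eell phiellP) ?Tk0 ?lt//.
case: (column _ _); case: (column _ _); case: (bottom _); by case: (h _).
Qed.

(** When the line passes through the zero, only the two quadrants below it count, as in
    [top_winding]. *)
Lemma strip_row k s s' : (1 <= k <= n)%N -> unit_segment s -> unit_segment s' ->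
  s < S k -> S k < s' ->
  (forall i, (1 <= i <= n)%N -> between s s' (S i) -> i = k) ->
  discrepancy (T (q k)) (row (S k)) s' =
  discrepancy (T (q k)) (row (S k)) s (+) sense k.
Proof.
move=> kn us us' sk sk' only.
have qn := q_bound kn.
have usk : unit_segment (S k) by apply: unitS; lia.
have utk : unit_segment (T (q k)) by apply: unitT; lia.
have Tk0 : 0 < T (q k) by rewrite -T0 ltT_iff//; lia.
have only2 x y : between s s' x -> between (T (q k)) 0 y -> mu x = ell y ->
    x = S k /\ y = T (q k).
  move=> sx ty /meet_only[||i i1 [xE yE]].
  - exact: unit_between sx.
  - exact: unit_between ty.
  by rewrite -(only i i1) -?xE.
have := top_winding emu eell phimuP phiellP usk utk (meet kn) (cross_neq0 kn) us
    us' unit0 sk sk' Tk0 only2.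
rewrite winding_bottom// /discrepancy -/(sense k).
move: (winding _ _ _) (winding _ _ _) (bottom _) (bottom _) (row _ _) (row _ _) (sense k).
by move=> a1 a2 a3 a4 a5 a6 a7; case: a1; case: a2; case: a3; case: a4; case: a5;
    case: a6; case: a7.
Qed.

Lemma unit_mid k : (k <= n)%N -> unit_segment (mid k).
Proof.
move=> kn; have /andP[? ?] := mid_between kn.
apply: (@unit_between _ (S k) (S k.+1)); try by apply: unitS; lia.
by apply/in_between; left; rewrite !ltW.
Qed.

Lemma mid_only k s i : (k <= n)%N -> (i <= n.+1)%N ->
  s = S k \/ s = S k.+1 -> between s (mid k) (S i) -> s = S i.
Proof.
move=> kn iN sE /in_between H; have /andP[? ?] := mid_between kn.
have [ik|ki] := leqP i k; last first.
  have ge : S k.+1 <= S i by rewrite leNgt ltS_iff//; lia.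
  by case: sE H => -> [] /andP[? ?]; lra.
have le : S i <= S k by rewrite leNgt ltS_iff//; lia.
by case: sE H => -> [] /andP[? ?]; lra.
Qed.

Lemma S_inj i j : (i <= n.+1)%N -> (j <= n.+1)%N -> S i = S j -> i = j.
Proof.
move=> iN jN ij; case: (ltngtP i j) => // h; first by
  have : S i < S j by [rewrite ltS_iff]; rewrite ij ltxx.
by have : S j < S i by [rewrite ltS_iff]; rewrite ij ltxx.
Qed.

Definition below i v : bool := \big[addb/false]_(1 <= k < i.+1) (q k < v)%N.

Section Row.
Variables (t : R) (h : R -> bool) (v : nat).
Hypothesis ut : unit_segment t.
Hypothesis t0 : 0 < t.

(** The number [v] is the rank of the height [t] among the labels. The two applications of [strip],
    left and right of [S k], differ only by the side, and only if the zero is below [t]. *)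
Lemma row_step k : (1 <= k <= n)%N -> t != T (q k) ->
  (T (q k) < t) = (q k < v)%N ->
  (forall s, unit_segment s -> between (mid k.-1) (mid k) s ->
    winding (fun x => mu x - ell t) (S k) s = h (S k) (+) h s) ->
  discrepancy t h (mid k.-1) =
    column_base k (+) (h (S k) (+) column (T (q k)) t) (+) (q k < v)%N && sense k /\
  discrepancy t h (mid k) = discrepancy t h (mid k.-1) (+) (q k < v)%N.
Proof.
move=> kn tk tv hrow; have k1 : (k.-1 <= n)%N by lia.
have /andP[kl kr] := mid_between k1.
have kn' : (k <= n)%N by lia.
have /andP[kl' kr'] := mid_between kn'.
have kE : k.-1.+1 = k by lia.
rewrite kE in kr.
have um := unit_mid k1; have um' := unit_mid kn'.
suff [E E'] : discrepancy t h (mid k.-1) =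
      column_base k (+) (h (S k) (+) column (T (q k)) t) (+) (q k < v)%N && sense k /\
    discrepancy t h (mid k) =
      column_base k (+) (h (S k) (+) column (T (q k)) t) (+) (q k < v)%N && ~~ sense k.
  split; first exact: E.
  apply: (etrans E'); rewrite [in RHS]E; move: (_ (+) (_ (+) _)) => a.
  by case: a; case: (q k < v)%N; case: (sense k).
split.
  rewrite (@strip k)//; first last.
  - by apply: (hrow _ um); exact: between_l.
  - move=> i i1 H; apply: S_inj; try lia; apply/esym/(mid_only k1) => //; first lia.
    by rewrite kE; right.
  - by rewrite lt_eqF.
  - by rewrite tv (lt_gtF kr) addbF.
rewrite (@strip k)//; first last.
- by apply: (hrow _ um'); exact: between_r.
- move=> i i1 H; apply: S_inj; try lia; apply/esym/(mid_only kn') => //; first lia.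
  by left.
- by rewrite gt_eqF.
- by rewrite tv kl' addbT.
Qed.

Lemma row_ends :
  winding (fun x => mu x - ell t) 0 (mid 0) = h 0 (+) h (mid 0) ->
  winding (fun x => mu x - ell t) 1 (mid n) = h 1 (+) h (mid n) ->
  discrepancy t h 0 = discrepancy t h (mid 0) /\
  discrepancy t h 1 = discrepancy t h (mid n).
Proof.
move=> h0 h1; split; apply: discrepancy_eq => //; try exact: unit_mid.
- move=> x y sx ty; apply/eqP => /meet_only[||i i1 [xE yE]].
  + by apply: unit_between sx => //; exact: unit_mid.
  + exact: unit_between ty.
  rewrite xE -S0 in sx; move/(@mid_only 0): sx => /(_ isT) H.
  have : 0%N = i by apply: S_inj => //; [lia|apply: H; [lia|left]].
  by lia.
- move=> x y sx ty; apply/eqP => /meet_only[||i i1 [xE yE]].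
  + by apply: unit_between sx => //; exact: unit_mid.
  + exact: unit_between ty.
  rewrite xE -S1 in sx; move/(@mid_only n): sx => /(_ (leqnn n)) H.
  have : n.+1 = i by apply: S_inj => //; [lia|apply: H; [lia|right]].
  by lia.
Qed.

End Row.

Lemma upper_secant (g : R -> R * R) (x y : R) : x < y -> upper (secant g (x, y)) = upper (g y - g x).
Proof. by move=> xy; rewrite secantE upperZ ?subr_gt0// secantC. Qed.

Lemma below0 v : below 0 v = false.
Proof. by rewrite /below big_geq. Qed.

Lemma belowS k v : below k.+1 v = below k v (+) (q k.+1 < v)%N.
Proof. by rewrite /below big_nat_recr. Qed.

Lemma row_same_side j k s : (1 <= j <= n)%N -> (1 <= k <= n)%N -> k != j ->
  unit_segment s -> S k.-1 < s -> s < S k.+1 ->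
  winding (fun x => mu x - ell (T (q j))) (S k) s =
  row (S j) (S k) (+) row (S j) s.
Proof.
move=> jn kn kj us sl sr; rewrite -(meet jn) (row_winding emu phimuP)//.
- by apply: unitS; clear -jn; lia.
- by apply: unitS; clear -kn; lia.
have [lt|lt|E] := ltngtP k j; last by rewrite E eqxx in kj.
- have H1 : S k < S j by apply: ltS; clear -jn lt; lia.
  have H2 : S k.+1 <= S j.
    have [<-|ne] := eqVneq k.+1 j; first exact: lexx.
    by apply/ltW/ltS; clear -jn lt ne; lia.
  by rewrite H1 (lt_le_trans sr H2).
- have H1 : S j < S k by apply: ltS; clear -kn lt; lia.
  have H2 : S j <= S k.-1.
    have [->|ne] := eqVneq j k.-1; first exact: lexx.
    by apply/ltW/ltS; clear -kn lt ne; lia.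
  by rewrite H1 (le_lt_trans H2 sl) orbT.
Qed.

Lemma between_mid k s : (1 <= k <= n)%N -> between (mid k.-1) (mid k) s ->
  S k.-1 < s < S k.+1.
Proof.
move=> kn /in_between.
have k1 : (k.-1 <= n)%N by clear -kn; lia.
have kn' : (k <= n)%N by clear -kn; lia.
have kE : k.-1.+1 = k by clear -kn; lia.
have /andP[a1 a2] := mid_between k1; have /andP[a3 a4] := mid_between kn'.
rewrite kE in a2.
by case=> /andP[? ?]; apply/andP; split; lra.
Qed.

Local Notation rowd j := (discrepancy (T (q j)) (row (S j))).

Lemma row_value_step j k : (1 <= j <= n)%N -> (1 <= k <= n)%N -> k != j ->
  rowd j (mid k.-1) = column_base k (+)
    (row (S j) (S k) (+) column (T (q k)) (T (q j))) (+) (q k < q j)%N && sense k /\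
  rowd j (mid k) = rowd j (mid k.-1) (+) (q k < q j)%N.
Proof.
move=> jn kn kj; have qj := q_bound jn; have qk := q_bound kn.
have qj' : (q j <= n.+1)%N by clear -qj; lia.
have qk' : (q k <= n.+1)%N by clear -qk; lia.
apply: row_step => //.
- exact: unitT.
- by rewrite -T0 ltT_iff//; clear -qj; lia.
- have : q j != q k by apply: contra_neq kj => /(q_inj jn kn).
  by case: ltngtP => // h _; [rewrite lt_eqF|rewrite gt_eqF]; rewrite // ltT_iff.
- exact: ltT_iff.
- move=> s us /(between_mid kn)/andP[? ?]; exact: row_same_side.
Qed.

Lemma rowd_ends j : (1 <= j <= n)%N ->
  rowd j 0 = rowd j (mid 0) /\ rowd j 1 = rowd j (mid n).
Proof.
move=> jn; have qj := q_bound jn.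
have uj : unit_segment (S j) by apply: unitS; clear -jn; lia.
have ut : unit_segment (T (q j)) by apply: unitT; clear -qj; lia.
have /andP[a1 a2] := mid_between (leq0n n).
have /andP[a3 a4] := mid_between (leqnn n).
have um := unit_mid (leq0n n); have um' := unit_mid (leqnn n).
have Tj0 : 0 < T (q j) by rewrite -T0; apply: ltT; clear -qj; lia.
have b1 : S 0%N < S j by apply: ltS; clear -jn; lia.
have b2 : S 1%N <= S j by rewrite leNgt ltS_iff; clear -jn; lia.
have b3 : S j < S n.+1 by apply: ltS; clear -jn; lia.
have b4 : S j <= S n by rewrite leNgt ltS_iff; clear -jn; lia.
apply: row_ends => //; rewrite -(meet jn) (row_winding emu phimuP)//.
- by rewrite -S0 b1 (lt_le_trans a2 b2).
- by rewrite -S1 b3 (le_lt_trans b4 a3) orbT.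
Qed.

(** Each point passed contributes a flip if it is below the row, except [j] itself, through which
    the row goes and which contributes [sense j]. *)
Lemma row_value j i : (1 <= j <= n)%N -> (i <= n)%N ->
  rowd j (mid i) = rowd j 0 (+) below i (q j) (+) ((j <= i)%N && sense j).
Proof.
move=> jn; have [E0 _] := rowd_ends jn; elim: i => [_|i IH iN].
  have -> : (j <= 0)%N = false by clear -jn; lia.
  by rewrite below0 !addbF E0.
have iN' : (i <= n)%N by clear -iN; lia.
have [E|ne] := eqVneq i.+1 j.
  have /andP[a1 a2] := mid_between iN'; have /andP[a3 a4] := mid_between iN.
  rewrite (@strip_row j (mid i) (mid i.+1))//.
  - rewrite IH// belowS E ltnn leqnn -E ltnn.
    by rewrite addbF addbF.
  - exact: unit_mid.
  - exact: unit_mid.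
  - by rewrite -E.
  - by rewrite -E.
  - move=> k kn /in_between H.
    have H1 : S i < S k by case: H => /andP[? ?]; lra.
    have H2 : S k < S i.+2 by case: H => /andP[? ?]; lra.
    have kN : (k <= n.+1)%N by clear -kn; lia.
    have iN2 : (i.+2 <= n.+1)%N by clear -iN; lia.
    rewrite ltS_iff ?(leqW iN')// in H1; rewrite ltS_iff// in H2.
    by clear -E H1 H2; lia.
have [_ ->] := @row_value_step j i.+1 jn iN ne; rewrite /= IH// belowS.
have -> : (j <= i.+1)%N = (j <= i)%N by clear -ne; lia.
by move: (rowd j 0) (below _ _) (_ && _) (_ < _)%N => -[] [] [] [].
Qed.

(** The value just left of [S i] on the row of [j] is known by counting from the left end
    ([row_value]) and locally at [i] ([row_value_step]); equating the two isolates the labels of the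
    pair. *)
Lemma discrepancy_pair i j : (1 <= i <= n)%N -> (1 <= j <= n)%N -> i != j ->
  row (S j) (S i) (+) column (T (q i)) (T (q j)) =
  column_base i (+) rowd j 0 (+) below i.-1 (q j) (+)
  ((j < i)%N && sense j) (+) ((q i < q j)%N && sense i).
Proof.
move=> iN jN ij; have [+ _] := row_value_step jN iN ij.
rewrite row_value//; last by clear -iN; lia.
have -> : (j <= i.-1)%N = (j < i)%N by clear -iN; lia.
move: (column_base i) (rowd j 0) (below _ _) (_ (+) column _ _) (_ && _) (_ && _).
by case=> -[] [] [] [] [].
Qed.

(** By symmetry of [phimu] and [phiell] only two [upper] terms remain. Both concern the vector
    joining the two intersection points, read in the same direction if [q i < q j] and in opposite
    directions otherwise. *)
Lemma row_column_sym i j : (1 <= i <= n)%N -> (1 <= j <= n)%N -> (i < j)%N ->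
  (row (S j) (S i) (+) column (T (q i)) (T (q j))) (+)
  (row (S i) (S j) (+) column (T (q j)) (T (q i))) = (q j < q i)%N.
Proof.
move=> iN jN ij; have qi := q_bound iN; have qj := q_bound jN.
have uSi : unit_segment (S i) by apply: unitS; clear -iN; lia.
have uSj : unit_segment (S j) by apply: unitS; clear -jN; lia.
have uTi : unit_segment (T (q i)) by apply: unitT; clear -qi; lia.
have uTj : unit_segment (T (q j)) by apply: unitT; clear -qj; lia.
have Sij : S i < S j by apply: ltS; clear -ij jN; lia.
have ij0 : mu (S j) != mu (S i).
  by apply: contraTneq Sij => /mu_inj ->; rewrite ?ltxx.
rewrite /row_label /column_label Sij (lt_gtF Sij) /= addbF.
rewrite (phimuC uSj uSi) (phiellC uTj uTi) upper_secant//.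
have Tij : T (q i) != T (q j).
  apply: contra_neq ij0 => TE; rewrite (meet iN) (meet jN) TE //.
have [lt|lt|E] := ltngtP (q i) (q j); last by rewrite E eqxx in Tij.
- have Tlt : T (q i) < T (q j) by apply: ltT; clear -lt qj; lia.
  rewrite Tlt (lt_gtF Tlt) /= addbF secantC upper_secant// -!meet//.
  by case: (phimu _ _); case: (phiell _ _); case: upper.
- have Tlt : T (q j) < T (q i) by apply: ltT; clear -lt qi; lia.
  rewrite Tlt (lt_gtF Tlt) /= addbF secantC upper_secant// -!meet//.
  rewrite -(opprB (mu (S j))) upperN ?subr_eq0//.
  by case: (phimu _ _); case: (phiell _ _); case: upper.
Qed.

Definition top s := on_left c p1 && upper (mu s - p1).

Local Notation topd := (discrepancy 1 top).

Lemma winding_top s s' : unit_segment s -> unit_segment s' ->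
  winding (fun x => mu x - ell 1) s s' = top s (+) top s'.
Proof.
move=> us us'; rewrite winding_inward//.
- by rewrite /top; case: (on_left c p1).
- exact: mu_disk.
- by apply: ell_boundary; right.
by move=> x /(unit_between us us') ux; apply: mu_ell0; auto.
Qed.

Lemma top_step k : (1 <= k <= n)%N ->
  topd (mid k.-1) = column_base k (+)
    (top (S k) (+) column (T (q k)) 1) (+) (q k < n.+1)%N && sense k /\
  topd (mid k) = topd (mid k.-1) (+) (q k < n.+1)%N.
Proof.
move=> kn; have qk := q_bound kn.
have lt1 : T (q k) < T n.+1 by apply: ltT; clear -qk; lia.
rewrite T1 in lt1.
have qn : (q k < n.+1)%N by clear -qk; lia.
apply: row_step => //.
- by rewrite gt_eqF.
- by rewrite lt1 qn.
- move=> s us _; apply: winding_top => //; apply: unitS; clear -kn; lia.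
Qed.

Lemma top_value i : (i <= n)%N -> topd (mid i) = topd 0 (+) odd i.
Proof.
elim: i => [_|i IH iN].
  have [] := @row_ends 1 top unit1 ltr01; try (apply: winding_top => //; exact: unit_mid).
  by rewrite addbF => ->.
have [_ ->] := @top_step i.+1 iN; have qk := @q_bound i.+1 iN.
have -> : (q i.+1 < n.+1)%N by clear -qk; lia.
rewrite /= IH; last by clear -iN; lia.
by rewrite -addbA addbT.
Qed.

(** First computation of the crossing sign, on the top edge: every zero lies below it, so the count
    is the position. *)
Lemma sense_position k : (1 <= k <= n)%N ->
  sense k = odd k.-1 (+) topd 0 (+) column_base k (+)
    (top (S k) (+) column (T (q k)) 1).
Proof.
move=> kn; have qk := q_bound kn; have [+ _] := top_step kn.
rewrite top_value; last by clear -kn; lia.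
have -> : (q k < n.+1)%N by clear -qk; lia.
move: (topd 0) (odd _) (column_base _) (_ (+) column _ _) (sense k).
by case=> -[] [] [] [].
Qed.

Hypothesis q_count : forall j, (1 <= j <= n)%N -> below n (q j) = odd (q j).-1.

(** Second computation, from one end to the other of the row of [j]: by [q_count] the points below
    it are counted by the label. *)
Lemma sense_label j : (1 <= j <= n)%N ->
  sense j = odd (q j).-1 (+) rowd j 0 (+) rowd j 1.
Proof.
move=> jn; have [_ ->] := rowd_ends jn; rewrite row_value// q_count//.
have -> : (j <= n)%N by clear -jn; lia.
move: (rowd j 0) (odd _) (sense j); by case=> -[] [].
Qed.

Lemma upper_subC (a b : R * R) : a != b -> upper (a - b) = ~~ upper (b - a).
Proof. by move=> ab; rewrite -opprB upperN// subr_eq0 eq_sym. Qed.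

Lemma winding_secant0 (g : R -> R * R) (a b : R) : smooth_embedding g -> unit_segment a -> unit_segment b ->
  0 < a -> 0 < b ->
  winding (fun x => secant g (x, 0)) a b = winding (fun x => g x - g 0) a b.
Proof.
move=> eg ua ub a0 b0; have [sg _ _] := eg.
rewrite -(@winding_scale _ (fun x => secant g (x, 0)) id)//.
- by apply: winding_eq => x _; rewrite secantE subr0.
- exact: continuous_secantl.
- move=> x /(unit_between ua ub) ux; exact: secant_neq0.
- by move=> x /in_between[] /andP[? ?] /=; lra.
Qed.

Lemma winding_secant1 (g : R -> R * R) (a b : R) : smooth_embedding g -> unit_segment a -> unit_segment b ->
  a < 1 -> b < 1 ->
  winding (fun x => secant g (x, 1)) a b = winding (fun x => g 1 - g x) a b.
Proof.
move=> eg ua ub a0 b0; have [sg _ _] := eg.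
rewrite -(@winding_scale _ (fun x => secant g (x, 1)) (fun x => 1 - x))//.
- by apply: winding_eq => x _; rewrite secantE secantC.
- exact: continuous_secantl.
- move=> x /(unit_between ua ub) ux; exact: secant_neq0.
- by move=> x /in_between[] /andP[? ?] /=; lra.
Qed.

Lemma inside_neq (g : R -> R * R) (x z : R) : smooth_embedding g -> unit_segment x -> unit_segment z ->
  x != z -> g x != g z.
Proof.
move=> [_ _ [_ [h [hg _]]]] ux uz; apply: contra_neq => E.
by rewrite -(hg x)// E hg.
Qed.

Let bd_m0 : disk_boundary c r m0. Proof. by apply: mu_boundary; left. Qed.
Let bd_m1 : disk_boundary c r m1. Proof. by apply: mu_boundary; right. Qed.
Let bd_p0 : disk_boundary c r p0. Proof. by apply: ell_boundary; left. Qed.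
Let bd_p1 : disk_boundary c r p1. Proof. by apply: ell_boundary; right. Qed.

Lemma Sk01 k : (1 <= k <= n)%N -> 0 < S k /\ S k < 1.
Proof. by move=> kn; rewrite -S0 -S1; split; apply: ltS; clear -kn; lia. Qed.

Lemma Tk01 k : (1 <= k <= n)%N -> 0 < T k /\ T k < 1.
Proof. by move=> kn; rewrite -T0 -T1; split; apply: ltT; clear -kn; lia. Qed.

Lemma winding_column (z : R * R) (t : R) : disk_boundary c r z -> unit_segment t ->
  (forall y, unit_segment y -> ell y != z) ->
  winding (fun y => z - ell y) 0 t =
  on_right c z && (upper (z - p0) (+) upper (z - ell t)).
Proof.
move=> zr ut ellz; apply: winding_outward => //; first exact: ell_disk.
by move=> x /(unit_between unit0 ut) /ellz.
Qed.

(** The point [mu (S j)] is eliminated: convexity evaluates the winding of the secants at [m0]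
    between the parameters [S j] and 1, and [side_upper] removes what is left. The result is the
    same for all [j], which is what later lets it cancel. *)
Lemma rowd0 j : (1 <= j <= n)%N -> rowd j 0 =
  on_right c m0 && (upper (m0 - p0) (+) upper (m0 - m1)) (+)
  on_left c p0 && upper (m0 - p0) (+) upper (m1 - m0) (+) phimu 0 1.
Proof.
move=> jn; have qj := q_bound jn; have [Sj0 Sj1] := Sk01 jn; have [Tj0 Tj1] := Tk01 qj.
have uj : unit_segment (S j) by apply: unitS; clear -jn; lia.
have ut : unit_segment (T (q j)) by apply: unitT; clear -qj; lia.
rewrite /discrepancy winding_column//; last first.
  by move=> y uy; rewrite eq_sym; apply: mu0_ell => //; left.
rewrite -(meet jn) /bottom /row_label Sj0 upper_secant//=.
have Sm0 : mu (S j) != m0 by apply: inside_neq => //; rewrite gt_eqF.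
have m10 : m1 != m0 by apply: inside_neq => //; rewrite oner_eq0.
have := phimuP unit0 uj unit1; rewrite winding_secant0// winding_inward//; first last.
- move=> x /in_between H; apply: inside_neq => //.
    by apply: unit_between uj unit1 _; apply/in_between.
  by rewrite gt_eqF//; case: H => /andP[? ?]; lra.
- exact: mu_disk.
rewrite (phimuC unit0 uj) (phimuC unit0 unit1).
have := side_upper bd_m0 (mu_disk uj) (mu_disk unit1) Sm0 m10.
rewrite (upper_subC Sm0) (upper_subC m10).
move: (phimu 1 0) (phimu (S j) 0) (upper (m0 - mu (S j))) (upper (m0 - m1)) (upper (m0 - p0)).
move: (on_left c m0) (on_right c m0) (on_left c p0).
by case=> -[] [] [] [] [] [] [].
Qed.

Lemma rowd1 j : (1 <= j <= n)%N -> rowd j 1 =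
  on_right c m1 && (upper (m1 - p0) (+) upper (m1 - m0)) (+)
  on_left c p0 && upper (m1 - p0) (+) phimu 0 1.
Proof.
move=> jn; have qj := q_bound jn; have [Sj0 Sj1] := Sk01 jn; have [Tj0 Tj1] := Tk01 qj.
have uj : unit_segment (S j) by apply: unitS; clear -jn; lia.
have ut : unit_segment (T (q j)) by apply: unitT; clear -qj; lia.
rewrite /discrepancy winding_column//; last first.
  by move=> y uy; rewrite eq_sym; apply: mu0_ell => //; right.
rewrite -(meet jn) /bottom /row_label (lt_gtF Sj1) /= addbF.
have := phimuP unit1 uj unit0; rewrite winding_secant1// winding_outward//; first last.
- move=> x /in_between H; apply: inside_neq => //.
    by apply: unit_between uj unit0 _; apply/in_between.
  by rewrite lt_eqF//; case: H => /andP[? ?]; lra.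
- exact: mu_disk.
rewrite (phimuC unit1 uj).
move: (phimu 0 1) (phimu (S j) 1) (upper (m1 - mu (S j))) (upper (m1 - m0)) (upper (m1 - p0)).
move: (on_right c m1) (on_left c p0).
by case=> -[] [] [] [] [] [].
Qed.

Lemma topd0 : topd 0 =
  on_right c m0 && (upper (m0 - p0) (+) upper (m0 - p1)) (+)
  on_left c p0 && upper (m0 - p0) (+) on_left c p1 && upper (m0 - p1).
Proof.
rewrite /discrepancy winding_column//.
by move=> y uy; rewrite eq_sym; apply: mu0_ell => //; left.
Qed.

Lemma column_baseE k : (1 <= k <= n)%N ->
  column_base k = on_left c p0 && upper (p1 - p0) (+) phiell 0 1.
Proof.
move=> kn; have qk := q_bound kn; have [Tk0 Tk1] := Tk01 qk.
have ut : unit_segment (T (q k)) by apply: unitT; clear -qk; lia.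
rewrite /column_base /bottom (meet kn) /column_label (lt_gtF Tk0) /= addbF.
have := phiellP unit0 ut unit1; rewrite winding_secant0// winding_inward//; first last.
- move=> x /in_between H; apply: inside_neq => //.
    by apply: unit_between ut unit1 _; apply/in_between.
  by rewrite gt_eqF//; case: H => /andP[? ?]; lra.
- exact: ell_disk.
rewrite (phiellC unit0 ut) (phiellC unit0 unit1).
move: (phiell _ _) (phiell _ _) (upper _) (upper _) (on_left c p0).
by case=> -[] [] [] [].
Qed.

Lemma top_baseE k : (1 <= k <= n)%N -> top (S k) (+) column (T (q k)) 1 =
  on_left c p1 && upper (p0 - p1) (+) upper (p1 - p0) (+) phiell 0 1.
Proof.
move=> kn; have qk := q_bound kn; have [Tk0 Tk1] := Tk01 qk.
have ut : unit_segment (T (q k)) by apply: unitT; clear -qk; lia.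
rewrite /top (meet kn) /column_label Tk1 secantC upper_secant//=.
have p01 : p0 != p1 by apply: inside_neq => //; rewrite eq_sym oner_eq0.
have Tp1 : ell (T (q k)) != p1 by apply: inside_neq => //; rewrite lt_eqF.
have := phiellP unit1 ut unit0; rewrite winding_secant1// winding_outward//; first last.
- move=> x /in_between H; apply: inside_neq => //.
    by apply: unit_between ut unit0 _; apply/in_between.
  by rewrite lt_eqF//; case: H => /andP[? ?]; lra.
- exact: ell_disk.
rewrite (phiellC unit1 ut).
have := side_upper bd_p1 (ell_disk ut) (ell_disk unit0) Tp1 p01.
rewrite (upper_subC p01) (upper_subC Tp1).
move: (phiell _ _) (phiell _ _) (upper _) (upper _).
move: (on_left c p1) (on_right c p1).
by case=> -[] [] [] [] [].
Qed.

(** The two computations of [sense k] are equated. The endpoint terms agree by [circle_parity], and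
    [phimu 0 1] and [phiell 0 1] each occur twice. *)
Lemma label_parity k : (1 <= k <= n)%N -> odd (q k) = odd k.
Proof.
move=> kn; have qk := q_bound kn.
have oddP i : (1 <= i <= n)%N -> odd i = ~~ odd i.-1 by case: i => //= i; rewrite negbK.
rewrite (oddP _ kn) (oddP _ qk); congr (~~ _).
have := sense_label kn; rewrite (sense_position kn) rowd0// rowd1// topd0.
rewrite column_baseE// top_baseE//.
have := circle_parity bd_m0 bd_p0 bd_p1 ends component.
move: (_ (+) upper (m1 - m0)) (_ (+) _ && upper (m1 - p0)) => X Y.
move: (_ (+) _ && upper (m0 - p1)) (_ && upper (p1 - p0)) => Z V.
move: (_ && _ (+) upper (p1 - p0)) (odd _) (odd _) (phimu 0 1) (phiell 0 1) => W.
by move: X Y Z V W => [] [] [] [] [] [] [] [] [].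
Qed.

(** The boundary terms in [sense_position] are independent of [k], so the crossing signs alternate
    along [mu]. *)
Lemma sense_parity : exists b, forall k, (1 <= k <= n)%N -> sense k = odd k (+) b.
Proof.
have [/eqP n0|n0] := boolP (n == 0%N).
  by exists false => k; clear -n0; lia.
have n1 : (1 <= 1 <= n)%N by clear -n0; lia.
exists (~~ (topd 0 (+) column_base 1 (+) (top (S 1%N) (+) column (T (q 1%N)) 1))).
move=> k kn; rewrite (sense_position kn) !column_baseE// !top_baseE//.
have -> : odd k = ~~ odd k.-1 by clear -kn; case: k kn => //= k _; rewrite negbK.
by rewrite -!addbA addNb addbN negbK !addbA.
Qed.

(** Sum of [discrepancy_pair] for [(i, j)] and [(j, i)]: the labels go by [row_column_sym], the
    boundary constants occur twice, and the senses become parities of positions, hence of labels. *)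
Lemma below_pair i j : (1 <= i <= n)%N -> (1 <= j <= n)%N -> (i < j)%N ->
  below i.-1 (q j) (+) below j.-1 (q i) =
  (q j < q i)%N (+) odd i (+) odd (minn (q i) (q j)).
Proof.
move=> iN jN ij; have ne : i != j by rewrite neq_ltn ij.
have [b bE] := sense_parity.
have := row_column_sym iN jN ij.
rewrite (discrepancy_pair iN jN ne) (discrepancy_pair jN iN); last by rewrite eq_sym.
have -> : (j < i)%N = false by clear -ij; lia.
rewrite ij /= addbF (bE _ iN) (bE _ jN) !column_baseE// (rowd0 iN) (rowd0 jN).
move: (_ (+) phimu 0 1) (_ (+) phiell 0 1) => X Y.
have qij : q i != q j by apply: contra_neq ne => /(q_inj iN jN).
rewrite -(label_parity iN) -(label_parity jN) minnE.
case: (ltngtP (q i) (q j)) qij => // h _.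
- have -> : (q i - (q i - q j) = q i)%N by clear -h; lia.
  rewrite /= addbF; move: (below _ _) (below _ _) (odd _) => B B' o.
  by move: (b) X Y B B' o => [] [] [] [] [] [].
- have -> : (q i - (q i - q j) = q j)%N by clear -h; lia.
  rewrite /= addbF; move: (below _ _) (below _ _) (odd _) (odd _) => B B' o o'.
  by move: (b) X Y B B' o o' => [] [] [] [] [] [] [].
Qed.

End Necessity.

(** * Common inversions *)

Section Inversions.
Variables (n : nat) (p : 'S_n).

Lemma odd_sum (I : finType) (P : pred I) :
  odd #|[set k | P k]%SET| = \big[addb/false]_k P k.
Proof.
rewrite -sum1dep_card (big_morph odd oddD erefl) big_mkcond /=.
by apply: eq_bigr => k _; case: (P k).
Qed.

Lemma addb_ltn_ord v : (v <= n)%N -> \big[addb/false]_(k < n) (k < v)%N = odd v.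
Proof.
move=> vn; rewrite -odd_sum -sum1dep_card.
by rewrite (big_ord_narrow vn) sum_nat_const card_ord muln1.
Qed.

Lemma addb_ltn_perm v : (v <= n)%N -> \big[addb/false]_(k < n) (p k < v)%N = odd v.
Proof.
move=> vn; rewrite -addb_ltn_ord// [RHS](reindex_inj (@perm_inj _ p)); exact: eq_bigl.
Qed.

Definition south_west (i v : nat) : bool :=
  \big[addb/false]_(k < n) ((k < i)%N && (p k < v)%N).

Lemma inversion_addb (i k : 'I_n) : inversion p i k = (k < i)%N (+) (p k < p i)%N.
Proof.
rewrite /inversion; case: (ltngtP i k) => ik /=; last first.
- by rewrite (val_inj ik) ltnn.
- by case: (ltngtP (p i) (p k)) => // /val_inj /perm_inj E; rewrite E ltnn in ik.
- by rewrite orbF.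
Qed.

(** Expand the product of [(k < i) (+) (p k < p i)] and [(k < j) (+) (p k < p j)] and sum over [k]:
    the pure terms count integers below a minimum, the mixed terms are south-west counts. *)
Lemma odd_common_inversions (i j : 'I_n) :
  odd (common_inversions p i j) =
  odd (minn i j) (+) odd (minn (p i) (p j)) (+)
  (south_west i (p j) (+) south_west j (p i)).
Proof.
rewrite /common_inversions odd_sum.
have li := ltnW (ltn_ord i); have lpi := ltnW (ltn_ord (p i)).
rewrite -[odd (minn i j)]addb_ltn_ord; last by rewrite geq_min li.
rewrite -[odd (minn (p i) _)]addb_ltn_perm; last by rewrite geq_min lpi.
rewrite -!big_split; apply: eq_bigr => k _ /=.
rewrite !inversion_addb !leq_min.
by case: (k < i)%N; case: (k < j)%N; case: (p k < p i)%N; case: (p k < p j)%N.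
Qed.

Lemma common_inversions_mod2 (i j : 'I_n) :
  (common_inversions p i j = (if inversion p i j then 1 else 0) %[mod 2])%N <->
  odd (common_inversions p i j) = inversion p i j.
Proof.
rewrite !modn2; case: inversion => /=; case: odd; by split.
Qed.

End Inversions.

(** * Parity identities of a meander *)

Section Meander.
Variables (R : realType) (n : nat) (M : meander R n) (p : 'S_n).

(** Positions are renumbered from 1, index 0 being the start of the curve; [insub] fails from [n.+1]
    on, and the default 1 is the end. *)
Definition time_of (s : 'I_n -> R) (k : nat) : R :=
  if k is k'.+1 then (if insub k' is Some i then s i else 1) else 0.

Definition label_of (k : nat) : nat :=
  if k is k'.+1 then (if insub k' is Some i then (p i).+1 else n.+1) else 0%N.

Lemma time_of_ord s (i : 'I_n) : time_of s i.+1 = s i.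
Proof. by rewrite /time_of valK. Qed.

Lemma label_of_ord (i : 'I_n) : label_of i.+1 = (p i).+1.
Proof. by rewrite /label_of valK. Qed.

Lemma time_of_end s : time_of s n.+1 = 1.
Proof. by rewrite /time_of insubF// ltnn. Qed.

Lemma ordP k : (1 <= k <= n)%N -> exists i : 'I_n, k = i.+1.
Proof. by case: k => // k kn; exists (Ordinal kn). Qed.

Lemma time_of_lt (s : 'I_n -> R) : (forall i, 0 < s i < 1) ->
  (forall i j : 'I_n, (i < j)%N -> s i < s j) ->
  forall i j, (i < j <= n.+1)%N -> time_of s i < time_of s j.
Proof.
move=> s01 slt i j /andP[]; case: i j => [|i] [|j] //= ij jn.
  by case: insubP => [j' _ _|_]; [case/andP: (s01 j')|exact: ltr01].
have iN : (i < n)%N by apply: (@leq_trans j).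
case: insubP => [i' _ i'E|]; last by rewrite iN.
case: insubP => [j' _ j'E|_]; last by case/andP: (s01 i').
by apply: slt; rewrite i'E j'E.
Qed.

Lemma below_label (i : nat) (j : 'I_n) : (i <= n)%N ->
  below label_of i (label_of j.+1) = south_west p i (p j).
Proof.
move=> iN; rewrite /below /south_west label_of_ord big_add1 /= big_mkord.
rewrite (big_ord_widen n (fun k => (label_of k.+1 < (p j).+1)%N) iN) big_mkcond.
by apply: eq_bigr => k _; rewrite [label_of _]label_of_ord ltnS; case: (k < i)%N.
Qed.

Lemma meander_pairs : is_meander_perm M p ->
  (forall i : 'I_n, odd (p i) = odd i) /\
  (forall i j : 'I_n, (i < j)%N ->
    south_west p i (p j) (+) south_west p j (p i) =
    (p j < p i)%N (+) odd i (+) odd (minn (p i) (p j))).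
Proof.
move=> [x [y [[xX [s [us slt sx]]] [yX [t [ut tlt ty]]] xy]]].
have emu := mu_embedding M; have eell := ell_embedding M.
have pmu := mu_proper M; have pell := ell_proper M.
have [mu0 mu1] := mu_ends M; have [ell0 ell1] := ell_ends M.
have ends : uniq [:: mu M 0; mu M 1; ell M 0; ell M 1].
  by rewrite mu0 mu1 ell0 ell1; exact: endpoints_uniq.
have comp := endpoints_component M; rewrite -mu0 -mu1 -ell0 -ell1 in comp.
have disj a b : a = 0 \/ a = 1 -> b = 0 \/ b = 1 -> mu M a <> ell M b.
  move: ends; rewrite /= !inE !negb_or => /and4P[/and3P[_ /eqP a1 /eqP a2] /andP[/eqP a3 /eqP a4] _ _].
  by case=> -> [] ->.
(* An endpoint of [mu] lies on the circle, so by properness it could only meet an endpoint of [ell],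
   and the four endpoints are distinct. *)
have s01 i : 0 < s i < 1.
  have : intersection (mu M) (ell M) (x i) by rewrite -xX; exists i.
  move=> [_ [b b01 bE]]; have [_ mb] := pmu; have [_ eb] := pell.
  have ends_s : s i = 0 \/ s i = 1 -> False.
    move=> si; have /mb bdx := si; apply: (disj (s i) b) => //; last by rewrite bE sx.
    by apply/(eb _ b01); rewrite bE -sx; apply: (mb _ (us i)).2.
  have := us i; rewrite /unit_segment /= in_itv /= => /andP[h0 h1].
  rewrite !lt_neqAle h0 h1 !andbT eq_sym; apply/andP.
  by split; apply/eqP => e; apply: ends_s; auto.
have t01 i : 0 < t i < 1.
  have : intersection (mu M) (ell M) (y i) by rewrite -yX; exists i.
  move=> [[b b01 bE] _]; have [_ mb] := pmu; have [_ eb] := pell.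
  have ends_t : t i = 0 \/ t i = 1 -> False.
    move=> ti; apply: (disj b (t i)) => //; last by rewrite bE ty.
    by apply/(mb _ b01); rewrite bE -ty; apply: (eb _ (ut i)).2.
  have := ut i; rewrite /unit_segment /= in_itv /= => /andP[h0 h1].
  rewrite !lt_neqAle h0 h1 !andbT eq_sym; apply/andP.
  by split; apply/eqP => e; apply: ends_t; auto.
have ltS := time_of_lt s01 slt.
have ltT := time_of_lt t01 tlt.
have [phimu [phimuP phimuC]] := secant_label emu.
have [phiell [phiellP phiellC]] := secant_label eell.
pose S := time_of s; pose T := time_of t.
pose mid k := (S k + S k.+1) / 2.
have midP k : (k <= n)%N -> S k < mid k < S k.+1.
  move=> kn; have : S k < S k.+1 by apply: ltS; rewrite ltnSn.
  by rewrite /mid => ?; apply/andP; split; lra.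
have q_bound k : (1 <= k <= n)%N -> (1 <= label_of k <= n)%N.
  by move=> /ordP[i ->]; rewrite label_of_ord; exact: ltn_ord.
have q_inj i j : (1 <= i <= n)%N -> (1 <= j <= n)%N ->
    label_of i = label_of j -> i = j.
  by move=> /ordP[{}i ->] /ordP[{}j ->]; rewrite !label_of_ord => -[] /val_inj /perm_inj ->.
have meet k : (1 <= k <= n)%N -> mu M (S k) = ell M (T (label_of k)).
  by move=> /ordP[i ->]; rewrite label_of_ord /S /T !time_of_ord sx ty xy.
have meet_only a b : unit_segment a -> unit_segment b -> mu M a = ell M b ->
    exists2 k, (1 <= k <= n)%N & a = S k /\ b = T (label_of k).
  move=> ua ub ab.
  have : intersection (mu M) (ell M) (mu M a).
    by split; [exists a|exists b; rewrite ?ab].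
  rewrite -xX => -[i _ xi]; exists i.+1; [exact: ltn_ord|rewrite label_of_ord /S /T !time_of_ord].
  split; first by apply: (mu_inj emu ua (us i)); rewrite sx xi.
  by apply: (mu_inj eell ub (ut (p i))); rewrite ty -xy xi ab.
have q_count j : (1 <= j <= n)%N -> below label_of n (label_of j) = odd (label_of j).-1.
  move=> /ordP[{}j ->]; rewrite below_label// label_of_ord /= /south_west.
  rewrite -(addb_ltn_perm p (ltnW (ltn_ord (p j)))).
  by apply: eq_bigr => k _; rewrite ltn_ord.
have trans : transverse (mu M) (ell M) := @mu_ell_transverse _ _ M.
split=> [i|i j ij].
  have := label_parity emu eell pmu pell ends comp trans
    (erefl : S 0%N = 0) (time_of_end s) ltS midP (erefl : T 0%N = 0) (time_of_end t)
    ltT q_bound q_inj meet meet_only phimuP phiellP phimuC phiellC q_count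
    (ltn_ord i : (1 <= i.+1 <= n)%N).
  by rewrite label_of_ord /= => /negb_inj.
have := below_pair emu eell pmu pell ends comp trans
  (erefl : S 0%N = 0) (time_of_end s) ltS midP (erefl : T 0%N = 0) (time_of_end t)
  ltT q_bound q_inj meet meet_only phimuP phiellP phimuC phiellC q_count
  (ltn_ord i : (1 <= i.+1 <= n)%N) (ltn_ord j : (1 <= j.+1 <= n)%N) ij.
rewrite -[i.+1.-1]/(nat_of_ord i) -[j.+1.-1]/(nat_of_ord j) !below_label ?(ltnW (ltn_ord _))// !label_of_ord minnSS /= => ->.
by rewrite (ltnS (p j).+1); case: (odd i); case: (odd (minn _ _)); case: (p j < p i)%N.
Qed.

(** For [i != j] the pair identity evaluates the mixed terms of [odd_common_inversions]; for [i = j]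
    only the parities of [i] and [p i] remain. *)
Lemma meander_common_inversions : is_meander_perm M p ->
  forall i j : 'I_n, odd (common_inversions p i j) = inversion p i j.
Proof.
move=> /meander_pairs[par pair] i j; rewrite odd_common_inversions.
have [ij|ji|/val_inj ->] := ltngtP i j.
- rewrite pair// inversion_addb [(j < i)%N]ltnNge (ltnW ij) /=.
  by case: (odd i); case: (odd (minn _ _)); case: (p j < p i)%N => /=.
- rewrite [X in _ (+) X]addbC pair// inversion_addb ji.
  have /negPf pij : p i != p j :> nat.
    by apply: contraTneq ji => /val_inj/perm_inj ->; rewrite ltnn.
  have -> : (p i < p j)%N = ~~ (p j < p i)%N by rewrite -leqNgt [RHS]leq_eqVlt pij.
  rewrite [minn (p j) _]minnC.
  by case: (odd j); case: (odd (minn _ _)); case: (p j < p i)%N => /=.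
- by rewrite inversion_addb !ltnn !minnn par !addbb.
Qed.

End Meander.

(** Here [a], [b] and [c], [d] are the ends of two chords. Each [w] occurs in two of the four
    identities and drops out of their sum, which says that an even number of the comparisons
    [c < a], [d < a], [c < b], [d < b] hold: the ends do not interleave. *)
Lemma noncrossing_of_parity a b c d (o w1 w2 w3 w4 : bool) :
  (odd d = ~~ o -> odd c = o -> odd b = ~~ o -> odd a = o ->
  b <> d -> a <> d -> b <> c -> a <> c ->
  w4 (+) (a < d) (+) (w3 (+) (c < b)) = (d < b) (+) ~~ o (+) odd (minn b d) ->
  w4 (+) (w2 (+) (c < a)) = (d < a) (+) o (+) odd (minn a d) ->
  w1 (+) (a < c) (+) w3 = (c < b) (+) ~~ o (+) odd (minn b c) ->
  w1 (+) w2 = (c < a) (+) o (+) odd (minn a c) ->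
  ~~ [&& minn a b < minn c d, minn c d < maxn a b & maxn a b < maxn c d] &&
  ~~ [&& minn c d < minn a b, minn a b < maxn c d & maxn c d < maxn a b])%N.
Proof.
move=> od oc ob oa bd ad bc ac.
case: (ltngtP b d) => bd' //; case: (ltngtP a d) => ad' //;
case: (ltngtP b c) => bc' //; case: (ltngtP a c) => ac' //;
rewrite ?od ?oc ?ob ?oa;
case: o {od oc ob oa}; case: w1; case: w2; case: w3; case: w4 => //= _ _ _ _.
all: try lia.
Qed.

(** * Noncrossing chords *)

Section Chords.
Variables (n : nat) (p : 'S_n).
Hypothesis idem : forall i j : 'I_n, odd (common_inversions p i j) = inversion p i j.

Local Notation q := (label_of p).

Definition south_west0 (i v : nat) : bool := \big[addb/false]_(0 <= k < i) (q k < v)%N.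

Lemma south_west0S i v : south_west0 i.+1 v = south_west0 i v (+) (q i < v)%N.
Proof. by rewrite /south_west0 big_nat_recr. Qed.

(** The added point of index 0 and label 0 is south-west of all these positions, hence the
    negation. *)
Lemma south_west0_ord (i : nat) v : (i <= n)%N ->
  south_west0 i.+1 v.+1 = ~~ south_west p i v.
Proof.
move=> iN; rewrite /south_west0 /south_west big_nat_recl//= -addTb; congr (_ (+) _).
rewrite big_mkord (big_ord_widen n (fun k => (q k.+1 < v.+1)%N) iN) big_mkcond.
by apply: eq_bigr => k _; rewrite [label_of _ _]label_of_ord ltnS; case: (k < i)%N.
Qed.

Lemma label_end : q n.+1 = n.+1.
Proof. by rewrite /label_of insubF// ltnn. Qed.

Lemma label_cases k : (k <= n.+1)%N ->
  [\/ k = 0%N, k = n.+1 | exists i : 'I_n, k = i.+1].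
Proof.
case: k => [|k kn]; first by constructor 1.
have [->|ne] := eqVneq k n; first by constructor 2.
have kn' : (k < n)%N by rewrite ltn_neqAle ne.
by constructor 3; exists (Ordinal kn').
Qed.

Lemma odd_perm_label (i : 'I_n) : odd (p i) = odd i.
Proof.
have := idem i i; rewrite odd_common_inversions inversion_addb !ltnn !minnn addbb addbF.
by move/negbT; rewrite negb_add => /eqP ->.
Qed.

Lemma odd_label k : (k <= n.+1)%N -> odd (q k) = odd k.
Proof.
move=> /label_cases[->|->|[i ->]] //; first by rewrite label_end.
by rewrite label_of_ord /= odd_perm_label.
Qed.

Lemma label_inj i j : (i <= n.+1)%N -> (j <= n.+1)%N -> q i = q j -> i = j.
Proof.
move=> /label_cases[->|->|[{}i ->]] /label_cases[->|->|[{}j ->]];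
  rewrite ?label_end ?label_of_ord //.
- by move=> [E]; have := ltn_ord (p j); rewrite -E ltnn.
- by move=> [E]; have := ltn_ord (p i); rewrite E ltnn.
- by move=> [] /val_inj /perm_inj ->.
Qed.

Lemma south_west0_end (i : nat) : (i <= n)%N -> south_west0 i.+1 n.+1 = odd i.+1.
Proof.
move=> iN; rewrite south_west0_ord//= /south_west; congr (~~ _).
by rewrite -(addb_ltn_ord iN); apply: eq_bigr => k _; rewrite ltn_ord andbT.
Qed.

Lemma south_west_end (v : nat) : (v <= n)%N -> south_west0 n.+1 v.+1 = odd v.+1.
Proof.
move=> vN; rewrite south_west0_ord//= /south_west; congr (~~ _).
by rewrite -(addb_ltn_perm p vN); apply: eq_bigr => k _; rewrite ltn_ord.
Qed.

(** Extends the pair identity to the added ends: nothing is south-west of the first, and everything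
    else is south-west of the last. *)
Lemma south_west0_pair i j : (i < j)%N -> (j <= n.+1)%N ->
  south_west0 i (q j) (+) south_west0 j (q i) =
  (q j < q i)%N (+) odd i (+) odd (minn (q i) (q j)).
Proof.
move=> ij jn; have iN : (i <= n.+1)%N by lia.
have [i0|E|[i' iE]] := label_cases iN.
- rewrite i0 /south_west0 big_geq//= big1 ?min0n// => k _; by rewrite ltn0.
- by lia.
have [E|jE|[j' jE]] := label_cases jn; first by lia.
- rewrite jE label_end iE label_of_ord south_west0_end; last exact: ltnW.
  rewrite south_west_end; last exact: ltnW.
  have pin := ltn_ord (p i').
  rewrite (minn_idPl _); last by rewrite ltnW.
  by rewrite ltnS ltnNge (ltnW pin) /=; case: (odd i'); case: odd.
rewrite iE jE ltnS in ij; rewrite iE jE !label_of_ord.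
have := idem i' j'; rewrite odd_common_inversions inversion_addb.
rewrite !south_west0_ord ?(ltnW (ltn_ord _))//.
rewrite minnSS ltnS (minn_idPl (ltnW ij)) [(j' < i')%N]ltnNge (ltnW ij) /=.
by case: (odd i'); case: (odd (minn _ _)); case: (p j' < p i')%N; case: south_west; case: south_west.
Qed.

(** Passing to the next index changes a south-west parity by one comparison, which yields the four
    identities of [noncrossing_of_parity]; [k.+1 < l] keeps the four ends distinct. *)
Lemma chords_noncrossing k l : (k.+1 < l)%N -> (l <= n)%N -> odd k = odd l ->
  [&& ~~ [&& minn (q k) (q k.+1) < minn (q l) (q l.+1),
        minn (q l) (q l.+1) < maxn (q k) (q k.+1) &
        maxn (q k) (q k.+1) < maxn (q l) (q l.+1)]%N &
     ~~ [&& minn (q l) (q l.+1) < minn (q k) (q k.+1),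
        minn (q k) (q k.+1) < maxn (q l) (q l.+1) &
        maxn (q l) (q l.+1) < maxn (q k) (q k.+1)]%N].
Proof.
move=> kl ln kl2.
have kn : (k <= n.+1)%N by clear -kl ln; lia.
have k1n : (k.+1 <= n.+1)%N by clear -kl ln; lia.
have lN : (l <= n.+1)%N by clear -kl ln; lia.
have l1n : (l.+1 <= n.+1)%N by clear -kl ln; lia.
have kl' : (k < l)%N by clear -kl; lia.
have kl1 : (k < l.+1)%N by clear -kl; lia.
have k1l1 : (k.+1 < l.+1)%N by clear -kl; lia.
have := south_west0_pair kl' lN; have := south_west0_pair kl lN.
have := south_west0_pair kl1 l1n; have := south_west0_pair k1l1 l1n.
have ne i j : (i < j)%N -> (i <= n.+1)%N -> (j <= n.+1)%N -> q i <> q j.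
  by move=> + iN jN => /[swap] /(label_inj iN jN) ->; rewrite ltnn.
have := ne _ _ kl' kn lN; have := ne _ _ kl k1n lN.
have := ne _ _ kl1 kn l1n; have := ne _ _ k1l1 k1n l1n.
have := odd_label kn; have := odd_label k1n.
have := odd_label lN; have := odd_label l1n.
rewrite !south_west0S -[odd k.+1]/(~~ odd k) -[odd l.+1]/(~~ odd l) kl2.
move: (south_west0 _ _) (south_west0 _ _) (south_west0 _ _) (south_west0 _ _).
move: (q k) (q k.+1) (q l) (q l.+1) (odd l).
exact: noncrossing_of_parity.
Qed.

End Chords.

(** * A smooth step *)

Section Elementary.
Variable R : realType.
Implicit Types f g : R -> R.

(** Negative powers times [expR (- x^-1)]: the derivative of [flat k] is a combination of
    [flat k.+1] and [flat k.+2], so the family is closed under differentiation. *)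
Definition flat (k : nat) (x : R) : R := if 0 < x then x ^- k * expR (- x^-1) else 0.

(* A class of functions stable under differentiation, large enough to contain
   a smooth step. *)
Inductive elementary : (R -> R) -> Prop :=
| elementary_cst c : elementary (fun=> c)
| elementary_id : elementary id
| elementary_sin : elementary sin
| elementary_cos : elementary cos
| elementary_flat k : elementary (flat k)
| elementary_add f g : elementary f -> elementary g -> elementary (fun x => f x + g x)
| elementary_mul f g : elementary f -> elementary g -> elementary (fun x => f x * g x)
| elementary_inv f : (forall x, f x != 0) -> elementary f ->
    elementary (fun x => (f x)^-1)
| elementary_comp f g : elementary f -> elementary g -> elementary (fun x => f (g x)).

(** Keep only the term of degree [k.+1] in the exponential series at [x^-1]. *)
Lemma expR_opp_inv_le (k : nat) (x : R) : 0 < x -> expR (- x^-1) <= k.+1`!%:R * x ^+ k.+1.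
Proof.
move=> x0; have y0 : 0 <= x^-1 by rewrite invr_ge0 ltW.
have fk0 : 0 < k.+1`!%:R :> R by rewrite ltr0n fact_gt0.
have H : x^-1 ^+ k.+1 / k.+1`!%:R <= expR x^-1.
  by apply: le_trans (expR_ge1Dxn k y0); rewrite lerDr.
rewrite expRN -[leRHS]invrK lef_pV2 ?posrE ?invr_gt0 ?mulr_gt0 ?exprn_gt0 ?expR_gt0//.
by rewrite invfM mulrC -exprVn.
Qed.

(** A quadratic bound at 0 forces the derivative there to be 0; two powers beyond [k] are needed,
    hence the factorial of [k.+2]. *)
Lemma flat_le (k : nat) (x : R) : `|flat k x| <= k.+2`!%:R * x ^+ 2.
Proof.
rewrite /flat; case: ltP => x0; last by rewrite normr0 mulr_ge0 ?sqr_ge0.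
have F0 : 0 <= x ^- k * expR (- x^-1).
  by apply: mulr_ge0; [rewrite invr_ge0 exprn_ge0// ltW|exact: expR_ge0].
rewrite ger0_norm//.
rewrite [leLHS]mulrC ler_pdivrMr ?exprn_gt0//.
apply: le_trans (expR_opp_inv_le k.+1 x0) _.
by rewrite -mulrA -exprD add2n.
Qed.

Lemma is_derive_quadratic f (C : R) : f 0 = 0 -> (forall x, `|f x| <= C * x ^+ 2) ->
  is_derive (0 : R) 1 f 0.
Proof.
move=> f0 fC.
have C0 : 0 <= C.
  by have := fC 1; rewrite expr1n mulr1; apply: le_trans.
have H : (h^-1 *: ((f \o shift 0) (h *: 1) - f 0)) @[h --> 0^'] --> (0 : R).
  apply/cvgr0Pnorm_lt => e e0; near=> h.
  have h0 : h != 0 by near: h; exact: nbhs_dnbhs_neq.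
  have hd : `|h| < e / (C + 1).
    near: h; apply: dnbhs0_lt; rewrite divr_gt0// ltr_wpDl//.
  rewrite /= f0 subr0 addr0 /GRing.scale /= mulr1 normrM normfV.
  rewrite ltr_pdivrMl ?normr_gt0//.
  apply: le_lt_trans (fC h) _; rewrite -(@real_normK _ h) ?num_real// expr2.
  rewrite ltr_pdivlMr in hd; last by rewrite ltr_wpDl.
  have : 0 < `|h| by rewrite normr_gt0.
  by nra.
by apply: DeriveDef; [apply/cvg_ex; exists 0|exact: cvg_lim H].
Unshelve. all: by end_near.
Qed.

Lemma is_derive_flat (k : nat) (x : R) :
  is_derive x 1 (flat k) (- k%:R * flat k.+1 x + flat k.+2 x).
Proof.
have [x0|x0|<-] := ltgtP 0 x.
- rewrite /flat x0.
  have xn0 : x != 0 by rewrite gt_eqF.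
  have near_flat : \near x, x ^-1 ^+ k * expR (- x^-1) = flat k x.
    have : \forall y \near x, 0 < y by exact: lt_nbhsr.
    by apply: filterS => y y0; rewrite /flat y0 exprVn.
  apply: (near_eq_is_derive near_flat).
  have dV := @is_deriveV _ id x 1 1 xn0 (is_derive_id _ _).
  have dX := is_deriveX k dV; rewrite exprfctE in dX.
  have dE := @is_derive1_comp R expR (fun y => - y^-1) x _ _ (is_derive_expR _) (is_deriveN dV).
  apply: is_derive_eq (is_deriveM dX dE) _.
  rewrite /GRing.scale /=.
  case: k {near_flat dX} => [|k]; first by rewrite /=; field.
  rewrite /= -!exprVn. rewrite !exprS -natr1. set E := expR _. set v := x^-1. ring.
- have near_flat : \near x, cst 0 x = flat k x.
    have : \forall y \near x, y < 0 by exact: lt_nbhsl.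
    by apply: filterS => y y0; rewrite /flat ltNge (ltW y0).
  apply: (near_eq_is_derive near_flat).
  apply: is_derive_eq (is_derive_cst _ _ _) _.
  by rewrite /flat !(lt_gtF x0) mulr0 addr0.
- rewrite /flat !ltxx mulr0 addr0.
  apply: (@is_derive_quadratic (flat k) k.+2`!%:R); last exact: flat_le.
  by rewrite /flat ltxx.
Qed.

Lemma elementary_derive f : elementary f ->
  exists2 f', elementary f' & forall x : R, is_derive x 1 f (f' x).
Proof.
elim=> {f}.
- move=> c; exists (fun=> 0); first exact: elementary_cst.
  by move=> x; exact: is_derive_cst.
- exists (fun=> 1); first exact: elementary_cst.
  by move=> x; exact: is_derive_id.
- by exists cos; [exact: elementary_cos|move=> x; exact: is_derive_sin].
- exists (fun x => -1 * sin x).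
    by apply: elementary_mul; [exact: elementary_cst|exact: elementary_sin].
  by move=> x; rewrite mulN1r; exact: is_derive_cos.
- move=> k; exists (fun x => (- k%:R) * flat k.+1 x + flat k.+2 x).
    apply: elementary_add; last exact: elementary_flat.
    by apply: elementary_mul; [exact: elementary_cst|exact: elementary_flat].
  exact: is_derive_flat.
- move=> f g _ [f' ef' df] _ [g' eg' dg]; exists (fun x => f' x + g' x).
    exact: elementary_add.
  by move=> x; apply: is_deriveD.
- move=> f g ef [f' ef' df] eg [g' eg' dg]; exists (fun x => f x * g' x + g x * f' x).
    by apply: elementary_add; apply: elementary_mul.
  by move=> x; exact: (is_deriveM (df x) (dg x)).
- move=> f f0 ef [f' ef' df]; exists (fun x => (-1 * ((f x)^-1 * (f x)^-1)) * f' x).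
    apply: elementary_mul => //; apply: elementary_mul; first exact: elementary_cst.
    by apply: elementary_mul; apply: elementary_inv.
  move=> x; apply: is_derive_eq (is_deriveV (f0 x) (df x)) _.
  by rewrite /GRing.scale /= mulN1r -expr2 exprVn.
- move=> f g ef [f' ef' df] eg [g' eg' dg]; exists (fun x => f' (g x) * g' x).
    by apply: elementary_mul => //; apply: elementary_comp.
  by move=> x; exact: (is_derive1_comp (df (g x)) (dg x)).
Qed.

Lemma smooth_elementary x y : elementary x -> elementary y ->
  smooth (fun t => (x t, y t)).
Proof.
move=> ex ey k t.
suff [x' [y' [ex' ey' ->]]] : exists x' y', [/\ elementary x', elementary y' &
    derive1n k (fun t => (x t, y t)) = (fun t => (x' t, y' t))].
  have [x'' _ dx] := elementary_derive ex'; have [y'' _ dy] := elementary_derive ey'.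
  by have [] := is_derive_pair (dx t) (dy t).
elim: k => [|k [x' [y' [ex' ey' E]]]]; first by exists x, y.
have [x'' ex'' dx] := elementary_derive ex'; have [y'' ey'' dy] := elementary_derive ey'.
exists x'', y''; split => //; rewrite derive1nS E; apply/funext => s.
by rewrite derive1E; have [_ ->] := is_derive_pair (dx s) (dy s).
Qed.

Lemma flat_gt0 k (x : R) : 0 < x -> 0 < flat k x.
Proof.
by move=> x0; rewrite /flat x0 mulr_gt0 ?expR_gt0// invr_gt0 exprn_gt0.
Qed.

Lemma flat_eq0 k (x : R) : x <= 0 -> flat k x = 0.
Proof. by move=> x0; rewrite /flat ltNge x0. Qed.

Lemma flat_ge0 k (x : R) : 0 <= flat k x.
Proof. by case: (ltP 0 x) => [/(flat_gt0 k)/ltW//|/(flat_eq0 k) ->]. Qed.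

Lemma flat0_lt (x y : R) : 0 <= x -> x < y -> flat 0 x < flat 0 y.
Proof.
rewrite le_eqVlt => /orP[/eqP <-|x0] xy; first by rewrite flat_eq0// flat_gt0.
have y0 := lt_trans x0 xy.
by rewrite /flat x0 y0 expr0 invr1 !mul1r ltr_expR ltrN2 ltf_pV2.
Qed.

Lemma flat0_le (x y : R) : x <= y -> flat 0 x <= flat 0 y.
Proof.
move=> xy; case: (leP x 0) => [/(flat_eq0 0) ->|x0]; first exact: flat_ge0.
move: xy; rewrite le_eqVlt => /orP[/eqP ->//|xy].
exact/ltW/flat0_lt/xy/ltW.
Qed.

Definition step_den (x : R) := flat 0 x + flat 0 (1 - x).

(** The usual smooth transition from 0 to 1; the denominator never vanishes because [x] or [1 - x]
    is positive. *)
Definition step (x : R) := flat 0 x * (step_den x)^-1.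

Lemma step_den_gt0 x : 0 < step_den x.
Proof.
rewrite /step_den; case: (ltP 0 x) => x0.
  by rewrite ltr_wpDr ?flat_ge0// flat_gt0.
by rewrite ltr_wpDl ?flat_ge0// flat_gt0// subr_gt0 (le_lt_trans x0).
Qed.

Lemma elementary_affine (a b : R) : elementary (fun x => a + b * x).
Proof.
apply: elementary_add; first exact: elementary_cst.
by apply: elementary_mul; [exact: elementary_cst|exact: elementary_id].
Qed.

Lemma elementary_step : elementary step.
Proof.
apply: elementary_mul; first exact: elementary_flat.
apply: elementary_inv; first by move=> x; rewrite gt_eqF// step_den_gt0.
apply: elementary_add; first exact: elementary_flat.
rewrite (_ : (fun x => _) = (fun x => flat 0 (1 + -1 * x))).
  by apply: elementary_comp; [exact: elementary_flat|exact: elementary_affine].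
by apply/funext => x; rewrite mulN1r.
Qed.

Lemma step_le0 x : x <= 0 -> step x = 0.
Proof. by move=> x0; rewrite /step flat_eq0// mul0r. Qed.

Lemma step_ge1 x : 1 <= x -> step x = 1.
Proof.
move=> x1; rewrite /step /step_den [flat 0 (1 - x)]flat_eq0 ?subr_le0// addr0 mulfV//.
by rewrite gt_eqF// flat_gt0// (lt_le_trans ltr01).
Qed.

Lemma step_half : step 2^-1 = 2^-1.
Proof.
rewrite /step /step_den (_ : 1 - 2^-1 = 2^-1 :> R); last by field.
have F0 : flat 0 2^-1 != 0 by rewrite gt_eqF// flat_gt0// invr_gt0.
by move: (flat 0 2^-1) F0 => F F0; rewrite -mulr2n; field.
Qed.

Lemma step_lt x y : 0 <= x -> x < y -> y <= 1 -> step x < step y.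
Proof.
move=> x0 xy y1; rewrite /step ltr_pdivrMr ?step_den_gt0// mulrAC.
rewrite ltr_pdivlMr ?step_den_gt0// /step_den !mulrDr [flat 0 y * flat 0 x]mulrC.
rewrite ltrD2l.
apply: (@le_lt_trans _ _ (flat 0 x * flat 0 (1 - x))).
  by rewrite ler_wpM2l ?flat_ge0// flat0_le// lerD2l lerN2 ltW.
by rewrite ltr_pM2r; [exact: flat0_lt|rewrite flat_gt0// subr_gt0 (lt_le_trans xy)].
Qed.

Lemma step_le x y : x <= y -> step x <= step y.
Proof.
move=> xy; rewrite /step ler_pdivrMr ?step_den_gt0// mulrAC.
rewrite ler_pdivlMr ?step_den_gt0// /step_den !mulrDr [flat 0 y * flat 0 x]mulrC.
rewrite lerD2l; apply: (@le_trans _ _ (flat 0 x * flat 0 (1 - x))).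
  by rewrite ler_wpM2l ?flat_ge0// flat0_le// lerD2l lerN2.
by rewrite ler_wpM2r ?flat_ge0// flat0_le.
Qed.

Lemma step_ge0 x : 0 <= step x.
Proof.
have [x0|x0] := leP 0 x; last by rewrite step_le0// ltW.
by rewrite -(step_le0 (lexx 0)) step_le.
Qed.

Lemma step_le1 x : step x <= 1.
Proof.
have [x1|x1] := leP x 1; last by rewrite step_ge1// ltW.
by rewrite -(step_ge1 (lexx 1)) step_le.
Qed.

Definition dstep (x : R) :=
  (flat 2 x * flat 0 (1 - x) + flat 0 x * flat 2 (1 - x)) / step_den x ^+ 2.

Lemma is_derive_step (x : R) : is_derive x 1 step (dstep x).
Proof.
have d0 (y : R) : is_derive y 1 (flat 0) (flat 2 y).
  by apply: is_derive_eq (is_derive_flat 0 y) _; rewrite oppr0 mul0r add0r.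
have d1 : is_derive x 1 (fun y => flat 0 (1 - y)) (- flat 2 (1 - x)).
  have dB : is_derive x 1 (fun y : R => 1 - y) (0 - 1) := is_deriveB (is_derive_cst _ _ _) (is_derive_id _ _).
  apply: is_derive_eq (@is_derive1_comp R (flat 0) (fun y => 1 - y) x _ _ (d0 _) dB) _.
  by rewrite sub0r mulrN1.
have den0 : step_den x != 0 by rewrite gt_eqF// step_den_gt0.
have dD : is_derive x 1 step_den (flat 2 x - flat 2 (1 - x)) := is_deriveD (d0 x) d1.
apply: is_derive_eq (is_deriveM (d0 x) (is_deriveV den0 dD)) _.
rewrite /dstep /GRing.scale /=; move: den0; rewrite /step_den => den0.
by field.
Qed.

Lemma dstep_ge0 x : 0 <= dstep x.
Proof. by rewrite /dstep divr_ge0 ?exprn_ge0 ?(ltW (step_den_gt0 _))// addr_ge0 ?mulr_ge0 ?flat_ge0. Qed.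

Lemma dstep_gt0 x : 0 < x < 1 -> 0 < dstep x.
Proof.
move=> /andP[x0 x1]; have x1' : 0 < 1 - x by rewrite subr_gt0.
by rewrite /dstep divr_gt0 ?exprn_gt0 ?step_den_gt0// addr_gt0 ?mulr_gt0 ?flat_gt0.
Qed.

End Elementary.

(** * Profile of a single arc *)

Section Profile.
Variable R : realType.

(** Horizontal progress along an arc. It is confined to the interval from 1/4 to 3/4, where
    [plateau] is 1. *)
Definition ramp (u : R) : R := step (- 2^-1 + 2 * u).

Definition plateau (u : R) : R := step (- 1 + 8 * u) * step (7 + (- 8) * u).

Lemma ramp_eq0 u : u <= 4^-1 -> ramp u = 0.
Proof. by move=> ?; apply: step_le0; lra. Qed.

Lemma ramp_eq1 u : 3 / 4 <= u -> ramp u = 1.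
Proof. by move=> ?; apply: step_ge1; lra. Qed.

Lemma ramp_half : ramp 2^-1 = 2^-1.
Proof. by rewrite -[RHS]step_half; congr step; field. Qed.

Lemma ramp_lt u v : u < v -> u < 3 / 4 -> 4^-1 < v -> ramp u < ramp v.
Proof.
move=> uv u1 v1; have [u0|u0] := leP u 4^-1; have [v2|v2] := leP (3 / 4) v.
- by rewrite ramp_eq0// ramp_eq1.
- rewrite ramp_eq0// -(step_le0 (lexx 0)); apply: step_lt; lra.
- rewrite [ltRHS]ramp_eq1// -(step_ge1 (lexx 1)); apply: step_lt; lra.
- by apply: step_lt; lra.
Qed.

Lemma ramp_ge0 u : 0 <= ramp u. Proof. exact: step_ge0. Qed.
Lemma ramp_le1 u : ramp u <= 1. Proof. exact: step_le1. Qed.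

Lemma plateau_ge0 u : 0 <= plateau u.
Proof. by rewrite mulr_ge0 ?step_ge0. Qed.

Lemma plateau_le1 u : plateau u <= 1.
Proof. by rewrite mulr_ile1 ?step_ge0 ?step_le1. Qed.

Lemma plateau_le0 u : u <= 8^-1 -> plateau u = 0.
Proof. by move=> ?; rewrite /plateau step_le0 ?mul0r//; lra. Qed.

Lemma plateau_ge78 u : 7 / 8 <= u -> plateau u = 0.
Proof. by move=> ?; rewrite /plateau [step (7 + _)]step_le0 ?mulr0//; lra. Qed.

Lemma plateau_eq1 u : 4^-1 <= u <= 3 / 4 -> plateau u = 1.
Proof. by move=> /andP[? ?]; rewrite /plateau !step_ge1 ?mulr1//; lra. Qed.

Lemma plateau_sym u : plateau (1 - u) = plateau u.
Proof. by rewrite /plateau mulrC; congr (step _ * step _); ring. Qed.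

Lemma plateau_le u v : u <= v -> v <= 4^-1 -> plateau u <= plateau v.
Proof.
move=> uv v1; rewrite /plateau ![step (7 + _)]step_ge1 ?mulr1; try lra.
by apply: step_le; lra.
Qed.

(** The sine crosses the axis with nonzero speed at both ends; the plateau lifts the middle half
    above [h] while the total stays at most [1 + h]. *)
Definition arc_height (h u : R) := sin (pi * u) + h * plateau u.

Lemma sin_pi_lt (u v : R) : 0 <= u -> u < v -> v <= 4^-1 -> sin (pi * u) < sin (pi * v).
Proof.
move=> u0 uv v1; have pi0 := pi_gt0 R.
have ds (x : R) : is_derive x 1 sin (cos x) := is_derive_sin x.
have lt : pi * u < pi * v by rewrite ltr_pM2l.
have cs : {within `[pi * u, pi * v], continuous sin}.
  by apply: continuous_subspaceT => x; exact: continuous_sin.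
have [c + E] := MVT lt (fun x _ => ds x) cs.
rewrite in_itv /= => /andP[c0 c1].
rewrite -subr_gt0 E mulr_gt0 ?subr_gt0//.
by apply: cos_gt0_pihalf; apply/andP; split; nra.
Qed.

Lemma arc_height_gt0 h u : 0 <= h -> 0 < u < 1 -> 0 < arc_height h u.
Proof.
move=> h0 /andP[u0 u1]; apply: ltr_wpDr; first by rewrite mulr_ge0 ?plateau_ge0.
have pi0 := pi_gt0 R; apply: sin_gt0_pi; apply/andP; split; nra.
Qed.

Lemma arc_height_sym h u : arc_height h (1 - u) = arc_height h u.
Proof.
by rewrite /arc_height plateau_sym mulrBr mulr1 addrC [pi - _]addrC sinDpi sinN opprK addrC.
Qed.

Lemma arc_height_lt h u v : 0 <= h -> 0 <= u -> u < v -> v <= 4^-1 ->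
  arc_height h u < arc_height h v.
Proof.
move=> h0 u0 uv v1; rewrite /arc_height ltr_leD ?sin_pi_lt//.
by rewrite ler_wpM2l// plateau_le// ltW.
Qed.

Lemma arc_height_le h u : 0 <= h -> arc_height h u <= 1 + h.
Proof.
by move=> h0; rewrite lerD ?sin_le1// ler_piMr ?plateau_le1.
Qed.

Lemma arc_height_mid h u : 0 <= h -> 4^-1 < u < 3 / 4 -> h < arc_height h u.
Proof.
move=> h0 /andP[u0 u1]; rewrite /arc_height plateau_eq1 ?mulr1; last by rewrite !ltW.
by have pi0 := pi_gt0 R; rewrite ltrDr; apply: sin_gt0_pi; apply/andP; split; nra.
Qed.

Lemma arc_height_half h : arc_height h 2^-1 = 1 + h.
Proof.
rewrite /arc_height -[pi * _]/(pi / 2) sin_pihalf plateau_eq1 ?mulr1//.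
by apply/andP; split; lra.
Qed.

End Profile.

Section ProfileDerivative.
Variable R : realType.

Definition dramp (u : R) : R := dstep (- 2^-1 + 2 * u) * 2.

Definition dplateau (u : R) : R :=
  dstep (- 1 + 8 * u) * 8 * step (7 + (- 8) * u) +
  step (- 1 + 8 * u) * (dstep (7 + (- 8) * u) * - 8).

Lemma is_derive_affine (a b u : R) : is_derive u 1 (fun x => a + b * x) b.
Proof.
apply: is_derive_eq (is_deriveD (is_derive_cst a u 1)
  (is_deriveM (is_derive_cst b u 1) (is_derive_id u 1))) _.
by rewrite /GRing.scale /= add0r mulr0 addr0 mulr1.
Qed.

Lemma is_derive_step_affine (a b u : R) :
  is_derive u 1 (fun x => step (a + b * x)) (dstep (a + b * u) * b).
Proof.
exact: (@is_derive1_comp R (@step R) (fun x => a + b * x) u _ _ (is_derive_step _)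
  (is_derive_affine _ _ _)).
Qed.

Lemma is_derive_ramp (u : R) : is_derive u 1 (@ramp R) (dramp u).
Proof. exact: is_derive_step_affine. Qed.

Lemma is_derive_plateau (u : R) : is_derive u 1 (@plateau R) (dplateau u).
Proof.
apply: is_derive_eq (is_deriveM (is_derive_step_affine (- 1) 8 u)
  (is_derive_step_affine 7 (- 8) u)) _.
by rewrite /dplateau /GRing.scale /= addrC mulrC.
Qed.

Lemma dstep_eq0 (x : R) : ~~ (0 < x < 1) -> dstep x = 0.
Proof.
rewrite negb_and -!leNgt /dstep => /orP[x0|x1].
  by rewrite !(flat_eq0 _ x0) !mul0r addr0 mul0r.
by rewrite ![flat _ (1 - x)]flat_eq0 ?subr_le0// !mulr0 addr0 mul0r.
Qed.

Lemma dramp_eq0 u : u <= 4^-1 \/ 3 / 4 <= u -> dramp u = 0.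
Proof.
move=> H; rewrite /dramp dstep_eq0 ?mul0r//; apply/negP => /andP[? ?].
by case: H => ?; lra.
Qed.

Lemma dramp_gt0 u : 4^-1 < u < 3 / 4 -> 0 < dramp u.
Proof.
by move=> /andP[? ?]; rewrite mulr_gt0// dstep_gt0//; apply/andP; split; lra.
Qed.

Lemma dplateau_eq0 u : u <= 0 \/ 1 <= u -> dplateau u = 0.
Proof.
move=> H; rewrite /dplateau.
rewrite !dstep_eq0 ?(mul0r, mulr0, addr0)//; apply/negP => /andP[? ?];
by case: H => ?; lra.
Qed.

Lemma dplateau_ge0 u : u <= 4^-1 -> 0 <= dplateau u.
Proof.
move=> u1; rewrite /dplateau [dstep (7 + _)]dstep_eq0; last by apply/negP => /andP[? ?]; lra.
have d0 := dstep_ge0 (- 1 + 8 * u); have s0 := step_ge0 (7 + (- 8) * u).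
by rewrite mul0r mulr0 addr0 mulr_ge0// mulr_ge0.
Qed.

Lemma dplateau_le0 u : 3 / 4 <= u -> dplateau u <= 0.
Proof.
move=> u1; rewrite /dplateau dstep_eq0; last by apply/negP => /andP[? ?]; lra.
have d0 := dstep_ge0 (7 + (- 8) * u); have s0 := step_ge0 (- 1 + 8 * u).
by rewrite !mul0r add0r; apply: mulr_ge0_le0 => //; apply: mulr_ge0_le0 => //; lra.
Qed.

Lemma sin_natD (k : nat) (u : R) : sin (pi * (k%:R + u)) = (-1) ^+ k * sin (pi * u).
Proof.
elim: k => [|k IH]; first by rewrite add0r expr0 mul1r.
rewrite -natr1 addrAC mulrDr mulr1 sinDpi IH exprS; ring.
Qed.

Lemma cos_natD (k : nat) (u : R) : cos (pi * (k%:R + u)) = (-1) ^+ k * cos (pi * u).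
Proof.
elim: k => [|k IH]; first by rewrite add0r expr0 mul1r.
rewrite -natr1 addrAC mulrDr mulr1 cosDpi IH exprS; ring.
Qed.

Definition darc_height (h u : R) := pi * cos (pi * u) + h * dplateau u.

(** In the first quarter sine and plateau both rise, in the last one both fall. In the middle half
    the curve is kept regular by [dramp] instead. *)
Lemma darc_height_neq0 (h u : R) : 0 <= h -> 0 <= u <= 1 -> u <= 4^-1 \/ 3 / 4 <= u ->
  darc_height h u != 0.
Proof.
move=> h0 /andP[u0 u1] H; have pi0 := pi_gt0 R.
have cos_pos (v : R) : 0 <= v -> v <= 4^-1 -> 0 < cos (pi * v).
  move=> v0 v1; have := mulr_ge0 (ltW pi0) v0.
  have : 0 <= pi * (4^-1 - v) by rewrite mulr_ge0 ?subr_ge0// ltW.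
  by move=> ? ?; apply: cos_gt0_pihalf; apply/andP; split; lra.
case: H => H.
  by rewrite gt_eqF// /darc_height ltr_wpDr ?mulr_ge0 ?dplateau_ge0// mulr_gt0// cos_pos.
have c0 : cos (pi * u) < 0.
  have E : cos (pi * (1 - u)) = - cos (pi * u).
    rewrite -cosDpi -[RHS]cosN -(cosD2pi (- (pi * u + pi))).
    by congr cos; rewrite mulr2n; ring.
  by rewrite -oppr_gt0 -E cos_pos//; lra.
rewrite lt_eqF// /darc_height; apply: (@le_lt_trans _ _ (pi * cos (pi * u))).
  by rewrite gerDl mulr_ge0_le0// dplateau_le0.
by rewrite pmulr_rlt0.
Qed.

End ProfileDerivative.

(** * The meander of a permutation *)

Section Curve.
Variables (R : realType) (n : nat) (X h : nat -> R).

(** A global sum, so that smoothness needs no gluing: ramps of past arcs are 1 and telescope, those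
    of future arcs are 0. *)
Definition xcoord (t : R) : R := X 0 + \sum_(k < n.+1) (X k.+1 - X k) * ramp (t - k%:R).

(** The sine changes sign at every integer, and the plateau of arc [k] takes the sign [(-1) ^+ k] to
    match. *)
Definition ycoord (t : R) : R :=
  sin (pi * t) + \sum_(k < n.+1) ((-1) ^+ k * h k) * plateau (t - k%:R).

Definition dxcoord (t : R) : R := \sum_(k < n.+1) (X k.+1 - X k) * dramp (t - k%:R).

Definition dycoord (t : R) : R :=
  pi * cos (pi * t) + \sum_(k < n.+1) ((-1) ^+ k * h k) * dplateau (t - k%:R).

Lemma sum_single (c : nat -> R) (g : R -> R) (t : R) (k : nat) : (k <= n)%N ->
  (forall l : nat, l != k -> g (t - l%:R) = 0) ->
  \sum_(l < n.+1) c l * g (t - l%:R) = c k * g (t - k%:R).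
Proof.
move=> kn g0; have kn' : (k < n.+1)%N by [].
rewrite (bigD1 (Ordinal kn'))//= big1 ?addr0// => l lk.
by rewrite g0 ?mulr0//; apply: contra lk => /eqP E; apply/eqP/val_inj.
Qed.

Lemma shift_le0 (k l : nat) (u : R) : u <= 1 -> (k < l)%N -> k%:R + u - l%:R <= 0.
Proof.
move=> u1 kl; rewrite subr_le0; apply: (@le_trans _ _ k.+1%:R); last by rewrite ler_nat.
by rewrite -natr1 lerD2l.
Qed.

Lemma shift_ge1 (k l : nat) (u : R) : 0 <= u -> (l < k)%N -> 1 <= k%:R + u - l%:R.
Proof.
move=> u0 lk; rewrite lerBrDl; apply: (@le_trans _ _ k%:R); last by rewrite lerDl.
by rewrite natr1 ler_nat.
Qed.

Lemma outside (k l : nat) (u : R) : 0 <= u <= 1 -> l != k ->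
  k%:R + u - l%:R <= 0 \/ 1 <= k%:R + u - l%:R.
Proof.
move=> /andP[u0 u1]; rewrite neq_ltn => /orP[lk|kl].
  by right; exact: shift_ge1.
by left; exact: shift_le0.
Qed.

Lemma xcoordE (k : nat) (u : R) : (k <= n)%N -> 0 <= u <= 1 ->
  xcoord (k%:R + u) = X k + (X k.+1 - X k) * ramp u.
Proof.
move=> kn /andP[u0 u1]; rewrite /xcoord.
rewrite -(big_mkord xpredT (fun l => (X l.+1 - X l) * ramp (k%:R + u - l%:R))).
rewrite (@big_cat_nat _ _ _ k)//=; last exact: leqW.
rewrite (@eq_big_nat _ _ _ 0 k _ (fun l => X l.+1 - X l)); last first.
  move=> l /andP[_ lk]; rewrite ramp_eq1 ?mulr1//.
  by have := shift_ge1 u0 lk; lra.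
rewrite telescope_sumr// big_ltn// [X in _ + (_ + (_ + X))]big_nat_cond big1 ?addr0.
  by rewrite (_ : k%:R + u - k%:R = u); ring.
move=> l; rewrite andbT => /andP[kl _]; rewrite ramp_eq0 ?mulr0//.
by have := shift_le0 u1 kl; lra.
Qed.

Lemma ycoordE (k : nat) (u : R) : (k <= n)%N -> 0 <= u <= 1 ->
  ycoord (k%:R + u) = (-1) ^+ k * arc_height (h k) u.
Proof.
move=> kn u01; rewrite /ycoord sin_natD.
rewrite (@sum_single (fun k => (-1) ^+ k * h k) (@plateau R) _ k)//; last first.
  move=> l /(outside u01)[H|H]; [apply: plateau_le0|apply: plateau_ge78]; lra.
by rewrite /arc_height (_ : k%:R + u - k%:R = u); ring.
Qed.

Lemma dxcoordE (k : nat) (u : R) : (k <= n)%N -> 0 <= u <= 1 ->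
  dxcoord (k%:R + u) = (X k.+1 - X k) * dramp u.
Proof.
move=> kn u01; rewrite /dxcoord.
rewrite (@sum_single (fun k => X k.+1 - X k) (@dramp R) _ k)//; last first.
  by move=> l /(outside u01)[H|H]; apply: dramp_eq0; [left|right]; lra.
by rewrite (_ : k%:R + u - k%:R = u); last by ring.
Qed.

Lemma dycoordE (k : nat) (u : R) : (k <= n)%N -> 0 <= u <= 1 ->
  dycoord (k%:R + u) = (-1) ^+ k * darc_height (h k) u.
Proof.
move=> kn u01; rewrite /dycoord cos_natD.
rewrite (@sum_single (fun k => (-1) ^+ k * h k) (@dplateau R) _ k)//; last first.
  by move=> l /(outside u01); exact: dplateau_eq0.
by rewrite /darc_height (_ : k%:R + u - k%:R = u); ring.
Qed.

Lemma elementary_shift (g : R -> R) (a : R) : elementary g -> elementary (fun t => g (t - a)).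
Proof.
move=> eg; rewrite (_ : (fun _ => _) = (fun t => g (- a + 1 * t))).
  by apply: (elementary_comp eg); exact: elementary_affine.
by apply/funext => t; rewrite mul1r addrC.
Qed.

Lemma elementary_sum (c : nat -> R) (g : R -> R) m : elementary g ->
  elementary (fun t => \sum_(k < m) c k * g (t - k%:R)).
Proof.
move=> eg; elim: m => [|m IH].
  rewrite (_ : (fun _ => _) = fun=> 0); first exact: elementary_cst.
  by apply/funext => t; rewrite big_ord0.
rewrite (_ : (fun _ => _) = fun t => \sum_(k < m) c k * g (t - k%:R) + c m * g (t - m%:R)).
  apply: elementary_add => //; apply: elementary_mul; first exact: elementary_cst.
  exact: elementary_shift.
by apply/funext => t; rewrite big_ord_recr.
Qed.

Lemma elementary_ramp : elementary (@ramp R).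
Proof. by apply: (elementary_comp (elementary_step R)); exact: elementary_affine. Qed.

Lemma elementary_plateau : elementary (@plateau R).
Proof.
by apply: elementary_mul; apply: (elementary_comp (elementary_step R)); exact: elementary_affine.
Qed.

Lemma elementary_xcoord : elementary xcoord.
Proof.
apply: elementary_add; first exact: elementary_cst.
exact: (elementary_sum (fun k => X k.+1 - X k) n.+1 elementary_ramp).
Qed.

Lemma elementary_ycoord : elementary ycoord.
Proof.
apply: elementary_add.
  apply: (elementary_comp (elementary_sin R)).
  by apply: elementary_mul; [exact: elementary_cst|exact: elementary_id].
exact: (elementary_sum (fun k => (-1) ^+ k * h k) n.+1 elementary_plateau).
Qed.

Lemma is_derive_sum_shift (c : nat -> R) (g dg : R -> R) (t : R) m :
  (forall x : R, is_derive x 1 g (dg x)) ->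
  is_derive t 1 (fun t => \sum_(k < m) c k * g (t - k%:R))
    (\sum_(k < m) c k * dg (t - k%:R)).
Proof.
move=> gd; elim: m => [|m IH].
  rewrite (_ : (fun _ => _) = cst 0); last by apply/funext => s; rewrite big_ord0.
  by rewrite big_ord0; exact: is_derive_cst.
rewrite (_ : (fun _ => _) = fun t => \sum_(k < m) c k * g (t - k%:R) + c m * g (t - m%:R)); last first.
  by apply/funext => s; rewrite big_ord_recr.
rewrite big_ord_recr /=; apply: is_deriveD => //.
have dA : is_derive t 1 (fun x : R => x - m%:R) (1 - 0) :=
  is_deriveB (is_derive_id t 1) (is_derive_cst (m%:R : R) t 1).
have dS := @is_derive1_comp R g (fun x => x - m%:R) t _ _ (gd _) dA.
apply: is_derive_eq (is_deriveM (is_derive_cst (c m) t 1) dS) _.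
by rewrite /GRing.scale /= mulr0 addr0 subr0 mulr1.
Qed.

Lemma is_derive_xcoord (t : R) : is_derive t 1 xcoord (dxcoord t).
Proof.
have dS := is_derive_sum_shift (fun k => X k.+1 - X k) t n.+1 (@is_derive_ramp R).
by apply: is_derive_eq (is_deriveD (is_derive_cst (X 0%N : R) t 1) dS) _; rewrite add0r.
Qed.

Lemma is_derive_ycoord (t : R) : is_derive t 1 ycoord (dycoord t).
Proof.
have dS := is_derive_sum_shift (fun k => (-1) ^+ k * h k) t n.+1 (@is_derive_plateau R).
have dP : is_derive t 1 (fun x : R => pi * x) pi.
  apply: is_derive_eq (is_deriveM (is_derive_cst (pi : R) t 1) (is_derive_id t 1)) _.
  by rewrite /GRing.scale /= mulr0 addr0 mulr1.
have dsin := @is_derive1_comp R (@sin R) (fun x => pi * x) t _ _ (is_derive_sin _) dP.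
by apply: is_derive_eq (is_deriveD dsin dS) _; rewrite [cos _ * _]mulrC.
Qed.

Lemma arc_decomposition (t : R) : 0 <= t <= n.+1%:R ->
  exists k u, [/\ (k <= n)%N, 0 <= u <= 1 & t = k%:R + u].
Proof.
move=> /andP[t0 tn]; elim: (n) tn => [|m IH] tn.
  by exists 0%N, t; rewrite add0r t0 tn.
have [tm|tm] := leP t m.+1%:R.
  by have [k [u [km u01 ->]]] := IH tm; exists k, u; rewrite leqW.
exists m.+1, (t - m.+1%:R); split => //; last by ring.
by rewrite subr_ge0 (ltW tm) lerBlDl natr1.
Qed.

End Curve.

(** * Injective curves and homeomorphisms *)

Section Homeomorphism.
Variable R : realType.

Lemma compact_unit_segment : compact (@unit_segment R).
Proof. exact: segment_compact. Qed.

(* A continuous injection of a compact set is a homeomorphism onto its image: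
   near [g t], the values avoid the closed image of the far parameters. *)
Lemma homeo_of_injective (g : R -> R * R) : continuous g ->
  (forall s t, unit_segment s -> unit_segment t -> g s = g t -> s = t) ->
  homeo_onto_image g.
Proof.
move=> cg ginj; split; first exact: continuous_subspaceT.
pose inv z := xget 0 [set t | unit_segment t /\ g t = z].
have invK t : unit_segment t -> inv (g t) = t.
  move=> ut; rewrite /inv; case: xgetP => [t' _ [ut' /ginj->//]|/(_ t)/= []//].
exists inv; split => //.
apply/subspace_continuousP => z [t ut <-].
change (inv w @[w --> within (g @` unit_segment) (nbhs (g t))] --> inv (g t)).
rewrite invK//.
apply/cvgrPdist_lt => e e0.
pose far := unit_segment `&` [set s | e <= `|t - s|].
have cfar : compact far.
  apply: (subclosed_compact _ compact_unit_segment); last by move=> ? [].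
  apply: closedI; first exact: itv_closed.
  rewrite (_ : [set s | _] = (fun s => `|t - s|) @^-1` [set s | e <= s]) //.
  apply: preimage_closed; last exact: closed_ge.
  move=> s _; apply: cvg_norm; apply: cvgB; [exact: cvg_cst|exact: cvg_id].
have clfar : closed (g @` far).
  apply: compact_closed; first exact: norm_hausdorff.
  by apply: continuous_compact => //; exact: continuous_subspaceT.
have ngt : (~` (g @` far)) (g t).
  move=> [s [us /= tse] /ginj st]; move: tse; rewrite st// subrr normr0.
  by rewrite leNgt e0.
have := open_nbhs_nbhs (conj (closed_openC clfar) ngt).
apply: filterS => w /= nw [s us sw]; rewrite -sw invK//.
rewrite ltNge; apply/negP => tse; apply: nw; exists s => //.
Qed.

End Homeomorphism.

(** * Assembling the meander *)

Section Assembly.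
Variables (R : realType) (n : nat) (p : 'S_n).
Hypothesis n1 : (1 <= n)%N.
Hypothesis idem : forall i j : 'I_n, odd (common_inversions p i j) = inversion p i j.

Local Notation q := (label_of p).

(** Heights are at most [n.+2], so this radius makes every [half_chord] exceed [n.+2] and leaves the
    inner arcs strictly inside the disk. *)
Definition rad : R := 2 * n.+2%:R.

Definition low k := minn (q k) (q k.+1).
Definition high k := maxn (q k) (q k.+1).
Definition height k : R := (high k - low k)%:R.

(** Abscissa at which the circle has ordinate [1 + height k], the height of arc [k] at its
    midpoint. *)
Definition half_chord k : R := Num.sqrt (rad ^+ 2 - (1 + height k) ^+ 2).

(* The two ends of the curve are placed so that the points of parameters 1/2 and
   n + 1/2 lie on the circle. *)
Definition node k : R :=
  if k == 0%N then - (2 * half_chord 0) - (q 1)%:R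
  else if k == n.+1 then 2 * half_chord n - (q n)%:R else (q k)%:R.

Lemma label_le k : (k <= n.+1)%N -> (q k <= n.+1)%N.
Proof.
move=> /label_cases[->|->|[i ->]] //; first by rewrite label_end.
by rewrite label_of_ord ltnS ltnW.
Qed.

Lemma label_inner k : (1 <= k <= n)%N -> (1 <= q k <= n)%N.
Proof. by move=> /ordP[i ->]; rewrite label_of_ord; exact: ltn_ord. Qed.

Lemma height_ge0 k : 0 <= height k.
Proof. exact: ler0n. Qed.

Lemma height_le k : (k <= n)%N -> 1 + height k <= n.+2%:R.
Proof.
move=> kn; rewrite /height addrC natr1 ler_nat ltnS.
have := @label_le k (leqW kn); have := @label_le k.+1 kn.
by rewrite /high /low; lia.
Qed.

Lemma half_chord_sqr k : (k <= n)%N ->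
  half_chord k ^+ 2 = rad ^+ 2 - (1 + height k) ^+ 2.
Proof.
move=> kn; rewrite sqr_sqrtr// subr_ge0.
have := height_le kn; have := height_ge0 k; rewrite /rad; nra.
Qed.

Lemma half_chord_gt k : (k <= n)%N -> n.+2%:R < half_chord k.
Proof.
move=> kn; have := half_chord_sqr kn; have := sqrtr_ge0 (rad ^+ 2 - (1 + height k) ^+ 2).
rewrite -/(half_chord k) => w0 w2; rewrite ltNge; apply/negP => wle.
have N0 : (0 : R) < n.+2%:R by rewrite ltr0n.
have := height_le kn; have := height_ge0 k; rewrite /rad in w2; nra.
Qed.

Lemma node0 : node 0 = - (2 * half_chord 0) - (q 1)%:R.
Proof. by []. Qed.

Lemma node_end : node n.+1 = 2 * half_chord n - (q n)%:R.
Proof. by rewrite /node /= eqxx. Qed.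

Lemma node_inner k : (1 <= k <= n)%N -> node k = (q k)%:R.
Proof. by rewrite /node; case: eqP => [->//|_]; case: eqP => // ->; rewrite ltnn. Qed.

Lemma node0_lt0 : node 0 < 0.
Proof.
have := half_chord_gt (leq0n n); have : (0 : R) <= (q 1)%:R by exact: ler0n.
have : (0 : R) <= n.+2%:R by exact: ler0n.
by rewrite node0; lra.
Qed.

Lemma node_end_gt : n%:R < node n.+1.
Proof.
have := half_chord_gt (leqnn n).
have : (q n)%:R <= n%:R :> R.
  by rewrite ler_nat; have := @label_inner n; rewrite n1 leqnn => /(_ isT)/andP[].
by rewrite node_end -natr1 -natr1; lra.
Qed.

Lemma node_lt i j : (i <= n.+1)%N -> (j <= n.+1)%N -> (q i < q j)%N -> node i < node j.
Proof.
move=> iN jN; have := node0_lt0; have := node_end_gt.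
have inner k : (1 <= k <= n)%N -> 1 <= node k <= n%:R.
  by move=> kn; rewrite node_inner// !ler_nat ler1n; exact: label_inner.
have [->|->|[i' iE]] := label_cases iN; have [->|->|[j' jE]] := label_cases jN;
  rewrite ?label_end//=.
- have : (0:R) <= n%:R by exact: ler0n. lra.
- have := inner j; rewrite jE ltn_ord => /(_ isT)/andP[? ?]; lra.
- by rewrite ltnn.
- by rewrite jE label_of_ord ltnS ltnNge (ltnW (ltn_ord _)).
- have := inner i; rewrite iE ltn_ord => /(_ isT)/andP[? ?] ? ? _; lra.
- move=> _ _; rewrite !node_inner ?iE ?jE ?ltr_nat //; exact: ltn_ord.
Qed.

Lemma node_ltE i j : (i <= n.+1)%N -> (j <= n.+1)%N -> (node i < node j) = (q i < q j)%N.
Proof.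
move=> iN jN; case: (ltngtP (q i) (q j)) => h.
- exact: node_lt.
- by apply/negbTE; rewrite -leNgt ltW// node_lt.
- by rewrite (label_inj iN jN h) ltxx.
Qed.

Local Notation x := (xcoord n node).
Local Notation y := (ycoord n height).

Lemma node_neq k : (k <= n)%N -> node k.+1 - node k != 0.
Proof.
move=> kn; rewrite subr_eq0; have kN := leqW kn; have kS : (k.+1 <= n.+1)%N := kn.
apply/eqP => E.
have : node k < node k.+1 \/ node k.+1 < node k.
  have [lt|lt|/(label_inj kN kS)] := ltngtP (q k) (q k.+1); last by clear; lia.
    by left; exact: node_lt.
  by right; exact: node_lt.
by rewrite E ltxx => -[].
Qed.

(** If both parameters are in the first quarter, the heights differ; if both are in the last, the
    same holds by symmetry; otherwise the ramp separates the abscissas. *)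
Lemma arc_inj k (u v : R) : (k <= n)%N -> 0 <= u -> u < v -> v <= 1 ->
  x (k%:R + u) = x (k%:R + v) -> y (k%:R + u) <> y (k%:R + v).
Proof.
move=> kn u0 uv v1.
have u01 : 0 <= u <= 1 by apply/andP; split; lra.
have v01 : 0 <= v <= 1 by apply/andP; split; lra.
rewrite !xcoordE// !ycoordE// => /addrI /(mulfI (node_neq kn)) ruv.
move=> /(mulfI (negbT (signr_eq0 _ _))) F.
have [v2|v2] := leP v 4^-1.
  by have := arc_height_lt (height_ge0 k) u0 uv v2; rewrite F ltxx.
have [u2|u2] := leP (3 / 4) u; last first.
  by have := ramp_lt uv u2 v2; rewrite ruv ltxx.
have := @arc_height_lt R (height k) (1 - v) (1 - u) (height_ge0 k).
rewrite !arc_height_sym F ltxx => H.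
by have : false by apply: H; lra.
Qed.

Lemma node_min_lt k l : (k <= n)%N -> (l <= n)%N -> (high k < low l)%N ->
  Num.max (node k) (node k.+1) < Num.min (node l) (node l.+1).
Proof.
move=> kn ln; have kN := leqW kn; have lN := leqW ln.
by rewrite /high /low lt_min !gt_max !node_ltE// leq_min !gtn_max.
Qed.

Lemma node_nested k l : (k <= n)%N -> (l <= n)%N -> (low k < low l)%N ->
  (high l < high k)%N ->
  Num.min (node k) (node k.+1) < Num.min (node l) (node l.+1) /\
  Num.max (node l) (node l.+1) < Num.max (node k) (node k.+1).
Proof.
move=> kn ln; have kN := leqW kn; have lN := leqW ln.
rewrite /high /low lt_min !gt_min gt_max !lt_max !node_ltE//.
by rewrite leq_min !gtn_min gtn_max !leq_max => -> ->.
Qed.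

Lemma xcoord_between k (u : R) : (k <= n)%N -> 0 <= u <= 1 ->
  Num.min (node k) (node k.+1) <= x (k%:R + u) <= Num.max (node k) (node k.+1).
Proof.
move=> kn u01; rewrite xcoordE//; have := ramp_ge0 u; have := ramp_le1 u.
by case: (leP (node k)) => ? ? ?; apply/andP; split; nra.
Qed.

Lemma xcoord_strict k (u : R) : (k <= n)%N -> 0 <= u <= 1 ->
  Num.min (node k) (node k.+1) < x (k%:R + u) < Num.max (node k) (node k.+1) ->
  4^-1 < u < 3 / 4.
Proof.
move=> kn u01; rewrite xcoordE// => /andP[lt1 lt2]; rewrite !ltNge; apply/andP.
split; apply/negP => H; move: lt1 lt2.
  rewrite ramp_eq0// mulr0 addr0; case: (leP (node k) (node k.+1)) => ? ? ?; lra.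
rewrite ramp_eq1// mulr1 addrC subrK; case: (leP (node k) (node k.+1)) => ? ? ?; lra.
Qed.

Lemma nested_height k l : (low k < low l)%N -> (high l < high k)%N ->
  1 + height l <= height k.
Proof.
move=> lo hi; rewrite /height addrC natr1 ler_nat.
by move: lo hi; rewrite /low /high; lia.
Qed.

(** A common abscissa is strictly inside the outer chord, hence in the middle half of the outer arc,
    which is there above [height k]; the inner arc never exceeds [1 + height l]. *)
Lemma nested_disjoint k l (u v : R) : (k <= n)%N -> (l <= n)%N ->
  0 <= u <= 1 -> 0 <= v <= 1 -> (low k < low l)%N -> (high l < high k)%N ->
  x (k%:R + u) = x (l%:R + v) ->
  arc_height (height k) u <> arc_height (height l) v.
Proof.
move=> kn ln u01 v01 lo hi xE F.
have [lo' hi'] := node_nested kn ln lo hi.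
have /andP[b1 b2] := xcoord_between ln v01.
have strict : 4^-1 < u < 3 / 4.
  by apply: (xcoord_strict kn u01); rewrite xE (lt_le_trans lo')//= (le_lt_trans b2).
have := arc_height_mid (height_ge0 k) strict.
have := arc_height_le v (height_ge0 l); have := nested_height lo hi.
by rewrite F; lra.
Qed.

Lemma chords_cases k l : (k <= n)%N -> (l <= n)%N -> k <> l -> odd k = odd l ->
  [\/ (high k < low l)%N, (high l < low k)%N,
      (low k < low l)%N && (high l < high k)%N |
      (low l < low k)%N && (high k < high l)%N].
Proof.
wlog kl : k l / (k < l)%N => [H kn ln ne par|kn ln _ par].
  have [lt|lt|//] := ltngtP k l; first exact: H.
  by have [|h|h|h|h] := H l k lt ln kn _ (esym par); [lia|constructor 2|constructor 1|
    constructor 4|constructor 3].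
(* Equal parities exclude consecutive indices, so the chords share no end. *)
have kl' : (k.+1 < l)%N.
  by rewrite ltn_neqAle kl andbT; apply: contra_eqN par => /eqP <- /=; case: odd.
have := chords_noncrossing idem kl' ln par.
have kN := leqW kn; have lN := leqW ln.
have kS : (k.+1 <= n.+1)%N := kn; have lS : (l.+1 <= n.+1)%N := ln.
have d1 : q k <> q l by move=> /(label_inj kN lN); clear -kl'; lia.
have d2 : q k <> q l.+1 by move=> /(label_inj kN lS); clear -kl'; lia.
have d3 : q k.+1 <> q l by move=> /(label_inj kS lN); clear -kl'; lia.
have d4 : q k.+1 <> q l.+1 by move=> /(label_inj kS lS); clear -kl'; lia.
move: d1 d2 d3 d4; rewrite /low /high.
move: (q k) (q k.+1) (q l) (q l.+1); clear => a b c d ac ad bc bd NC.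
have : [|| (maxn a b < minn c d), (maxn c d < minn a b),
    (minn a b < minn c d) && (maxn c d < maxn a b) |
    (minn c d < minn a b) && (maxn a b < maxn c d)]%N by lia.
by case/or4P => h; [constructor 1|constructor 2|constructor 3|constructor 4].
Qed.

(** Half-open parameters make the arc index unique. Height 0 occurs only at nodes, the sign of the
    height gives the parity of the index, and arcs on the same side have disjoint or nested
    chords. *)
Lemma curve_inj k l (u v : R) : (k <= n)%N -> (l <= n)%N ->
  0 <= u < 1 -> 0 <= v < 1 -> x (k%:R + u) = x (l%:R + v) ->
  y (k%:R + u) = y (l%:R + v) -> k = l /\ u = v.
Proof.
move=> kn ln /andP[u0 u1] /andP[v0 v1] xE yE.
have u01 : 0 <= u <= 1 by rewrite u0 ltW.
have v01 : 0 <= v <= 1 by rewrite v0 ltW.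
have F0 h' : arc_height h' 0 = 0 :> R by rewrite /arc_height mulr0 sin0 plateau_le0 ?mulr0 ?addr0//; lra.
have F1 k' w : 0 <= w -> w < 1 -> w != 0 -> 0 < arc_height (height k') w.
  by move=> w0 w1 wn; apply: arc_height_gt0; rewrite ?height_ge0// lt_neqAle eq_sym wn w0.
move: (yE); rewrite !ycoordE// => FE.
have [uz|un] := eqVneq u 0; have [vz|vn] := eqVneq v 0.
- split; last by rewrite uz vz.
  have r0 : ramp (0 : R) = 0 by rewrite ramp_eq0//; lra.
  move: xE; rewrite !xcoordE// uz vz r0 !mulr0 !addr0.
  move=> E; have kN := leqW kn; have lN := leqW ln.
  have [lt|lt|/(label_inj kN lN)//] := ltngtP (q k) (q l).
  + by have := node_lt kN lN lt; rewrite E ltxx.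
  + by have := node_lt lN kN lt; rewrite E ltxx.
- move: FE; rewrite uz F0 mulr0 => /esym/eqP; rewrite mulf_eq0 signr_eq0 /=.
  by rewrite gt_eqF// F1.
- move: FE; rewrite vz F0 mulr0 => /eqP; rewrite mulf_eq0 signr_eq0 /=.
  by rewrite gt_eqF// F1.
have Fk := F1 k u u0 u1 un; have Fl := F1 l v v0 v1 vn.
have par : odd k = odd l.
  move: FE; rewrite -signr_odd -[(-1) ^+ l]signr_odd.
  by case: odd; case: odd; rewrite ?expr0 ?expr1 ?mul1r ?mulN1r// => ?; lra.
have {}FE : arc_height (height k) u = arc_height (height l) v.
  by move: FE; rewrite -signr_odd -[(-1) ^+ l]signr_odd par => /(mulfI (negbT (signr_eq0 _ _))).
have [kl|kl] := eqVneq k l.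
  split => //; rewrite -kl in xE yE.
  have [lt|lt|//] := ltgtP u v.
  + by case: (arc_inj kn u0 lt (ltW v1) xE).
  + by case: (arc_inj kn v0 lt (ltW u1) (esym xE)).
exfalso; have /andP[a1 a2] := xcoord_between kn u01.
have /andP[b1 b2] := xcoord_between ln v01.
have [|h|h|/andP[h h']|/andP[h h']] := chords_cases kn ln _ par.
- exact/eqP.
- by have := node_min_lt kn ln h; rewrite xE in a2; move: a2 b1; lra.
- by have := node_min_lt ln kn h; rewrite -xE in b2; move: b2 a1; lra.
- exact: (nested_disjoint kn ln u01 v01 h h' xE).
- exact: (nested_disjoint ln kn v01 u01 h h' (esym xE)).
Qed.

(** Only the part from the middle of the first arc to the middle of the last is used; the end of an
    arc is reassigned to the start of the next. *)
Lemma window (t : R) : 2^-1 <= t <= n%:R + 2^-1 -> exists k u,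
  [/\ (k <= n)%N /\ 0 <= u < 1, t = k%:R + u, k = 0%N -> 2^-1 <= u & k = n -> u <= 2^-1].
Proof.
move=> /andP[t1 t2].
have [k [u [kn /andP[u0 u1] tE]]] : exists k u, [/\ (k <= n)%N, 0 <= u <= 1 & t = k%:R + u].
  by apply: arc_decomposition; apply/andP; split; rewrite -?natr1; lra.
have [u1'|u1'] := eqVneq u 1; last first.
  exists k, u; split => //.
  - by rewrite u0 lt_neqAle u1' u1.
  - by move=> k0; move: t1; rewrite tE k0 add0r.
  - by move=> k0; move: t2; rewrite tE k0 lerD2l.
have kn' : (k < n)%N.
  by rewrite -(ltr_nat R); move: t2; rewrite tE u1'; lra.
exists k.+1, 0; split => //.
- by rewrite lexx ltr01.
- by rewrite tE u1' addr0 natr1.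
- by move=> _; lra.
Qed.

Lemma ycoord_sqr k (u : R) : (k <= n)%N -> 0 <= u <= 1 ->
  y (k%:R + u) ^+ 2 = arc_height (height k) u ^+ 2.
Proof. by move=> kn u01; rewrite ycoordE// exprMn sqrr_sign mul1r. Qed.

Lemma arc_height_sqr k (u : R) : (k <= n)%N -> 0 <= u <= 1 ->
  arc_height (height k) u ^+ 2 <= (1 + height k) ^+ 2.
Proof.
move=> kn /andP[u0 u1]; have h0 := height_ge0 k.
have le1 := arc_height_le u h0.
suff ge0 : 0 <= arc_height (height k) u by rewrite ler_sqr ?nnegrE//; lra.
apply: addr_ge0; last by rewrite mulr_ge0 ?plateau_ge0.
by have pi0 := pi_gt0 R; apply: sin_ge0_pi; apply/andP; split; nra.
Qed.

(** On the two end arcs the abscissa is strictly within [half_chord] except at the extremity, while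
    the height is at most [1 + height k]. The other arcs have abscissas between 1 and [n] and are
    inside by the choice of [rad]. *)
Lemma in_disk (t : R) : 2^-1 <= t <= n%:R + 2^-1 ->
  x t ^+ 2 + y t ^+ 2 <= rad ^+ 2 /\
  (x t ^+ 2 + y t ^+ 2 = rad ^+ 2 <-> t = 2^-1 \/ t = n%:R + 2^-1).
Proof.
move=> /window[k [u [[kn /andP[u0 u1]] -> uk0 ukn]]].
have u01 : 0 <= u <= 1 by rewrite u0 ltW.
have ny := arc_height_sqr kn u01; rewrite ycoord_sqr//.
have label_bound j : (1 <= j <= n)%N -> 1 <= ((q j)%:R : R) <= n%:R.
  by move=> jn; rewrite ler1n ler_nat; exact: label_inner.
have strict : k%:R + u <> 2^-1 -> k%:R + u <> n%:R + 2^-1 ->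
    x (k%:R + u) ^+ 2 + arc_height (height k) u ^+ 2 < rad ^+ 2.
  move=> t0 tn.
  have [k0|k0] := eqVneq k 0%N.
    have u2 : 2^-1 < u.
      by rewrite lt_neqAle uk0// andbT; apply/eqP => E; apply: t0; rewrite k0 add0r.
    have wlt := half_chord_gt (leq0n n); have w2 := half_chord_sqr (leq0n n).
    have /andP[q1 q2] : 1 <= ((q 1)%:R : R) <= n%:R by apply: label_bound; rewrite n1.
    have r1 : 2^-1 < ramp u by rewrite -ramp_half; apply: ramp_lt => //; lra.
    have r2 := ramp_le1 u; rewrite k0 in ny *.
    rewrite -natr1 -natr1 in wlt.
    have xE : x (0%:R + u) = node 0 + (node 1 - node 0) * ramp u by apply: xcoordE.
    have node1 : node 1 = (q 1)%:R by apply: node_inner; rewrite n1.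
    have xlo : - half_chord 0 < x (0%:R + u) by rewrite xE node1 node0; nra.
    have xhi : x (0%:R + u) < half_chord 0 by rewrite xE node1 node0; nra.
    have : x (0%:R + u) ^+ 2 < half_chord 0 ^+ 2 by nra.
    by rewrite w2; lra.
  have [kN|kN] := eqVneq k n.
    have u2 : u < 2^-1.
      by rewrite lt_neqAle ukn// andbT; apply/eqP => E; apply: tn; rewrite kN E.
    have wlt := half_chord_gt (leqnn n); have w2 := half_chord_sqr (leqnn n).
    have /andP[q1 q2] : 1 <= ((q n)%:R : R) <= n%:R by apply: label_bound; rewrite n1 leqnn.
    have r1 : ramp u < 2^-1 by rewrite -[ltRHS]ramp_half; apply: ramp_lt => //; lra.
    have r2 := ramp_ge0 u; rewrite kN in ny *.
    rewrite -natr1 -natr1 in wlt.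
    have xE : x (n%:R + u) = node n + (node n.+1 - node n) * ramp u by apply: xcoordE.
    have node1 : node n = (q n)%:R by apply: node_inner; rewrite n1 leqnn.
    have xlo : - half_chord n < x (n%:R + u) by rewrite xE node1 node_end; nra.
    have xhi : x (n%:R + u) < half_chord n by rewrite xE node1 node_end; nra.
    have : x (n%:R + u) ^+ 2 < half_chord n ^+ 2 by nra.
    by rewrite w2; lra.
  have k1 : (1 <= k <= n)%N by rewrite lt0n k0.
  have k2 : (1 <= k.+1 <= n)%N by rewrite /= ltn_neqAle kN.
  have /andP[q1 q2] := label_bound k k1; have /andP[q3 q4] := label_bound k.+1 k2.
  have /andP[x1 x2] := xcoord_between kn u01.
  rewrite !node_inner// in x1 x2.
  have x3 : 1 <= x (k%:R + u) by apply: le_trans x1; rewrite le_min q1 q3.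
  have x4 : x (k%:R + u) <= n%:R by apply: le_trans x2 _; rewrite ge_max q2 q4.
  have hk := height_le kn; have hk0 := height_ge0 k; rewrite /rad -natr1 -natr1 in hk *.
  have n0 : (0 : R) <= n%:R by exact: ler0n.
  have : x (k%:R + u) ^+ 2 <= n%:R ^+ 2 by nra.
  have : (1 + height k) ^+ 2 <= (n%:R + 1 + 1) ^+ 2 by nra.
  nra.
have [t0|t0] := eqVneq (k%:R + u) 2^-1.
  have k0 : k = 0%N.
    case: (k) t0 => // k'; rewrite -natr1 => E; have : (0:R) <= k'%:R by exact: ler0n.
    by move=> ?; exfalso; lra.
  have uE : u = 2^-1 by rewrite -t0 k0 add0r.
  have xE : x (k%:R + u) = - half_chord 0.
    rewrite xcoordE// k0 uE ramp_half node0 node_inner; last by rewrite n1.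
    by field.
  rewrite xE uE arc_height_half sqrrN half_chord_sqr// k0 subrK lexx; split => //.
  by split => // _; left; rewrite add0r.
have [tn|tn] := eqVneq (k%:R + u) (n%:R + 2^-1).
  have kN : k = n.
    apply/eqP; rewrite eqn_leq kn -ltnS -(ltr_nat R) -natr1; lra.
  have uE : u = 2^-1 by move: tn; rewrite kN => /addrI.
  have xE : x (k%:R + u) = half_chord n.
    rewrite xcoordE// kN uE ramp_half node_end node_inner; last by rewrite n1 leqnn.
    by field.
  rewrite xE uE arc_height_half half_chord_sqr// kN subrK lexx; split => //.
  by split => // _; right.
have lt := strict (elimN eqP t0) (elimN eqP tn).
split; first exact: ltW.
split => [E|[E|E]]; first by rewrite E ltxx in lt.
- by rewrite E eqxx in t0.
- by rewrite E eqxx in tn.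
Qed.

Definition param (s : R) : R := 2^-1 + n%:R * s.
Definition arcs (s : R) : R * R := (x (param s), y (param s)).
Definition diameter (s : R) : R * R := (- rad + (2 * rad) * s, 0).

Let nR_gt0 : (0 : R) < n%:R. Proof. by rewrite ltr0n. Qed.

Lemma rad_gt0 : 0 < rad.
Proof. by rewrite /rad mulr_gt0// ltr0n. Qed.

Lemma param_window (s : R) : unit_segment s -> 2^-1 <= param s <= n%:R + 2^-1.
Proof.
rewrite /unit_segment /= in_itv /= /param => /andP[s0 s1].
by have := ltW nR_gt0 => ?; apply/andP; split; nra.
Qed.

Lemma param_inj (s t : R) : param s = param t -> s = t.
Proof. by move=> /addrI /mulfI; apply; rewrite gt_eqF. Qed.

Lemma smooth_arcs : smooth arcs.
Proof.
apply: smooth_elementary.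
  by apply: (elementary_comp (elementary_xcoord _ _)); exact: elementary_affine.
by apply: (elementary_comp (elementary_ycoord _ _)); exact: elementary_affine.
Qed.

Lemma smooth_diameter : smooth diameter.
Proof. by apply: smooth_elementary; [exact: elementary_affine|exact: elementary_cst]. Qed.

Lemma derive_arcs (s : R) : derive1 arcs s =
  (dxcoord n node (param s) * n%:R, dycoord n height (param s) * n%:R).
Proof.
have da := is_derive_affine (2^-1 : R) n%:R s.
have dx := @is_derive1_comp R x param s _ _ (is_derive_xcoord _ _ _) da.
have dy := @is_derive1_comp R y param s _ _ (is_derive_ycoord _ _ _) da.
by rewrite derive1E; have [_ ->] := is_derive_pair dx dy.
Qed.

Lemma derive_diameter (s : R) : derive1 diameter s = (2 * rad, 0).
Proof.
have := is_derive_pair (is_derive_affine (- rad) (2 * rad) s) (is_derive_cst (0 : R) s 1).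
by rewrite derive1E => -[_ ->].
Qed.

Lemma immersion_arcs : immersion arcs.
Proof.
move=> s /param_window/window[k [u [[kn /andP[u0 u1]] tE _ _]]].
have u01 : 0 <= u <= 1 by rewrite u0 ltW.
rewrite derive_arcs tE dxcoordE// dycoordE//; apply/eqP => -[/eqP E1 /eqP E2].
move: E1; rewrite mulf_eq0 (gt_eqF nR_gt0) orbF mulf_eq0 (negPf (node_neq kn)) /= => E1.
move: E2; rewrite mulf_eq0 (gt_eqF nR_gt0) orbF mulf_eq0 signr_eq0 /=.
have [u2|u2] := boolP ((u <= 4^-1) || (3 / 4 <= u)).
  apply/negP; apply: darc_height_neq0; rewrite ?height_ge0//.
  by apply/orP.
have u3 : 4^-1 < u < 3 / 4 by move: u2; rewrite negb_or -!ltNge.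
by have := dramp_gt0 u3; rewrite (eqP E1) ltxx.
Qed.

Lemma immersion_diameter : immersion diameter.
Proof.
move=> s _; rewrite derive_diameter; apply/eqP => -[/eqP].
by rewrite mulf_eq0 (gt_eqF rad_gt0) pnatr_eq0.
Qed.

Lemma arcs_inj (s t : R) : unit_segment s -> unit_segment t -> arcs s = arcs t -> s = t.
Proof.
move=> /param_window/window[k [u [[kn u01] sE _ _]]].
move=> /param_window/window[l [v [[ln v01] tE _ _]]].
rewrite /arcs sE tE => -[xE yE]; apply: param_inj; rewrite sE tE.
by have [-> ->] := curve_inj kn ln u01 v01 xE yE.
Qed.

Lemma diameter_inj (s t : R) : diameter s = diameter t -> s = t.
Proof.
move=> [/addrI/mulfI]; apply; rewrite mulf_neq0 ?pnatr_eq0//.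
by rewrite gt_eqF// rad_gt0.
Qed.

Lemma arcs_embedding : smooth_embedding arcs.
Proof.
split; [exact: smooth_arcs|exact: immersion_arcs|apply: homeo_of_injective].
  exact: smooth_continuous smooth_arcs.
exact: arcs_inj.
Qed.

Lemma diameter_embedding : smooth_embedding diameter.
Proof.
split; [exact: smooth_diameter|exact: immersion_diameter|apply: homeo_of_injective].
  exact: smooth_continuous smooth_diameter.
by move=> s t _ _; exact: diameter_inj.
Qed.

Lemma arcs_proper : proper_in_disk (0, 0) rad arcs.
Proof.
split=> s us; have [le iff] := in_disk (param_window us).
  by rewrite /disk /= !subr0.
rewrite /disk_boundary /= !subr0; apply: (iff_trans iff).
rewrite /param; split=> -[].
- move=> /(canRL (addKr _)); rewrite addNr => /eqP; rewrite mulf_eq0 (gt_eqF nR_gt0) /=.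
  by move/eqP; left.
- rewrite addrC => /addIr /eqP; rewrite -subr_eq0 -{2}[n%:R]mulr1 -mulrBr mulf_eq0.
  by rewrite (gt_eqF nR_gt0) subr_eq0 => /eqP; right.
- by move=> ->; left; rewrite mulr0 addr0.
- by move=> ->; right; rewrite mulr1 addrC.
Qed.

Lemma diameter_proper : proper_in_disk (0, 0) rad diameter.
Proof.
have r0 := rad_gt0; split=> s; rewrite /unit_segment /= in_itv /= => /andP[s0 s1].
  have : 0 <= rad ^+ 2 * (s * (1 - s)) by rewrite mulr_ge0 ?sqr_ge0// mulr_ge0// subr_ge0.
  by rewrite /disk /= !subr0 expr0n addr0; lra.
rewrite /disk_boundary /= !subr0 expr0n addr0; split.
  move=> E; have /eqP : s * (1 - s) = 0.
    apply: (@mulfI _ (4 * rad ^+ 2)); first by rewrite mulf_neq0 ?pnatr_eq0// expf_neq0// gt_eqF.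
    by rewrite mulr0; lra.
  by rewrite mulf_eq0 subr_eq0 => /orP[/eqP ->|/eqP <-]; auto.
by case=> ->; ring.
Qed.

Lemma ycoord_eq0 (t : R) : 2^-1 <= t <= n%:R + 2^-1 -> y t = 0 ->
  exists2 k, (1 <= k <= n)%N & t = k%:R.
Proof.
move=> /window[k [u [[kn /andP[u0 u1]] -> uk0 ukn]]].
have u01 : 0 <= u <= 1 by rewrite u0 ltW.
rewrite ycoordE// => /eqP; rewrite mulf_eq0 signr_eq0 /=.
have [u00|un] := eqVneq u 0.
  exists k; last by rewrite u00 addr0.
  by rewrite kn andbT lt0n; apply/eqP => /uk0; rewrite u00; lra.
by rewrite gt_eqF// arc_height_gt0 ?height_ge0// lt_neqAle eq_sym un u0.
Qed.

Lemma arcs_node k s : (1 <= k <= n)%N -> param s = k%:R -> arcs s = ((q k)%:R, 0).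
Proof.
move=> kn sE; have kN : (k <= n)%N by case/andP: kn.
have u01 : 0 <= (0 : R) <= 1 by rewrite lexx ler01.
rewrite /arcs sE -[k%:R]addr0 xcoordE// ycoordE// ramp_eq0; last lra.
rewrite mulr0 addr0 node_inner//; congr (_, _).
by rewrite /arc_height mulr0 sin0 plateau_le0 ?mulr0 ?addr0 ?mulr0//; lra.
Qed.

Definition time k : R := (k%:R - 2^-1) / n%:R.

Lemma param_time k : param (time k) = k%:R.
Proof. by rewrite /param /time mulrC divfK ?gt_eqF// addrC subrK. Qed.

Lemma unit_time k : (1 <= k <= n)%N -> unit_segment (time k).
Proof.
move=> /andP[k1 kn]; rewrite /unit_segment /= in_itv /= /time.
have h1 : (1 : R) <= k%:R by rewrite ler1n.
have h2 : (k%:R : R) <= n%:R by rewrite ler_nat.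
apply/andP; split; first by rewrite divr_ge0 ?ler0n//; lra.
by rewrite ler_pdivrMr// mul1r; lra.
Qed.

Definition abscissa_time (v : R) : R := (v / rad + 1) / 2.

Lemma diameter_time v : diameter (abscissa_time v) = (v, 0).
Proof.
rewrite /diameter /abscissa_time; congr (_, _).
by have := lt0r_neq0 rad_gt0 => ?; field.
Qed.

Lemma unit_abscissa_time (v : nat) : (v <= n)%N -> unit_segment (abscissa_time v%:R).
Proof.
move=> vn; rewrite /unit_segment /= in_itv /= /abscissa_time.
have h0 : 0 <= v%:R / rad by rewrite divr_ge0 ?ler0n// ltW// rad_gt0.
have h1 : v%:R / rad <= 1.
  rewrite ler_pdivrMr ?rad_gt0// mul1r /rad.
  have : (v%:R : R) <= n%:R by rewrite ler_nat.
  have : (0 : R) <= n%:R by exact: ler0n.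
  by rewrite -natr1 -natr1; lra.
by apply/andP; split; lra.
Qed.

Lemma intersectionE z : intersection arcs diameter z <->
  exists2 k, (1 <= k <= n)%N & z = ((q k)%:R, 0).
Proof.
split.
  move=> [[s us sz] [t ut tz]].
  have /(ycoord_eq0 (param_window us))[k kn kE] : y (param s) = 0.
    by have : (arcs s).2 = (diameter t).2 by rewrite sz tz.
  by exists k => //; rewrite -sz; exact: arcs_node.
move=> [k kn ->]; split.
  by exists (time k); [exact: unit_time|exact: (arcs_node kn (param_time k))].
exists (abscissa_time (q k)%:R); last exact: diameter_time.
by apply: unit_abscissa_time; have /andP[] := label_inner kn.
Qed.

Lemma arcs_transverse : transverse arcs diameter.
Proof.
move=> s t us ut E v.
have /(ycoord_eq0 (param_window us))[k /andP[k1 kn] kE] : y (param s) = 0.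
  by have : (arcs s).2 = (diameter t).2 by rewrite E.
have u01 : 0 <= (0 : R) <= 1 by rewrite lexx ler01.
rewrite derive_arcs derive_diameter kE -[k%:R]addr0 dxcoordE// dycoordE//.
rewrite dramp_eq0; last by left; lra.
(* At a node the abscissa is stationary, so the velocity is the vertical vector [(0, d)], against
   the horizontal diameter. *)
set d := (-1) ^+ k * _ * _.
have d0 : d != 0.
  apply: mulf_neq0; last by rewrite gt_eqF.
  apply: mulf_neq0; first by rewrite signr_eq0.
  by apply: darc_height_neq0; rewrite ?height_ge0//; left; lra.
exists (v.2 / d), (v.1 / (2 * rad)).
apply: injective_projections => /=; rewrite /GRing.scale /=.
  by rewrite mulr0 mul0r mulr0 add0r divfK// mulf_neq0 ?pnatr_eq0// gt_eqF// rad_gt0.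
by rewrite mulr0 addr0 divfK.
Qed.

Lemma arcs_start : arcs 0 = (- half_chord 0, 1 + height 0).
Proof.
have u01 : 0 <= (2^-1 : R) <= 1 by apply/andP; split; lra.
rewrite /arcs /param mulr0 addr0 -[2^-1](add0r) -[0]/(0%:R) xcoordE// ycoordE//.
rewrite arc_height_half ramp_half expr0 mul1r node0 node_inner; last by rewrite n1.
by congr (_, _); field.
Qed.

Lemma arcs_stop : arcs 1 = (half_chord n, (-1) ^+ n * (1 + height n)).
Proof.
have u01 : 0 <= (2^-1 : R) <= 1 by apply/andP; split; lra.
rewrite /arcs /param mulr1 addrC xcoordE// ycoordE//.
rewrite arc_height_half ramp_half node_end node_inner; last by rewrite n1 leqnn.
by congr (_, _); field.
Qed.

Lemma diameter_start : diameter 0 = (- rad, 0).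
Proof. by rewrite /diameter mulr0 addr0. Qed.

Lemma diameter_stop : diameter 1 = (rad, 0).
Proof. by rewrite /diameter; congr (_, _); ring. Qed.

Let w_gt0 k : (k <= n)%N -> 0 < half_chord k.
Proof. by move=> /half_chord_gt; apply: le_lt_trans; exact: ler0n. Qed.

Let top_neq0 k : (-1) ^+ k * (1 + height k) != 0.
Proof.
by rewrite mulf_neq0 ?signr_eq0// gt_eqF// ltr_wpDr ?height_ge0.
Qed.

Lemma ends_uniq : uniq [:: arcs 0; arcs 1; diameter 0; diameter 1].
Proof.
rewrite arcs_start arcs_stop diameter_start diameter_stop /= !inE !xpair_eqE.
have := rad_gt0; have := w_gt0 (leq0n n); have := w_gt0 (leqnn n) => h1 h2 h3.
have H1 : (- half_chord 0 == half_chord n) = false by rewrite lt_eqF//; lra.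
have H2 : (1 + height 0 == 0) = false by rewrite gt_eqF// ltr_wpDr ?height_ge0.
have H3 : (- rad == rad) = false by rewrite lt_eqF//; lra.
by rewrite H1 H2 H3 (negPf (top_neq0 n)) !andbF.
Qed.

Lemma ends_boundary : [/\ disk_boundary (0, 0) rad (arcs 0),
  disk_boundary (0, 0) rad (arcs 1), disk_boundary (0, 0) rad (diameter 0) &
  disk_boundary (0, 0) rad (diameter 1)].
Proof.
have [_ a] := arcs_proper; have [_ d] := diameter_proper.
have u0 : unit_segment (0 : R) by rewrite /unit_segment /= in_itv /= lexx ler01.
have u1 : unit_segment (1 : R) by rewrite /unit_segment /= in_itv /= lexx ler01.
by split; [apply/(a _ u0)|apply/(a _ u1)|apply/(d _ u0)|apply/(d _ u1)]; auto.
Qed.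

Lemma ends_component : exists2 z : R * R,
  (disk_boundary (0, 0) rad `\` [set arcs 0; diameter 0]) z &
  connected_component (disk_boundary (0, 0) rad `\` [set arcs 0; diameter 0]) z (arcs 1) /\
  connected_component (disk_boundary (0, 0) rad `\` [set arcs 0; diameter 0]) z (diameter 1).
Proof.
set D := _ `\` _; pose b := (-1) ^+ n * (1 + height n).
(* The right half of the circle, parametrised by the ordinate; it joins [diameter 1] to [arcs 1],
   whose ordinate is [b], while both removed points have negative abscissa. *)
pose f (t : R) : R * R := (Num.sqrt (rad ^+ 2 - t ^+ 2), t).
pose C := f @` between 0 b.
have r0 := rad_gt0; have w0 := w_gt0 (leq0n n).
have b2 : b ^+ 2 = (1 + height n) ^+ 2 by rewrite exprMn sqrr_sign mul1r.
have f0 : f 0 = diameter 1.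
  by rewrite diameter_stop /f expr0n subr0 sqrtr_sqr ger0_norm// ltW.
have fb : f b = arcs 1 by rewrite arcs_stop /f b2.
have CD : C `<=` D.
  move=> _ [t /in_between tb <-]; split.
    rewrite /disk_boundary /= !subr0 sqr_sqrtr ?subrK//.
    have := half_chord_sqr (leqnn n); have := sqr_ge0 (half_chord n).
    rewrite -b2 subr_ge0 => ? ?.
    have : t ^+ 2 <= b ^+ 2 by case: tb => /andP[? ?]; nra.
    by lra.
  have f1 : 0 <= (f t).1 by exact: sqrtr_ge0.
  by case=> E; move: f1; rewrite E ?arcs_start ?diameter_start /=; lra.
have connC : connected C.
  apply: connected_continuous_connected; first exact: connected_between.
  apply: continuous_subspaceT => t.
  apply: (@continuous_pair _ _ _ (fun t : R => Num.sqrt (rad ^+ 2 - t ^+ 2)) id) => //.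
  apply: (@continuous_comp _ _ _ (fun t : R => rad ^+ 2 - t ^+ 2)).
    by apply: cvgB; [exact: cvg_cst|exact: exprn_continuous].
  exact: sqrt_continuous.
have C0 : C (diameter 1) by exists 0 => //; exact: between_l.
have C1 : C (arcs 1) by exists b => //; exact: between_r.
exists (diameter 1); first exact: CD.
by split; apply: (connected_component_max C0 CD connC).
Qed.

Lemma intersection_card : (intersection arcs diameter #= `I_n)%card.
Proof.
rewrite (_ : intersection _ _ = (fun k => ((q k.+1)%:R, 0)) @` `I_n).
  apply: inj_card_eq => i j; rewrite !inE /= => iN jN [/eqP].
  by rewrite eqr_nat => /eqP /(label_inj (leqW iN) (leqW jN)) [].
apply/seteqP; split => z.
  by move=> /intersectionE[[|k]// kn ->]; exists k.
by move=> [k /= kn <-]; apply/intersectionE; exists k.+1.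
Qed.

Lemma assembled_meandric : meandric R p.
Proof.
pose M := @Meander R n (0, 0) rad (arcs 0) (arcs 1) (diameter 0) (diameter 1)
  arcs diameter rad_gt0 ends_uniq ends_boundary ends_component arcs_embedding
  arcs_proper (conj erefl erefl) diameter_embedding diameter_proper
  (conj erefl erefl) arcs_transverse intersection_card.
exists M, (fun k : 'I_n => ((q k.+1)%:R, 0)), (fun v : 'I_n => (v.+1%:R, 0)).
split.
- split.
    apply/seteqP; split => z.
      by move=> [k _ <-]; apply/intersectionE; exists k.+1; rewrite ?ltn_ord.
    by move=> /intersectionE[[|k]// kn ->]; exists (Ordinal (kn : (k < n)%N)).
  exists (fun k : 'I_n => time k.+1); split => [k|i j ij|k].
  + by apply: unit_time; exact: ltn_ord.
  + by rewrite ltr_pM2r ?invr_gt0// ltrD2r ltr_nat.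
  + by apply: arcs_node (param_time _); exact: ltn_ord.
- split.
    apply/seteqP; split => z.
      move=> [v _ <-]; apply/intersectionE; exists ((p^-1)%g v).+1; first exact: ltn_ord.
      by rewrite label_of_ord permKV.
    by move=> /intersectionE[_ /ordP[k ->] ->]; exists (p k) => //; rewrite label_of_ord.
  exists (fun v : 'I_n => abscissa_time v.+1%:R); split => [v|i j ij|v].
  + exact/unit_abscissa_time/ltn_ord.
  + rewrite ltr_pM2r ?invr_gt0// ltrD2r ltr_pM2r ?invr_gt0 ?rad_gt0//.
    by rewrite ltr_nat.
  + exact: diameter_time.
- by move=> k; rewrite label_of_ord.
Qed.

End Assembly.

Theorem corollary5p5 (R : realType) (n : nat) (n_ge1 : (1 <= n)%N)
    (p : 'S_n) :
  meandric R p <->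
  (forall i j : 'I_n,
     common_inversions p i j = (if inversion p i j then 1 else 0) %[mod 2])%N.
Proof.
split=> [[M Mp] i j|cond].
  exact/common_inversions_mod2/(meander_common_inversions Mp).
apply: assembled_meandric => // i j.
exact/common_inversions_mod2.
Qed.
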